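(* Let $\mathsf{DerCom}$ be the symmetric two-coloured operad (colours $S$, $L$) generated by a symmetric operation $\alpha:S\otimes S\to S$, a skew-symmetric operation $\beta:L\otimes L\to L$, and operations $d:S\otimes L\to S$, $m:S\otimes L\to L$ (no symmetry), subject to the relations $$\alpha(\alpha(x_1,x_2),x_3)-\alpha(x_1,\alpha(x_2,x_3))=0,$$ $$\beta(\beta(x_1,x_2),x_3)-\beta(\beta(x_1,x_3),x_2)-\beta(x_1,\beta(x_2,x_3))=0,$$ $$d(\alpha(x_1,x_2),x_3)=\alpha(x_1,d(x_2,x_3))+\alpha(d(x_1,x_3),x_2),$$ $$d(x_1,\beta(x_2,x_3))=d(d(x_1,x_3),x_2)-d(d(x_1,x_2),x_3),$$ $$m(\alpha(x_1,x_2),x_3)=m(x_1,m(x_2,x_3)).$$ Then the ideal of relations of the associated shuffle two-coloured operad, with generators $\alpha,\beta,d,e,m,n$, where $e(x_1,x_2)=d(x_2,x_1)$ and $n(x_1,x_2)=m(x_2,x_1)$, admits a quadratic Gröbner basis with respect to the three-level QM-ordering described in the context.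
   Context: Work over a field $\Bbbk$ of characteristic $0$. Let $I$ be a finite set of colours. A symmetric $I$-coloured operad $P$ consists of finite-dimensional spaces $P(n,\chi,c)$ for $n\ge 1$, $\chi:\{1,\dots,n\}\to I$ (input colours), $c\in I$ (output colour), with symmetric group actions $\sigma:P(n,\chi,c)\to P(n,\chi\sigma,c)$, partial compositions $\circ_l$ defined when the colour of the $l$-th input equals the output colour of the inserted operation, and identities $\mathrm{id}_c$, satisfying the usual operad axioms. Free shuffle coloured operad. Given generators, each with an arity, an ordered list of input colours and an output colour, the free shuffle $I$-coloured operad has as basis the tree monomials: planar rooted trees with vertices labelled by generators, edge colours matching the input/output colours of the generators, and leaves labelled bijectively by $1,\dots,n$ so that at every vertex the smallest leaf labels of the subtrees above its inputs increase from left to right. Shuffle compositions $\mu\circ_{l,\omega}\nu$ graft $\nu$ on the leaf $l$ of $\mu$ (colours matching) and relabel the leaves by $\omega$, preserving the relative orders of labels coming from $\mu$ and from $\nu$, so that the result is again a shuffle tree. An operadic ideal is a collection of subspaces, one for each arity, input colouring and output colour, closed under compositions with arbitrary elements on either side. A symmetric operad given by generators and relations yields a shuffle operad: its generators are all generators together with a basis of their symmetric group orbits, and its relations are all elements of the symmetric group orbits of the relations, rewritten as combinations of shuffle tree monomials. An ordering of tree monomials is admissible if monomials of smaller arity are smaller and $\mu\le\mu'$, $\nu\le\nu'$ (with $\mu,\mu'$ of the same arity and $\nu,\nu'$ of the same arity) imply $\mu\circ_{l,\omega}\nu\le\mu'\circ_{l,\omega}\nu'$ for all possible compositions. Three-level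 QM-ordering: consider the algebra generated by $\alpha,d,e,m,n,\beta,q$ with $q$ central and relations $u\alpha=\alpha u q$ for $u\in\{d,e,m,n,\beta\}$ and $uv=vuq$ for $u\in\{m,n,\beta\}$, $v\in\{d,e\}$. Every word in the generators has a normal form $w_\alpha w_{d,e}w_{m,n,\beta}q^{d_q}$, with $w_\alpha$ a word in $\alpha$ of length $d_\alpha$, $w_{d,e}$ a word in $d,e$ of length $d_{(d,e)}$ and $w_{m,n,\beta}$ a word in $m,n,\beta$ of length $d_{(m,n,\beta)}$. To compare two words: the one with smaller $d_\alpha$ is greater; if equal, the one with smaller $d_{(d,e)}$ is greater; if equal, the one with greater $d_{(m,n,\beta)}$ is greater; if equal, the one with greater $d_q$ is greater. To compare tree monomials, compare arities first (smaller arity is smaller); for equal arity $k$ compare the vectors $(a_1,\dots,a_k)$, where $a_j$ is the word of vertex labels on the path from the root to leaf $j$, component by component using this comparison of words. This is a partial ordering; any extension of it to an admissible total ordering may be used. Gröbner bases: the leading term of an element is its largest tree monomial. For a subtree (containing all edges adjacent to its vertices) of a tree monomial, its leaves are relabelled according to the order of the smallest leaf labels above them; $\mu$ is divisible by $\nu$ if $\nu$ arises in this way from a subtree of $\mu$. A generating set $G$ of an operadic ideal $M$ is a Gröbner basis if the leading term of every nonzero $f\in M$ is divisible by the leading term of some element of $G$. It is quadratic if all its elements are combinations of tree monomials with two vertices.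
   Formalization: The vectors (a_1,...,a_k) are compared one criterion at a time (d_alpha along all components, then d_(d,e), then d_(m,n,beta), then d_q), not word by word: for the word-by-word lexicographic extension the relations have no quadratic Gröbner basis. *)

(* Defs.v *)
From HB Require Import structures.
From mathcomp Require Import all_boot all_order all_algebra.
From mathcomp Require Import finmap.
From mathcomp.multinomials Require Import monalg.

Set Implicit Arguments.
Unset Strict Implicit.
Unset Printing Implicit Defensive.

Import Order.TTheory GRing.Theory Num.Theory.

(** * Two-coloured trees with binary vertices *)

Variant col := colS | colL.

Definition bool_of_col (c : col) : bool := if c is colS then true else false.
Definition col_of_bool (b : bool) : col := if b then colS else colL.
Lemma bool_of_colK : cancel bool_of_col col_of_bool. Proof. by case. Qed.
HB.instance Definition _ := Countable.copy col (can_type bool_of_colK).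

(* Vertices are labelled in X, leaves by positive integers.  A leaf carries its
   colour, so that [Leaf c 1] is the identity of colour c. *)
Inductive tree (X : Type) : Type :=
  | Leaf of col & nat
  | Node of X & tree X & tree X.

Arguments Leaf {X} c i.

Section TreeChoice.
Variable X : choiceType.

Fixpoint encode_tree (t : tree X) : GenTree.tree (col * nat + X) :=
  match t with
  | Leaf c i => GenTree.Leaf (inl (c, i))
  | Node x a b =>
      GenTree.Node 0 [:: GenTree.Leaf (inr x); encode_tree a; encode_tree b]
  end.

Fixpoint decode_tree (t : GenTree.tree (col * nat + X)) : option (tree X) :=
  match t with
  | GenTree.Leaf (inl (c, i)) => Some (Leaf c i)
  | GenTree.Node 0 [:: GenTree.Leaf (inr x); a; b] =>
      if (decode_tree a, decode_tree b) is (Some a', Some b')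
      then Some (Node x a' b') else None
  | _ => None
  end.

Lemma encode_treeK : pcancel encode_tree decode_tree.
Proof. by elim=> //= x a -> b ->. Qed.

HB.instance Definition _ := Choice.copy (tree X) (pcan_type encode_treeK).
End TreeChoice.

Section Trees.
Variable X : Type.
Implicit Types t : tree X.

Fixpoint leaves t : seq (nat * col) :=
  match t with
  | Leaf c i => [:: (i, c)]
  | Node _ a b => leaves a ++ leaves b
  end.

Definition labels t : seq nat := unzip1 (leaves t).

Definition arity t : nat := size (leaves t).

Fixpoint minlabel t : nat :=
  match t with
  | Leaf _ i => i
  | Node _ a b => minn (minlabel a) (minlabel b)
  end.

Definition leafcol t (i : nat) : col :=
  nth colS (unzip2 (leaves t)) (index i (labels t)).

Definition incols t : seq col := [seq leafcol t i | i <- iota 1 (arity t)].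

Fixpoint vertices t : nat :=
  match t with
  | Leaf _ _ => 0
  | Node _ a b => (vertices a + vertices b).+1
  end.

Fixpoint relabel (f : nat -> nat) t : tree X :=
  match t with
  | Leaf c i => Leaf c (f i)
  | Node x a b => Node x (relabel f a) (relabel f b)
  end.

(* [graft l f s t] replaces the leaf l of t by s and relabels the others by f. *)
Fixpoint graft (l : nat) (f : nat -> nat) (s t : tree X) : tree X :=
  match t with
  | Leaf c i => if i == l then s else Leaf c (f i)
  | Node x a b => Node x (graft l f s a) (graft l f s b)
  end.

Fixpoint path_word t (i : nat) : seq X :=
  match t with
  | Leaf _ _ => [::]
  | Node x a b => x :: (if i \in labels a then path_word a i else path_word b i)
  end.

Definition path_words t : seq (seq X) := [seq path_word t i | i <- iota 1 (arity t)].

End Trees.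

(** * The free shuffle coloured operad on alpha, beta, d, e, m, n *)

Variant gen := opAlpha | opBeta | opD | opE | opM | opN.

Definition nat_of_gen (x : gen) : nat :=
  match x with
  | opAlpha => 0 | opBeta => 1 | opD => 2 | opE => 3 | opM => 4 | opN => 5
  end.
Definition gen_of_nat : nat -> gen :=
  nth opAlpha [:: opAlpha; opBeta; opD; opE; opM; opN].
Lemma nat_of_genK : cancel nat_of_gen gen_of_nat. Proof. by case. Qed.
HB.instance Definition _ := Countable.copy gen (can_type nat_of_genK).

Definition incol1 (x : gen) : col :=
  match x with opAlpha | opD | opM => colS | opBeta | opE | opN => colL end.
Definition incol2 (x : gen) : col :=
  match x with opAlpha | opE | opN => colS | opBeta | opD | opM => colL end.
Definition gen_outcol (x : gen) : col :=
  match x with opAlpha | opD | opE => colS | opBeta | opM | opN => colL end.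

Definition outcol (t : tree gen) : col :=
  match t with Leaf c _ => c | Node x _ _ => gen_outcol x end.

Fixpoint well_coloured (t : tree gen) : bool :=
  match t with
  | Leaf _ _ => true
  | Node x a b => [&& outcol a == incol1 x, outcol b == incol2 x,
                      well_coloured a & well_coloured b]
  end.

Fixpoint shuffle_tree (t : tree gen) : bool :=
  match t with
  | Leaf _ _ => true
  | Node _ a b => [&& minlabel a < minlabel b, shuffle_tree a & shuffle_tree b]
  end.

Definition tree_monomial : pred (tree gen) := fun t =>
  [&& well_coloured t, shuffle_tree t
    & perm_eq (labels t) (iota 1 (arity t))].

(* chi lists the colours of the inputs 1, ..., size chi. *)
Definition component_basis (chi : seq col) (c : col) : pred (tree gen) :=
  fun t => [&& tree_monomial t, incols t == chi & outcol t == c].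

(* The data (l, omega) of a shuffle composition of mu of arity k with nu of
   arity r: omega is the pair of the relabellings f of mu and g of nu.  The
   leaf l of mu takes part in the ordering of the labels of mu, and its place is
   taken by the smallest label of nu; this is what makes the result a shuffle
   tree whatever mu and nu are. *)
Definition shuffle (k r l : nat) (f g : nat -> nat) : Prop :=
  [/\ 1 <= l <= k,
      {in iota 1 k &, {homo f : i j / i < j}},
      {in iota 1 r &, {homo g : i j / i < j}},
      f l = g 1 &
      perm_eq ([seq f i | i <- iota 1 k & i != l] ++ [seq g j | j <- iota 1 r])
              (iota 1 (k + r - 1))].

Definition comp_tree (l : nat) (f g : nat -> nat) (mu nu : tree gen) :
    tree gen :=
  graft l f (relabel g nu) mu.

Definition comp_incols (f g : nat -> nat) (chi chi' : seq col) : seq col :=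
  let gs := [seq g j | j <- iota 1 (size chi')] in
  let fs := [seq f i | i <- iota 1 (size chi)] in
  [seq if p \in gs then nth colS chi' (index p gs)
       else nth colS chi (index p fs)
  | p <- iota 1 (size chi + size chi' - 1)].

Section FreeOperad.
Variable F : fieldType.

Local Open Scope ring_scope.

Definition in_component (chi : seq col) (c : col) (u : {malg F[tree gen]}) :
    Prop :=
  forall t, t \in msupp u -> component_basis chi c t.

Definition comp_element (l : nat) (f g : nat -> nat) (u v : {malg F[tree gen]}) :
    {malg F[tree gen]} :=
  \sum_(s <- msupp u) \sum_(t <- msupp v)
    << u@_s * v@_t *g comp_tree l f g s t >>.

Definition component_family := seq col -> col -> {malg F[tree gen]} -> Prop.

Record operadic_ideal (M : component_family) : Prop := OperadicIdeal {
  ideal_homogeneous : forall chi c u, M chi c u -> in_component chi c u;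
  ideal0 : forall chi c, M chi c 0;
  idealZD : forall chi c (a : F) u v,
    M chi c u -> M chi c v -> M chi c (a *: u + v);
  ideal_compl : forall chi c chi' l f g u v,
    M chi c u -> in_component chi' (nth colS chi l.-1) v ->
    shuffle (size chi) (size chi') l f g ->
    M (comp_incols f g chi chi') c (comp_element l f g u v);
  ideal_compr : forall chi c chi' l f g u v,
    in_component chi c u -> M chi' (nth colS chi l.-1) v ->
    shuffle (size chi) (size chi') l f g ->
    M (comp_incols f g chi chi') c (comp_element l f g u v)
}.

Definition generated_ideal (G : {malg F[tree gen]} -> Prop) :
    component_family :=
  fun chi c u => forall M : component_family, operadic_ideal M ->
    (forall chi' c' v, G v -> in_component chi' c' v -> M chi' c' v) ->
    M chi c u.

End FreeOperad.

(** * Relations of DerCom and of the associated shuffle operad *)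

Variant symgen := symAlpha | symBeta | symD | symM.

Definition shuffle_gen (x : symgen) : gen :=
  match x with
  | symAlpha => opAlpha | symBeta => opBeta | symD => opD | symM => opM
  end.

(* x(a, b) = +/- (opposite_gen x)(b, a), with a minus sign for beta only. *)
Definition opposite_gen (x : symgen) : gen :=
  match x with
  | symAlpha => opAlpha | symBeta => opBeta | symD => opE | symM => opN
  end.
Definition opposite_sign (x : symgen) : bool :=
  if x is symBeta then true else false.

(* The Boolean is true when the shuffle tree appears with coefficient -1. *)
Fixpoint shuffle_form (t : tree symgen) : bool * tree gen :=
  match t with
  | Leaf c i => (false, Leaf c i)
  | Node x a b =>
      let: (sa, a') := shuffle_form a in
      let: (sb, b') := shuffle_form b in
      if minlabel a' < minlabel b'
      then (sa (+) sb, Node (shuffle_gen x) a' b')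
      else (sa (+) sb (+) opposite_sign x, Node (opposite_gen x) b' a')
  end.

Section DerCom.

Let alpha := Node symAlpha.
Let beta := Node symBeta.
Let d := Node symD.
Let m := Node symM.
Let s (i : nat) : tree symgen := Leaf colS i.
Let y (i : nat) : tree symgen := Leaf colL i.

(* A relation is the list of its terms, with their coefficients; the arguments
   x_i are written s i or y i according to their colour. *)
Definition dercom_relations : seq (seq (int * tree symgen)) :=
  [:: [:: (1%R, alpha (alpha (s 1) (s 2)) (s 3));
          ((-1)%R, alpha (s 1) (alpha (s 2) (s 3)))];
      [:: (1%R, beta (beta (y 1) (y 2)) (y 3));
          ((-1)%R, beta (beta (y 1) (y 3)) (y 2));
          ((-1)%R, beta (y 1) (beta (y 2) (y 3)))];
      [:: (1%R, d (alpha (s 1) (s 2)) (y 3));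
          ((-1)%R, alpha (s 1) (d (s 2) (y 3)));
          ((-1)%R, alpha (d (s 1) (y 3)) (s 2))];
      [:: (1%R, d (s 1) (beta (y 2) (y 3)));
          ((-1)%R, d (d (s 1) (y 3)) (y 2));
          (1%R, d (d (s 1) (y 2)) (y 3))];
      [:: (1%R, m (alpha (s 1) (s 2)) (y 3));
          ((-1)%R, m (s 1) (m (s 2) (y 3)))]].

End DerCom.

Section ShuffleRelations.
Variable F : fieldType.

Local Open Scope ring_scope.

Definition shuffle_element (r : seq (int * tree symgen)) (sigma : nat -> nat) :
    {malg F[tree gen]} :=
  \sum_(p <- r) let: (b, t) := shuffle_form (relabel sigma p.2) in
                << (-1) ^+ b * p.1%:~R *g t >>.

Definition dercom_shuffle_relation (u : {malg F[tree gen]}) : Prop :=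
  exists (sigma : nat -> nat) (i : nat),
    [/\ (i < size dercom_relations)%N,
        perm_eq [seq sigma j | j <- iota 1 3] (iota 1 3) &
        u = shuffle_element (nth [::] dercom_relations i) sigma].

End ShuffleRelations.

(** * Admissible orderings *)

Definition total_order_on_monomials (le : rel (tree gen)) : Prop :=
  [/\ {in tree_monomial, reflexive le},
      {in tree_monomial &, antisymmetric le},
      {in tree_monomial & &, transitive le} &
      {in tree_monomial &, total le}].

Definition admissible (le : rel (tree gen)) : Prop :=
  {in tree_monomial &, forall s t, arity s < arity t -> le s t} /\
  (forall mu mu' nu nu' l f g,
     tree_monomial mu -> tree_monomial mu' ->
     tree_monomial nu -> tree_monomial nu' ->
     arity mu = arity mu' -> arity nu = arity nu' ->
     leafcol mu l = outcol nu -> leafcol mu' l = outcol nu' ->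
     shuffle (arity mu) (arity nu) l f g ->
     le mu mu' -> le nu nu' ->
     le (comp_tree l f g mu nu) (comp_tree l f g mu' nu')).

(** * The three-level QM-ordering *)

(* The normal form w_alpha w_{d,e} w_{m,n,beta} q^{d_q} of a word. *)
Record qmonomial := QMonomial {
  q_alpha : seq gen;
  q_de : seq gen;
  q_mnbeta : seq gen;
  q_exp : nat
}.

(* The first letter of the word is moved to its place in the normal form of the
   rest; each exchange with a letter of a lower level contributes a factor q. *)
Fixpoint qnormal (w : seq gen) : qmonomial :=
  if w isn't u :: w' then QMonomial [::] [::] [::] 0 else
  let: QMonomial wa wd wm k := qnormal w' in
  match u with
  | opAlpha => QMonomial (u :: wa) wd wm k
  | opD | opE => QMonomial wa (u :: wd) wm (k + size wa)
  | opM | opN | opBeta => QMonomial wa wd (u :: wm) (k + size wa + size wd)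
  end.

(* The four successive criteria in the comparison of words, with signs such
   that a greater value always makes the word greater. *)
Definition qcriterion (i : nat) (w : seq gen) : int :=
  let: QMonomial wa wd wm k := qnormal w in
  nth 0%R [:: - (size wa)%:Z; - (size wd)%:Z; (size wm)%:Z; k%:Z]%R i.

Definition lex_lt (x y : seq int) : bool :=
  ((x : seqlexi int) < (y : seqlexi int))%O.

Definition qword_lt (w w' : seq gen) : bool :=
  lex_lt [seq qcriterion i w | i <- iota 0 4]
         [seq qcriterion i w' | i <- iota 0 4].

(* Trees of the same arity are compared criterion by criterion, and for each
   criterion component by component along (a_1, ..., a_k).  This refines the
   componentwise comparison of the vectors of words (qm_lt_componentwise).
   Comparing a_1 by all four criteria before looking at a_2 is a different
   refinement, for which the ideal of relations of DerCom has no quadratic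
   Groebner basis: the element
     alpha(d(alpha(1,3),4),2) + alpha(d(alpha(1,2),4),3)
       - alpha(alpha(d(1,4),2),3) - d(alpha(alpha(1,2),3),4)
   of the ideal would be reduced. *)
Definition qm_vector (t : tree gen) : seq int :=
  flatten [seq [seq qcriterion i w | w <- path_words t] | i <- iota 0 4].

Definition qm_lt (s t : tree gen) : bool :=
  (arity s < arity t) ||
  ((arity s == arity t) && lex_lt (qm_vector s) (qm_vector t)).

Section Componentwise.

Lemma lex_lt_cons (a b : int) (x y : seq int) :
  lex_lt (a :: x) (b :: y) = (a < b)%O || ((a == b) && lex_lt x y).
Proof. by rewrite /lex_lt ltxi_cons; case: (comparableP a b) => // _. Qed.

Lemma lex_lt_cat (x y x' y' : seq int) : size x = size y ->
  lex_lt (x ++ x') (y ++ y') = lex_lt x y || ((x == y) && lex_lt x' y').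
Proof.
elim: x y => [|a x IH] [|b y] //= [eq_sz].
by rewrite !lex_lt_cons IH // eqseq_cons; case: ltgtP.
Qed.

Lemma lex_lt_pointwise (T : Type) (c c' : T -> int) (r : seq T) :
  all (fun j => (c j <= c' j)%O) r ->
  [seq c j | j <- r] != [seq c' j | j <- r] ->
  lex_lt [seq c j | j <- r] [seq c' j | j <- r].
Proof.
elim: r => [|j r IH] //= /andP[le_j le_r].
rewrite eqseq_cons lex_lt_cons.
by case: ltgtP le_j => //= _ _; apply: IH.
Qed.

Lemma qm_lt_componentwise (s t : tree gen) :
  arity s = arity t ->
  (forall j, j \in iota 1 (arity s) ->
     ~~ qword_lt (path_word t j) (path_word s j)) ->
  (exists2 j, j \in iota 1 (arity s) &
     qword_lt (path_word s j) (path_word t j)) ->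
  qm_lt s t.
Proof.
move=> eq_ar; rewrite /qm_lt /qm_vector /path_words -eq_ar eqxx ltnn orFb andTb.
rewrite /qword_lt; move: (iota 1 (arity s)) (iota 0 4) => r I.
elim: I => [|i I IH] /=; first by move=> _ [].
move=> le_st [j0 j0r lt_j0]; rewrite -!map_comp lex_lt_cat ?size_map //.
have le_i : all (fun j => (qcriterion i (path_word s j) <=
                            qcriterion i (path_word t j))%O) r.
  by apply/allP => j /le_st; rewrite lex_lt_cons negb_or -leNgt => /andP[].
case: eqP => [eq_i|/eqP ne_i] /=; last by rewrite lex_lt_pointwise.
have eqj j : j \in r ->
    qcriterion i (path_word s j) = qcriterion i (path_word t j).
  by move/eq_in_map: eq_i; apply.
rewrite orbC IH //.
  by move=> j jr; move: (le_st j jr); rewrite lex_lt_cons eqj // ltxx eqxx.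
by exists j0 => //; move: lt_j0; rewrite lex_lt_cons eqj // ltxx eqxx.
Qed.

End Componentwise.

Definition qm_ordering (le : rel (tree gen)) : Prop :=
  [/\ total_order_on_monomials le,
      admissible le &
      {in tree_monomial &, forall s t, qm_lt s t -> le s t && (s != t)}].

(** * Groebner bases *)

(* [truncation t s]: s is a subtree of t with the same root, each removed part
   being replaced by a leaf with the smallest label of that part. *)
Inductive truncation : tree gen -> tree gen -> Prop :=
  | TruncLeaf t : truncation t (Leaf (outcol t) (minlabel t))
  | TruncNode x a b a' b' : truncation a a' -> truncation b b' ->
      truncation (Node x a b) (Node x a' b').

Inductive subtree : tree gen -> tree gen -> Prop :=
  | SubtreeRoot t s : truncation t s -> subtree t s
  | SubtreeLeft x a b s : subtree a s -> subtree (Node x a b) s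
  | SubtreeRight x a b s : subtree b s -> subtree (Node x a b) s.

Definition standardize (t : tree gen) : tree gen :=
  relabel (fun i => count (fun j => j <= i) (labels t)) t.

Definition divides (nu mu : tree gen) : Prop :=
  exists2 s, subtree mu s & nu = standardize s.

Section Groebner.
Variable F : fieldType.

Definition leading_term (le : rel (tree gen)) (u : {malg F[tree gen]})
    (t : tree gen) : Prop :=
  t \in msupp u /\ (forall s, s \in msupp u -> le s t).

Definition groebner_basis (le : rel (tree gen)) (M : component_family F)
    (G : {malg F[tree gen]} -> Prop) : Prop :=
  [/\ forall v, G v -> exists chi c, in_component chi c v,
      forall chi c u, M chi c u <-> generated_ideal G chi c u &
      forall chi c u t, M chi c u -> leading_term le u t ->
        exists v t', [/\ G v, leading_term le v t' & divides t' t]].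

Definition quadratic (G : {malg F[tree gen]} -> Prop) : Prop :=
  forall v t, G v -> t \in msupp v -> vertices t = 2.

End Groebner.

(* Main.v *)
From HB Require Import structures.
Require Import Defs.
From mathcomp Require Import all_boot all_order all_algebra.
From mathcomp Require Import finmap.
From mathcomp.multinomials Require Import monalg.
From mathcomp Require Import zify ring.

(** No overlap of two rules is ever resolved. The obstacle is to keep the lead under control through
    nesting, a bracket inside an m inside a bracket and so on. A letter therefore exposes the least
    leaf label of the tree behind it, which is all that an outer bracket compares, and accumulates
    in its weight how far inner terms lie above inner leads. Values and weights never fall below
    those of the lead, so a sum of excesses vanishes only if each of them does; this replaces a
    lexicographic comparison through the levels. Words are read as numerals in base [N], where [N]
    exceeds every leaf label. On the rewriting side each step is decided by the numbers of alpha, of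
    d and e, and of m, n and beta on the paths to the leaves. These numbers are additive along a
    path, so a surrounding tree shifts both sides of a step by the same amount. *)

(* Reducing by the relations rewrites every tree monomial, modulo the ideal, into
   smaller ones until no redex is left, so it is enough that the normal trees are
   linearly independent modulo the ideal.  This is seen in one DerCom algebra.
   Its L-part is a free associative algebra T on letters, with the commutator;
   its S-part is the commutative algebra freely generated by the elements i.w,
   for w a word, on which d acts by the derivations i.w |-> i.(uw); and m(s, w)
   is a new letter, except that m(s, m(s', w)) is m(s s', w).  Evaluated at
   generators, a normal tree gives a combination of basis elements with a unique
   one of least weight, its lead, which has coefficient 1; for the bracket the
   lead is the concatenation of words, as for Lyndon words.  A normal tree can be
   recovered from its lead, whence the independence. *)

Set Implicit Arguments.
Unset Strict Implicit.
Unset Printing Implicit Defensive.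

Import Order.TTheory GRing.Theory Num.Theory.

(** * Trees and shuffle compositions *)

Section TreeCombinatorics.
Variable X : Type.
Implicit Types s t : tree X.

Lemma labels_node x s t : labels (Node x s t) = labels s ++ labels t.
Proof. exact: map_cat. Qed.

Lemma arity_node x s t : arity (Node x s t) = arity s + arity t.
Proof. exact: size_cat. Qed.

Lemma size_labels t : size (labels t) = arity t.
Proof. exact: size_map. Qed.

Lemma arity_gt0 t : 0 < arity t.
Proof. by elim: t => // x s s0 t _; rewrite arity_node addn_gt0 s0. Qed.

Lemma minlabel_in t : minlabel t \in labels t.
Proof.
elim: t => [c i|x s IHs t IHt]; first exact: mem_head.
by rewrite labels_node mem_cat /=; case: leqP => _; rewrite ?IHs ?IHt ?orbT.
Qed.

Lemma minlabel_le t i : i \in labels t -> minlabel t <= i.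
Proof.
elim: t => [c j|x s IHs t IHt]; first by rewrite inE => /eqP ->.
by rewrite labels_node mem_cat geq_min /= => /orP[/IHs -> //|/IHt ->]; rewrite orbT.
Qed.

Lemma minlabelP t i :
  i \in labels t -> {in labels t, forall j, i <= j} -> minlabel t = i.
Proof.
by move=> it le_i; apply/eqP; rewrite eqn_leq minlabel_le // le_i ?minlabel_in.
Qed.

Lemma minlabel_perm s t :
  perm_eq (labels s) (labels t) -> minlabel s = minlabel t.
Proof.
move=> /perm_mem st; apply: minlabelP; first by rewrite st minlabel_in.
by move=> j; rewrite st; apply: minlabel_le.
Qed.

Lemma leaves_relabel f t :
  leaves (relabel f t) = [seq (f p.1, p.2) | p <- leaves t].
Proof. by elim: t => //= x s -> t ->; rewrite map_cat. Qed.

Lemma labels_relabel f t : labels (relabel f t) = map f (labels t).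
Proof. by rewrite /labels /unzip1 leaves_relabel -!map_comp. Qed.

Lemma leaves_graft_notin l f s t : l \notin labels t ->
  graft l f s t = relabel f t.
Proof.
elim: t => [c i|x t1 IH1 t2 IH2] /=.
  by rewrite inE eq_sym => /negPf ->.
by rewrite labels_node mem_cat => /norP[/IH1 -> /IH2 ->].
Qed.

(** Distinct labels ensure that [graft] inserts a single copy of [s]. *)
Lemma perm_leaves_graft l f s t : uniq (labels t) -> l \in labels t ->
  perm_eq (leaves (graft l f s t))
    ([seq (f p.1, p.2) | p <- leaves t & p.1 != l] ++ leaves s).
Proof.
elim: t => [c i|x t1 IH1 t2 IH2].
  by move=> _; rewrite inE => /eqP -> /=; rewrite eqxx /=.
rewrite labels_node cat_uniq mem_cat => /and3P[u1 dis u2].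
have keep t : l \notin labels t -> [seq p <- leaves t | p.1 != l] = leaves t.
  move=> lt; apply/all_filterP/allP => p pt.
  by apply: contraNneq lt => <-; apply: map_f.
case/boolP: (l \in labels t1) => [l1 _|l1 /= l2] /=.
  have l2 : l \notin labels t2.
    by apply: contra dis => l2; apply/hasP; exists l.
  rewrite filter_cat map_cat (leaves_graft_notin _ _ l2) leaves_relabel (keep _ l2) //.
  rewrite -catA perm_sym perm_catCA perm_sym.
  by rewrite perm_catC perm_cat2l IH1.
rewrite filter_cat map_cat (leaves_graft_notin _ _ l1) leaves_relabel (keep _ l1) //.
by rewrite -catA perm_cat2l IH2.
Qed.

Lemma mem_leafcol t i : i \in labels t -> (i, leafcol t i) \in leaves t.
Proof.
move=> it; rewrite /leafcol.
have lt_i : index i (labels t) < size (leaves t).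
  by rewrite -(size_map fst) index_mem.
apply/(nthP (0, colS)); exists (index i (labels t)) => //.
apply/eqP; rewrite -pair_eqE /pair_eq /= (nth_map (0, colS)) // eqxx andbT.
by rewrite -(nth_map _ 0) // nth_index.
Qed.

Lemma leafcolP t i c : uniq (labels t) -> (i, c) \in leaves t -> leafcol t i = c.
Proof.
move=> ut ict; have it : i \in labels t by apply/mapP; exists (i, c).
have /mem_leafcol := it; move: ict.
elim: t ut {it} (leafcol t i) => [c' j|x t1 IH1 t2 IH2] u c1 /=.
  by rewrite !inE => /eqP[_ ->] /eqP[_ ->].
move: u; rewrite labels_node cat_uniq => /and3P[u1 /hasPn dis u2].
rewrite !mem_cat => /orP[a|a] /orP[b|b]; [exact: IH1| | |exact: IH2].
  by case/negP: (dis _ (map_f fst b)); apply/mapP; exists (i, c).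
by case/negP: (dis _ (map_f fst a)); apply/mapP; exists (i, c1).
Qed.

End TreeCombinatorics.

Section ShuffleMonomials.
Implicit Types s t : tree gen.

Lemma monomial_mem t i :
  tree_monomial t -> (i \in labels t) = (1 <= i <= arity t).
Proof. by case/and3P => _ _ /perm_mem ->; rewrite mem_iota; lia. Qed.

Lemma monomial_uniq t : tree_monomial t -> uniq (labels t).
Proof. by case/and3P => _ _ /perm_uniq ->; apply: iota_uniq. Qed.

Lemma minlabel_relabel f t :
  {in labels t &, {homo f : i j / i < j}} ->
  minlabel (relabel f t) = f (minlabel t).
Proof.
move=> homo_f; apply: minlabelP; rewrite labels_relabel.
  by rewrite map_f ?minlabel_in.
move=> _ /mapP[j jt ->]; have := minlabel_le jt; rewrite leq_eqVlt.
by case/orP=> [/eqP -> //|/homo_f lt_f]; rewrite ltnW ?lt_f ?minlabel_in.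
Qed.

Lemma outcol_relabel f t : outcol (relabel f t) = outcol t.
Proof. by case: t. Qed.

Lemma well_coloured_relabel f t : well_coloured (relabel f t) = well_coloured t.
Proof. by elim: t => //= x s -> t ->; rewrite !outcol_relabel. Qed.

Lemma sub_homo f (r r' : seq nat) : {subset r <= r'} ->
  {in r' &, {homo f : i j / i < j}} -> {in r &, {homo f : i j / i < j}}.
Proof. by move=> sub h i j /sub ? /sub ?; apply: h. Qed.

Lemma shuffle_tree_relabel f t : {in labels t &, {homo f : i j / i < j}} ->
  shuffle_tree (relabel f t) = shuffle_tree t.
Proof.
elim: t => //= x s IHs t IHt; rewrite labels_node => hf.
have ss : {subset labels s <= labels s ++ labels t}.
  by move=> i; rewrite mem_cat => ->.
have st : {subset labels t <= labels s ++ labels t}.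
  by move=> i; rewrite mem_cat orbC => ->.
rewrite IHs ?IHt; try exact: sub_homo hf.
rewrite !minlabel_relabel; try exact: sub_homo hf.
congr (_ && _); have := ss _ (minlabel_in s); have := st _ (minlabel_in t).
move: (minlabel s) (minlabel t) => i j ji ii; apply/idP/idP; last exact: hf.
by apply: contraTT; rewrite -!leqNgt leq_eqVlt => /orP[/eqP ->//|/hf/ltnW]; apply.
Qed.

End ShuffleMonomials.

Section Composition.
Variables (mu nu : tree gen) (l : nat) (f g : nat -> nat).
Hypotheses (mu_mon : tree_monomial mu) (nu_mon : tree_monomial nu).
Hypothesis sh : shuffle (arity mu) (arity nu) l f g.

Let fhomo : {in labels mu &, {homo f : i j / i < j}}.
Proof.
case: sh => _ h _ _ _; apply: sub_homo h => i.
by rewrite monomial_mem // mem_iota; lia.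
Qed.

Let ghomo : {in labels nu &, {homo g : i j / i < j}}.
Proof.
case: sh => _ _ h _ _; apply: sub_homo h => i.
by rewrite monomial_mem // mem_iota; lia.
Qed.

Lemma shuffle_leaf : l \in labels mu.
Proof. by rewrite monomial_mem //; case: sh. Qed.

Lemma shuffle_leafE : f l = g 1. Proof. by case: sh. Qed.

Lemma shuffle_homol : {in labels mu &, {mono f : i j / i < j}}.
Proof.
move=> i j im jm; apply/idP/idP; last exact: fhomo.
apply: contraTT; rewrite -!leqNgt leq_eqVlt => /orP[/eqP -> //|/fhomo/ltnW].
exact.
Qed.

Lemma shuffle_homor : {in labels nu &, {mono g : i j / i < j}}.
Proof.
move=> i j im jm; apply/idP/idP; last exact: ghomo.
apply: contraTT; rewrite -!leqNgt leq_eqVlt => /orP[/eqP -> //|/ghomo/ltnW].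
exact.
Qed.

Lemma shuffle_injl : {in labels mu &, injective f}.
Proof.
move=> i j im jm eq_f; apply/eqP; rewrite eqn_leq leqNgt (leqNgt j).
by rewrite -(shuffle_homol jm im) -(shuffle_homol im jm) eq_f ltnn.
Qed.

Lemma shuffle_injr : {in labels nu &, injective g}.
Proof.
move=> i j im jm eq_f; apply/eqP; rewrite eqn_leq leqNgt (leqNgt j).
by rewrite -(shuffle_homor jm im) -(shuffle_homor im jm) eq_f ltnn.
Qed.

Lemma shuffle_neq i j :
  i \in labels mu -> i != l -> j \in labels nu -> f i != g j.
Proof.
move=> im il jn; case: sh => _ _ _ _ /perm_uniq.
rewrite iota_uniq cat_uniq => /and3P[_ /hasPn dis _].
have gj : g j \in [seq g j | j <- iota 1 (arity nu)].
  by apply: map_f; move: jn; rewrite monomial_mem // mem_iota; lia.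
apply: contraNneq (dis _ gj) => <-; apply: map_f.
by rewrite mem_filter il; move: im; rewrite monomial_mem // mem_iota; lia.
Qed.

Let ul : uniq (labels mu). Proof. exact: monomial_uniq. Qed.

Lemma perm_leaves_comp : perm_eq (leaves (comp_tree l f g mu nu))
  ([seq (f p.1, p.2) | p <- leaves mu & p.1 != l] ++
   [seq (g p.1, p.2) | p <- leaves nu]).
Proof.
by rewrite (permPl (perm_leaves_graft _ _ ul shuffle_leaf)) leaves_relabel.
Qed.

Lemma perm_labels_comp : perm_eq (labels (comp_tree l f g mu nu))
  ([seq f i | i <- labels mu & i != l] ++ [seq g i | i <- labels nu]).
Proof.
rewrite (permPl (perm_map fst perm_leaves_comp)) map_cat -!map_comp.
by rewrite /labels /unzip1 filter_map -!map_comp.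
Qed.

Lemma perm_labels_comp_iota : perm_eq (labels (comp_tree l f g mu nu))
  (iota 1 (arity mu + arity nu - 1)).
Proof.
rewrite (permPl perm_labels_comp); case: sh => _ _ _ _; apply: perm_trans.
have [/and3P[_ _ pm] /and3P[_ _ pn]] := conj mu_mon nu_mon.
by apply: perm_cat; apply: perm_map => //; apply: perm_filter.
Qed.

Lemma arity_comp : arity (comp_tree l f g mu nu) = arity mu + arity nu - 1.
Proof. by rewrite -size_labels (perm_size perm_labels_comp_iota) size_iota. Qed.

Lemma mem_labels_comp_l i : i \in labels mu -> i != l ->
  f i \in labels (comp_tree l f g mu nu).
Proof.
move=> im il; rewrite (perm_mem perm_labels_comp) mem_cat.
by rewrite map_f // mem_filter il.
Qed.

Lemma mem_labels_comp_r j : j \in labels nu ->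
  g j \in labels (comp_tree l f g mu nu).
Proof.
by move=> jn; rewrite (perm_mem perm_labels_comp) mem_cat map_f ?orbT.
Qed.

Variant comp_label_spec p : Prop :=
| CompLabelL i of i \in labels mu & i != l & p = f i
| CompLabelR j of j \in labels nu & p = g j.

Lemma comp_labelP p :
  p \in labels (comp_tree l f g mu nu) -> comp_label_spec p.
Proof.
rewrite (perm_mem perm_labels_comp) mem_cat => /orP[] /mapP[i].
  by rewrite mem_filter => /andP[il im] ->; left with i.
by move=> jn ->; right with i.
Qed.

Lemma minlabel_monomial t : tree_monomial t -> minlabel t = 1.
Proof.
move=> tm; apply: minlabelP => [|j]; rewrite monomial_mem //; last by lia.
by rewrite arity_gt0.
Qed.

Lemma leafcol_comp_l i : i \in labels mu -> i != l ->
  leafcol (comp_tree l f g mu nu) (f i) = leafcol mu i.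
Proof.
move=> im il; apply: leafcolP.
  by rewrite (perm_uniq perm_labels_comp_iota) iota_uniq.
rewrite (perm_mem perm_leaves_comp) mem_cat; apply/orP; left.
apply/mapP; exists (i, leafcol mu i) => //.
by rewrite mem_filter il mem_leafcol.
Qed.

Lemma leafcol_comp_r j : j \in labels nu ->
  leafcol (comp_tree l f g mu nu) (g j) = leafcol nu j.
Proof.
move=> jn; apply: leafcolP.
  by rewrite (perm_uniq perm_labels_comp_iota) iota_uniq.
rewrite (perm_mem perm_leaves_comp) mem_cat; apply/orP; right.
by apply/mapP; exists (j, leafcol nu j) => //; rewrite mem_leafcol.
Qed.

Hypothesis col_l : leafcol mu l = outcol nu.

Let col_leaves c : (l, c) \in leaves mu -> c = outcol nu.
Proof. by move/leafcolP => <-. Qed.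

Let nu' := relabel g nu.

Let min_nu' : minlabel nu' = f l.
Proof.
by rewrite minlabel_relabel // minlabel_monomial // shuffle_leafE.
Qed.

(** Stated for all trees with leaves among those of [mu], so that the induction goes through.
    Because [f l = g 1], the grafted tree has least label [f l]; grafting thus acts on least labels
    as the increasing map [f] does, and the shuffle condition is inherited at each vertex. *)
Let graft_ok t : {subset leaves t <= leaves mu} ->
  well_coloured t -> shuffle_tree t ->
  [/\ well_coloured (graft l f nu' t), shuffle_tree (graft l f nu' t),
      outcol (graft l f nu' t) = outcol t &
      minlabel (graft l f nu' t) = f (minlabel t)].
Proof.
have [/and3P[wn sn _]] := nu_mon.
elim: t => [c i|x t1 IH1 t2 IH2] /= sub.
  case: eqP => [eil|//] _ _.
  rewrite well_coloured_relabel wn shuffle_tree_relabel // sn.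
  rewrite outcol_relabel min_nu' eil; split => //.
  by rewrite -(col_leaves (c := c)) // sub // inE eil.
move=> /and4P[o1 o2 w1 w2] /and3P[lt12 s1 s2].
have sub1 : {subset leaves t1 <= leaves mu}.
  by move=> i ii; apply: sub; rewrite mem_cat ii.
have sub2 : {subset leaves t2 <= leaves mu}.
  by move=> i ii; apply: sub; rewrite mem_cat ii orbT.
have [-> -> -> ->] := IH1 sub1 w1 s1; have [-> -> -> ->] := IH2 sub2 w2 s2.
have lab t : {subset leaves t <= leaves mu} -> minlabel t \in labels mu.
  move=> st; have /mapP[p pt ->] := minlabel_in t.
  by apply: map_f; apply: st.
rewrite o1 o2 fhomo ?lab //; split => //.
by rewrite /minn shuffle_homol ?lab // lt12.
Qed.

Lemma comp_monomial : tree_monomial (comp_tree l f g mu nu).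
Proof.
have /and3P[wm sm _] := mu_mon.
have [w s _ _] := graft_ok (fun _ h => h) wm sm.
by apply/and3P; split=> //; rewrite arity_comp perm_labels_comp_iota.
Qed.

Lemma outcol_comp : outcol (comp_tree l f g mu nu) = outcol mu.
Proof.
by have /and3P[wm sm _] := mu_mon; case: (graft_ok (fun _ h => h) wm sm).
Qed.

Lemma incols_comp :
  incols (comp_tree l f g mu nu) = comp_incols f g (incols mu) (incols nu).
Proof.
rewrite /incols /comp_incols arity_comp !size_map !size_iota.
apply/eq_in_map => p.
rewrite -(perm_mem perm_labels_comp_iota) => /comp_labelP[i im il|j jn] ->.
  have in_i : i \in iota 1 (arity mu).
    by move: im; rewrite monomial_mem // mem_iota; lia.
  rewrite leafcol_comp_l //; case: ifP => [/mapP[j]|_].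
    rewrite mem_iota => jn /eqP; rewrite (negPf (shuffle_neq im il _)) //.
    by rewrite monomial_mem //; lia.
  (* [comp_incols] finds a colour by position among the relabelled leaves. Injectivity of [f] turns
     the position of [f i] back into [i.-1], as labels start at 1. *)
  have -> : index (f i) [seq f i | i <- iota 1 (arity mu)] = i.-1.
    rewrite (_ : f i = nth 0 [seq f i | i <- iota 1 (arity mu)] i.-1).
      rewrite index_uniq // ?size_map ?size_iota.
        by move: in_i; rewrite mem_iota; lia.
      rewrite map_inj_in_uniq ?iota_uniq // => a b.
      rewrite !mem_iota => a1 b1; apply: shuffle_injl; rewrite monomial_mem; lia.
    rewrite (nth_map 0) ?size_iota; last by move: in_i; rewrite mem_iota; lia.
    by rewrite nth_iota; move: in_i; rewrite mem_iota; [|lia] => ?; congr f; lia.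
  rewrite (nth_map 0) ?size_iota; last by move: in_i; rewrite mem_iota; lia.
  by rewrite nth_iota; move: in_i; rewrite mem_iota; [|lia] => ?; congr leafcol; lia.
have in_j : j \in iota 1 (arity nu).
  by move: jn; rewrite monomial_mem // mem_iota; lia.
rewrite leafcol_comp_r // map_f //.
have -> : index (g j) [seq g i | i <- iota 1 (arity nu)] = j.-1.
  rewrite (_ : g j = nth 0 [seq g i | i <- iota 1 (arity nu)] j.-1).
    rewrite index_uniq // ?size_map ?size_iota.
      by move: in_j; rewrite mem_iota; lia.
    rewrite map_inj_in_uniq ?iota_uniq // => a b.
    rewrite !mem_iota => a1 b1; apply: shuffle_injr; rewrite monomial_mem; lia.
  rewrite (nth_map 0) ?size_iota; last by move: in_j; rewrite mem_iota; lia.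
  by rewrite nth_iota; move: in_j; rewrite mem_iota; [|lia] => ?; congr g; lia.
rewrite (nth_map 0) ?size_iota; last by move: in_j; rewrite mem_iota; lia.
by rewrite nth_iota; move: in_j; rewrite mem_iota; [|lia] => ?; congr leafcol; lia.
Qed.

End Composition.

Lemma component_comp chi c chi' l f g mu nu :
  component_basis chi c mu ->
  component_basis chi' (nth colS chi l.-1) nu ->
  shuffle (size chi) (size chi') l f g ->
  component_basis (comp_incols f g chi chi') c (comp_tree l f g mu nu).
Proof.
case/and3P => mm /eqP <- /eqP <- /and3P[nm /eqP <- /eqP col_l].
rewrite !size_map !size_iota => sh; have [/andP[l1 l2] _ _ _ _] := sh.
have {}col_l : leafcol mu l = outcol nu.
  rewrite col_l (nth_map 0) ?size_iota; last by lia.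
  by rewrite nth_iota; [congr leafcol|]; lia.
apply/and3P; split; first exact: comp_monomial sh col_l.
  by rewrite incols_comp.
by rewrite (outcol_comp _ _ sh).
Qed.

(** * An admissible ordering *)

Section LexLe.

Definition lex_le (x y : seq int) : bool := ((x : seqlexi int) <= y)%O.

Lemma lex_lt_le x y : lex_lt x y = lex_le x y && (x != y).
Proof. by rewrite /lex_lt lt_neqAle andbC. Qed.

Lemma lex_le_cons (a b : int) (x y : seq int) :
  lex_le (a :: x) (b :: y) = (a < b)%O || ((a == b) && lex_le x y).
Proof. by rewrite /lex_le lexi_cons; case: (comparableP a b) => // _. Qed.

Lemma lex_le_cat (x y x' y' : seq int) : size x = size y ->
  lex_le (x ++ x') (y ++ y') = lex_lt x y || ((x == y) && lex_le x' y').
Proof.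
elim: x y => [|a x IH] [|b y] //= [eq_sz].
by rewrite lex_le_cons lex_lt_cons IH // eqseq_cons; case: ltgtP.
Qed.

(** Each block is compared under the assumption that all earlier blocks agree; in this form a
    composite can be treated one criterion and one leaf at a time. *)
Lemma lex_le_flatten (I : seq nat) (c c' : nat -> seq int) :
    sorted ltn I -> (forall k, size (c k) = size (c' k)) ->
  lex_le (flatten [seq c k | k <- I]) (flatten [seq c' k | k <- I]) <->
  {in I, forall k, {in I, forall k', k' < k -> c k' = c' k'} ->
     lex_le (c k) (c' k)}.
Proof.
move=> sI eq_sz; elim: I sI => [|k I IH] //= sI.
have {}IH := IH (path_sorted sI).
have lt_k := order_path_min ltn_trans sI.
rewrite lex_le_cat // lex_lt_le; split=> [|H].
  case/orP=> [/andP[le_k ne_k] j|/andP[/eqP eq_k leI] j].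
    rewrite inE => /orP[/eqP -> //|jI] /(_ k (mem_head _ _)).
    by move/allP: lt_k => /(_ _ jI) -> /(_ isT) /eqP; rewrite (negPf ne_k).
  rewrite inE => /orP[/eqP -> _|jI agree]; first by rewrite eq_k /lex_le.
  move/IH: leI; apply=> // i iI; apply: agree.
  by rewrite inE iI orbT.
have le_k : lex_le (c k) (c' k).
  apply: H; first exact: mem_head.
  move=> j; rewrite inE => /orP[/eqP ->|]; first by rewrite ltnn.
  by move/(allP lt_k) => kj jk; move: (ltn_trans kj jk); rewrite ltnn.
rewrite le_k /=; case: eqP => //= eq_k.
apply/IH.
move=> j jI agree; apply: H; first by rewrite inE jI orbT.
by move=> i; rewrite inE => /orP[/eqP -> //|]; apply: agree.
Qed.

Lemma lex_le_map (I : seq nat) (c c' : nat -> int) : sorted ltn I ->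
  lex_le [seq c k | k <- I] [seq c' k | k <- I] <->
  {in I, forall k, {in I, forall k', k' < k -> c k' = c' k'} -> (c k <= c' k)%O}.
Proof.
move=> sI; have flat (a : nat -> int) :
    [seq a k | k <- I] = flatten [seq [:: a k] | k <- I].
  by elim: (I) => //= k J ->.
rewrite !flat lex_le_flatten //; split=> H k kI agree.
  have := H k kI; rewrite lex_le_cons /lex_le /= lexx andbT orbC -le_eqVlt.
  by apply=> j jI /(agree _ jI) ->.
rewrite lex_le_cons /lex_le /= lexx andbT orbC -le_eqVlt.
by apply: H => // j jI /(agree _ jI) [].
Qed.

End LexLe.

(** * Paths with directions, and the criteria by which they are compared *)

Section DirectedPaths.

(** Label words do not separate tree monomials: alpha(alpha(1,2),alpha(3,4)) and
    alpha(alpha(1,3),alpha(2,4)) have the same ones. Recording the turns as well makes the paths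
    determine the tree ([dpath_inj]), as a total ordering requires. *)
Fixpoint dpath (t : tree gen) (i : nat) : seq (gen * bool) :=
  match t with
  | Leaf _ _ => [::]
  | Node x a b =>
      if i \in labels a then (x, true) :: dpath a i else (x, false) :: dpath b i
  end.

Lemma path_word_dpath t i : path_word t i = unzip1 (dpath t i).
Proof. by elim: t => //= x a -> b ->; case: ifP. Qed.

Definition dletter (p : gen * bool) : nat := nat_of_gen p.1 * 2 + p.2.

(** Base 12 because a letter is one of 6 generators with one of 2 directions. *)
Fixpoint dcode (w : seq (gen * bool)) : nat :=
  if w is p :: w' then dletter p * 12 ^ size w' + dcode w' else 0.

Lemma dletter_lt p : dletter p < 12. Proof. by case: p => [[]][]. Qed.

Lemma dletter_inj : injective dletter.
Proof. by case=> [x a] [y b]; case: x; case: y; case: a; case: b. Qed.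

Lemma dcode_lt w : dcode w < 12 ^ size w.
Proof. by elim: w => //= p w IH; have := dletter_lt p; rewrite expnS; nia. Qed.

Lemma dcode_inj w w' : size w = size w' -> dcode w = dcode w' -> w = w'.
Proof.
elim: w w' => [|p w IH] [|p' w'] //= [eq_sz]; rewrite -eq_sz => eq_c.
have := dcode_lt w; have := dcode_lt w'; rewrite -eq_sz => lt' lt.
have eq_p : dletter p = dletter p' by nia.
by rewrite (dletter_inj eq_p) (IH w') //; move: eq_c; rewrite eq_p; lia.
Qed.

Lemma dcode_cat u v : dcode (u ++ v) = dcode u * 12 ^ size v + dcode v.
Proof. by elim: u => //= p u ->; rewrite size_cat expnD; lia. Qed.

Definition is_alpha (x : gen) := if x is opAlpha then true else false.
Definition is_de (x : gen) := if x is opD then true else if x is opE then true else false.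
Definition is_mnb (x : gen) := ~~ is_alpha x && ~~ is_de x.

Definition qpairs (w : seq gen) : nat := q_exp (qnormal w).

Lemma qcriterion0 w : qcriterion 0 w = (- (count is_alpha w)%:Z)%R.
Proof.
rewrite /qcriterion; suff ->: count is_alpha w = size (q_alpha (qnormal w)).
  by case: (qnormal w).
by elim: w => //= x w ->; case: (qnormal w) => wa wd wm k; case: x.
Qed.

Lemma qcriterion1 w : qcriterion 1 w = (- (count is_de w)%:Z)%R.
Proof.
rewrite /qcriterion; suff ->: count is_de w = size (q_de (qnormal w)).
  by case: (qnormal w).
by elim: w => //= x w ->; case: (qnormal w) => wa wd wm k; case: x.
Qed.

Lemma qcriterion2 w : qcriterion 2 w = (count is_mnb w)%:Z%R.
Proof.
rewrite /qcriterion; suff ->: count is_mnb w = size (q_mnbeta (qnormal w)).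
  by case: (qnormal w).
by elim: w => //= x w ->; case: (qnormal w) => wa wd wm k; case: x.
Qed.

Lemma qcriterion3 w : qcriterion 3 w = (qpairs w)%:Z%R.
Proof. by rewrite /qcriterion /qpairs; case: (qnormal w). Qed.

Lemma qpairs_cons x w : qpairs (x :: w) =
  qpairs w + (~~ is_alpha x) * count is_alpha w + is_mnb x * count is_de w.
Proof.
have := qcriterion0 w; have := qcriterion1 w; rewrite /qcriterion /qpairs /=.
by case: (qnormal w) => wa wd wm k /=; case: x => /=; lia.
Qed.

(** The exponent of [q] counts the pairs of letters standing against the order of levels.
    Concatenation adds the pairs across the cut, whose number depends only on how many letters of
    each level occur. *)
Lemma qpairs_cat u v : qpairs (u ++ v) = qpairs u + qpairs v +
  count is_alpha v * (count is_de u + count is_mnb u) +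
  count is_de v * count is_mnb u.
Proof.
elim: u => [|x u IH]; first by rewrite /qpairs /=; lia.
by rewrite /= !qpairs_cons IH !count_cat; case: x => /=; lia.
Qed.

Lemma size_classes (w : seq gen) :
  size w = count is_alpha w + count is_de w + count is_mnb w.
Proof. by elim: w => //= x w ->; case: x => /=; lia. Qed.

Definition dcriterion (k : nat) (w : seq (gen * bool)) : int :=
  if k < 4 then qcriterion k (unzip1 w) else (dcode w)%:Z%R.

Lemma dcriterion_size u u' :
  (forall k, k < 3 -> dcriterion k u = dcriterion k u') -> size u = size u'.
Proof.
have szE (w : seq (gen * bool)) : size w = size (unzip1 w) by rewrite size_map.
move=> eq_c; rewrite (szE u) (szE u') !size_classes.
have := (eq_c 0 isT, eq_c 1 isT, eq_c 2 isT).
by rewrite /dcriterion /= !qcriterion0 !qcriterion1 !qcriterion2 => -[[]]; lia.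
Qed.

Lemma dcriterion_inj u u' :
  (forall k, k < 5 -> dcriterion k u = dcriterion k u') -> u = u'.
Proof.
move=> eq_c; apply: dcode_inj; last by have := eq_c 4 isT; case.
by apply: dcriterion_size => k lt_k; apply: eq_c; lia.
Qed.

(** The core of admissibility: once lower criteria tie, each criterion is monotone under
    concatenation and reflects ties. Criteria 0 to 2 are additive; criterion 3 is additive up to a
    cross term fixed by the tied counts; criterion 4 is positional, and tied counts give equal
    lengths. *)
Lemma dcriterion_cat k u u' v v' : k < 5 ->
    (forall k', k' < k -> dcriterion k' u = dcriterion k' u') ->
    (forall k', k' < k -> dcriterion k' v = dcriterion k' v') ->
    (dcriterion k u <= dcriterion k u')%O ->
    (dcriterion k v <= dcriterion k v')%O ->
  (dcriterion k (u ++ v) <= dcriterion k (u' ++ v'))%O /\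
  (dcriterion k (u ++ v) = dcriterion k (u' ++ v') ->
   dcriterion k u = dcriterion k u' /\ dcriterion k v = dcriterion k v').
Proof.
have cat_map (a b : seq (gen * bool)) :
  unzip1 (a ++ b) = unzip1 a ++ unzip1 b by exact: map_cat.
case: k => [_ _ _|k].
  by rewrite /dcriterion /= !qcriterion0 !cat_map !count_cat; lia.
case: k => [_ _ _|k].
  by rewrite /dcriterion /= !qcriterion1 !cat_map !count_cat; lia.
case: k => [_ _ _|k].
  by rewrite /dcriterion /= !qcriterion2 !cat_map !count_cat; lia.
case: k => [_ eu ev|[_ eu ev|//]].
  have := (eu 0 isT, eu 1 isT, eu 2 isT, (ev 0 isT, ev 1 isT, ev 2 isT)).
  rewrite /dcriterion /= !qcriterion0 !qcriterion1 !qcriterion2 !qcriterion3.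
  rewrite !cat_map !qpairs_cat => -[[[eu0 eu1] eu2] [[ev0 ev1] ev2]].
  have -> : count is_alpha (unzip1 v) = count is_alpha (unzip1 v') by lia.
  have -> : count is_de (unzip1 v) = count is_de (unzip1 v') by lia.
  have -> : count is_de (unzip1 u) = count is_de (unzip1 u') by lia.
  have -> : count is_mnb (unzip1 u) = count is_mnb (unzip1 u') by lia.
  by lia.
have sz : size v = size v'.
  by apply: dcriterion_size => k lt_k; apply: ev; lia.
rewrite /dcriterion /= !dcode_cat sz => le_u le_v.
have : 0 < 12 ^ size v' by rewrite expn_gt0.
move: (12 ^ _) => B; nia.
Qed.

End DirectedPaths.

Section DirectedPathsOfTrees.

Lemma dpath_relabel f t i : {in labels t &, injective f} -> i \in labels t ->
  dpath (relabel f t) (f i) = dpath t i.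
Proof.
elim: t => //= x a IHa b IHb; rewrite labels_node => inj_f it.
have -> : (f i \in labels (relabel f a)) = (i \in labels a).
  rewrite labels_relabel; apply/mapP/idP => [[j ja eq_f]|ia]; last by exists i.
  by rewrite (inj_f i j it _ eq_f) // mem_cat ja.
case: ifP it => [ia _|ia].
  by rewrite IHa // => j k ja ka; apply: inj_f; rewrite mem_cat ?ja ?ka.
rewrite mem_cat ia => ib.
by rewrite IHb // => j k ja ka; apply: inj_f; rewrite mem_cat ?ja ?ka orbT.
Qed.

(** The first letters of the paths give the root and split the labels between its two subtrees,
    which are then equal by induction. *)
Lemma dpath_inj s t : well_coloured s -> well_coloured t ->
  uniq (labels s) -> uniq (labels t) -> labels s =i labels t ->
  outcol s = outcol t -> {in labels s, dpath s =1 dpath t} -> s = t.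
Proof.
elim: s t => [c i|x a IHa b IHb] [c' i'|x' a' b'].
- move=> _ _ _ _ eq_l /= -> _; congr Leaf.
  by have := eq_l i; rewrite !inE eqxx => /esym/eqP.
- move=> _ _ _ _ _ _ /(_ i); rewrite inE eqxx /= => /(_ isT).
  by case: ifP.
- move=> _ _ _ _ _ _ /(_ _ (minlabel_in _)) /=.
  by case: ifP.
move=> /and4P[/eqP oa /eqP ob wa wb] /and4P[/eqP oa' /eqP ob' wa' wb'].
rewrite !labels_node !cat_uniq => /and3P[ua /hasPn dis ub].
case/and3P=> [ua' /hasPn dis' ub'] eq_l _ eq_p.
have eq_x : x = x'.
  have := eq_p (minlabel a); rewrite mem_cat minlabel_in => /(_ isT) /=.
  by rewrite minlabel_in; case: ifP => _ [].
have eq_a : labels a =i labels a'.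
  move=> i; apply/idP/idP => ia; last first.
    have := eq_p i; rewrite eq_l mem_cat ia => /(_ isT) /=.
    by rewrite ia; case: ifP.
  have := eq_p i; rewrite mem_cat ia => /(_ isT) /=.
  by rewrite ia; case: ifP.
have eq_b : labels b =i labels b'.
  move=> i; have := eq_l i; rewrite !mem_cat eq_a.
  case/boolP: (i \in labels a') => //= ia' _.
  have /negPf -> : i \notin labels b by apply: contraL ia' => /dis; rewrite -eq_a.
  by apply/esym/negbTE; apply: contraL ia' => /dis'.
rewrite -eq_x in oa' ob' eq_p *; congr Node.
  apply: IHa => //; first by rewrite oa oa'.
  move=> i ia; have := eq_p i; rewrite mem_cat ia => /(_ isT) /=.
  by rewrite -eq_a ia => -[].
apply: IHb => //; first by rewrite ob ob'.
move=> i ib; have := eq_p i; rewrite mem_cat ib orbT => /(_ isT) /=.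
by rewrite -eq_a; have /negPf -> := dis _ ib; case.
Qed.

Section Composition.
Variables (mu nu : tree gen) (l : nat) (f g : nat -> nat).
Hypotheses (mu_mon : tree_monomial mu) (nu_mon : tree_monomial nu).
Hypothesis sh : shuffle (arity mu) (arity nu) l f g.

Let nu' := relabel g nu.

Let graft_l_mem t i : {subset labels t <= labels mu} ->
    i \in labels mu -> i != l ->
  (f i \in labels (graft l f nu' t)) = (i \in labels t).
Proof.
elim: t => [c j|x a IHa b IHb] sub im il /=; last first.
  rewrite !labels_node !mem_cat IHa ?IHb // => j jj; apply: sub;
  by rewrite labels_node mem_cat jj ?orbT.
case: eqP => [->|/eqP jl].
  rewrite labels_relabel inE (negPf il); apply/negbTE/mapP => -[k kn /eqP].
  by rewrite (negPf (shuffle_neq mu_mon nu_mon sh im il kn)).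
have jm : j \in labels mu by apply: sub; rewrite inE.
by rewrite !inE; apply/eqP/eqP => [|-> //]; apply: (shuffle_injl mu_mon nu_mon sh im jm).
Qed.

Let graft_r_mem t j : {subset labels t <= labels mu} -> j \in labels nu ->
  (g j \in labels (graft l f nu' t)) = (l \in labels t).
Proof.
elim: t => [c i|x a IHa b IHb] sub jn /=; last first.
  rewrite !labels_node !mem_cat IHa ?IHb // => k kk; apply: sub;
  by rewrite labels_node mem_cat kk ?orbT.
have im : i \in labels mu by apply: sub; rewrite inE.
rewrite [RHS]inE [RHS]eq_sym /=; case: eqP => [|/eqP] il.
  by rewrite labels_relabel map_f.
by rewrite inE eq_sym (negPf (shuffle_neq mu_mon nu_mon sh im il jn)).
Qed.

Lemma dpath_comp_l i : i \in labels mu -> i != l ->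
  dpath (comp_tree l f g mu nu) (f i) = dpath mu i.
Proof.
rewrite /comp_tree => im il; have := im.
have : {subset labels mu <= labels mu} by [].
elim: {1 3 4 5}mu => [c j|x a IHa b IHb] sub.
  rewrite inE => /eqP eq_ij /=; case: eqP => // jl.
  by rewrite eq_ij /= jl eqxx in il.
rewrite labels_node mem_cat /=.
have sa : {subset labels a <= labels mu}.
  by move=> k ka; apply: sub; rewrite labels_node mem_cat ka.
have sb : {subset labels b <= labels mu}.
  by move=> k kb; apply: sub; rewrite labels_node mem_cat kb orbT.
rewrite graft_l_mem //; case: ifP => [ia _|_ ib]; first by rewrite IHa.
by rewrite IHb.
Qed.

Lemma dpath_comp_r j : j \in labels nu ->
  dpath (comp_tree l f g mu nu) (g j) = dpath mu l ++ dpath nu j.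
Proof.
rewrite /comp_tree => jn; have := shuffle_leaf mu_mon sh.
have : {subset labels mu <= labels mu} by [].
elim: {1 3 4 5}mu => [c i|x a IHa b IHb] sub.
  rewrite inE => /eqP eq_ij /=; rewrite eq_ij eqxx dpath_relabel //.
  exact: shuffle_injr mu_mon nu_mon sh.
rewrite labels_node mem_cat /=.
have sa : {subset labels a <= labels mu}.
  by move=> k ka; apply: sub; rewrite labels_node mem_cat ka.
have sb : {subset labels b <= labels mu}.
  by move=> k kb; apply: sub; rewrite labels_node mem_cat kb orbT.
rewrite graft_r_mem //; case: ifP => [ia _|_ ib]; first by rewrite IHa.
by rewrite IHb.
Qed.

End Composition.

End DirectedPathsOfTrees.

(** * The total ordering of tree monomials and its admissibility *)

Section Ordering.

(* The trivial trees of both colours have the same paths. *)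
Definition root_leaf (t : tree gen) : int := if t is Leaf colS _ then 1 else 0.

Definition dvector (t : tree gen) : seq int :=
  flatten [seq [seq dcriterion k (dpath t i) | i <- iota 1 (arity t)]
          | k <- iota 0 5].

Definition monomial_le (s t : tree gen) : bool :=
  (arity s < arity t) || ((arity s == arity t) &&
    lex_le (rcons (dvector s) (root_leaf s)) (rcons (dvector t) (root_leaf t))).

Definition dvector_le (s t : tree gen) : Prop :=
  forall k, k < 5 ->
    (forall k' i, k' < k -> 1 <= i <= arity s ->
       dcriterion k' (dpath s i) = dcriterion k' (dpath t i)) ->
  forall i, 1 <= i <= arity s ->
    (forall i', 1 <= i' < i ->
       dcriterion k (dpath s i') = dcriterion k (dpath t i')) ->
  (dcriterion k (dpath s i) <= dcriterion k (dpath t i))%O.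

Lemma dvector_leP s t : arity s = arity t ->
  lex_le (dvector s) (dvector t) <-> dvector_le s t.
Proof.
move=> eq_ar; rewrite /dvector -eq_ar lex_le_flatten; first last.
- by move=> k; rewrite !size_map.
- exact: iota_ltn_sorted.
split=> H k.
  move=> lt_k agree i i_in agree_i.
  have /H : k \in iota 0 5 by rewrite mem_iota.
  rewrite lex_le_map; last exact: iota_ltn_sorted.
  apply=> [k' _ lt_k'||i'].
  - apply/eq_in_map => i'; rewrite mem_iota => i'_in.
    by apply: agree => //; lia.
  - by rewrite mem_iota; lia.
  - by rewrite mem_iota => i'_in lt_i'; apply: agree_i; lia.
rewrite mem_iota add0n leq0n andTb => lt_k agree.
rewrite lex_le_map; last exact: iota_ltn_sorted.
move=> i; rewrite mem_iota => i_in agree_i; apply: H => //.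
- move=> k' i' lt_k' i'_in; have k'_in : k' \in iota 0 5 by rewrite mem_iota; lia.
  by move: (agree k' k'_in lt_k') => /eq_in_map; apply; rewrite mem_iota; lia.
by move=> i' i'_in; apply: agree_i; rewrite ?mem_iota; lia.
Qed.

Lemma size_dvector s t : arity s = arity t -> size (dvector s) = size (dvector t).
Proof. by move=> eq_ar; rewrite /dvector /= !size_cat !size_map !size_iota eq_ar. Qed.

Lemma lex_le_rcons x y (a b : int) : size x = size y ->
  lex_le (rcons x a) (rcons y b) = lex_le x y && ((x == y) ==> (a <= b)%O).
Proof.
move=> eq_sz; rewrite -!cats1 lex_le_cat // lex_lt_le.
have -> : lex_le [:: a] [:: b] = (a <= b)%O.
  by rewrite lex_le_cons /lex_le lexx andbT orbC -le_eqVlt.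
by case: eqP => [->|_] /=; rewrite ?andbT ?orbF ?andbF //= /lex_le lexx.
Qed.

Lemma monomial_leE s t : arity s = arity t ->
  monomial_le s t =
    lex_le (dvector s) (dvector t) &&
    ((dvector s == dvector t) ==> (root_leaf s <= root_leaf t)%O).
Proof.
move=> eq_ar; rewrite /monomial_le eq_ar ltnn eqxx /= lex_le_rcons //.
exact: size_dvector.
Qed.

Lemma dvector_eq s t : arity s = arity t -> dvector s = dvector t ->
  forall i, 1 <= i <= arity s -> dpath s i = dpath t i.
Proof.
rewrite /dvector => <- eq_v i i_in; apply: dcriterion_inj => k lt_k.
suff /eq_in_map : [seq dcriterion k (dpath s i) | i <- iota 1 (arity s)] =
                  [seq dcriterion k (dpath t i) | i <- iota 1 (arity s)].
  by apply; rewrite mem_iota; lia.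
have : k \in iota 0 5 by rewrite mem_iota.
elim: (iota 0 5) eq_v => //= j r IH /eqP.
rewrite eqseq_cat ?size_map // => /andP[/eqP eq_j /eqP eq_r].
by rewrite inE => /orP[/eqP -> //|]; apply: IH.
Qed.

Lemma monomial_le_total : total_order_on_monomials monomial_le.
Proof.
split.
- by move=> s _; rewrite monomial_leE // eqxx /lex_le !lexx.
- move=> s t sm tm; rewrite /monomial_le; case: ltngtP => // eq_ar /=.
  rewrite /lex_le => /le_anti /eqP; rewrite eqseq_rcons => /andP[/eqP eq_v /eqP eq_r].
  have eq_p := dvector_eq eq_ar eq_v.
  have [/and3P[ws _ _] /and3P[wt _ _]] := conj sm tm.
  apply: dpath_inj => //; try exact: monomial_uniq.
  + by move=> i; rewrite !monomial_mem // eq_ar.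
  + case: s t {sm tm ws wt eq_v} eq_ar eq_r eq_p => [c i|x a b] [c' i'|x' a' b'].
    * by case: c; case: c'.
    * by rewrite arity_node => eq_ar; have := arity_gt0 a'; have := arity_gt0 b';
         move: eq_ar; rewrite /arity /=; lia.
    * by rewrite arity_node => eq_ar; have := arity_gt0 a; have := arity_gt0 b;
         move: eq_ar; rewrite /arity /=; lia.
    * move=> _ _ /(_ 1); rewrite arity_gt0 => /(_ isT) /=.
      by case: ifP; case: ifP => _ _ [] ->.
  + by move=> i; rewrite monomial_mem //; apply: eq_p.
- move=> t s u _ _ _; rewrite /monomial_le.
  case: (ltngtP (arity s)) => //= st; case: (ltngtP (arity t)) => //= tu.
  + by move=> _ _; rewrite (ltn_trans st tu).
  + by move=> _ _; rewrite -tu st.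
  + by move=> _ _; rewrite st tu.
  by move=> le1 le2; rewrite st tu ltnn eqxx /=; apply: le_trans le1 le2.
- by move=> s t _ _; rewrite /monomial_le; case: ltngtP => //= eq_ar; apply: le_total.
Qed.

Section CompositionMonotone.
Variables (mu mu' nu nu' : tree gen) (l : nat) (f g : nat -> nat).
Hypotheses (mm : tree_monomial mu) (mm' : tree_monomial mu').
Hypotheses (nm : tree_monomial nu) (nm' : tree_monomial nu').
Hypotheses (ar_mu : arity mu = arity mu') (ar_nu : arity nu = arity nu').
Hypothesis sh : shuffle (arity mu) (arity nu) l f g.
Hypotheses (le_mu : dvector_le mu mu') (le_nu : dvector_le nu nu').

Let s := comp_tree l f g mu nu.
Let t := comp_tree l f g mu' nu'.

Let sh' : shuffle (arity mu') (arity nu') l f g.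
Proof. by rewrite -ar_mu -ar_nu. Qed.

Let eq_at k i := dcriterion k (dpath s i) = dcriterion k (dpath t i).
Let eq_mu k i := dcriterion k (dpath mu i) = dcriterion k (dpath mu' i).
Let eq_nu k i := dcriterion k (dpath nu i) = dcriterion k (dpath nu' i).

Let mem_mu' i : i \in labels mu -> i \in labels mu'.
Proof. by rewrite !monomial_mem // ar_mu. Qed.
Let mem_nu' i : i \in labels nu -> i \in labels nu'.
Proof. by rewrite !monomial_mem // ar_nu. Qed.
Let l_mu : l \in labels mu. Proof. exact: shuffle_leaf sh. Qed.

Let crit_l k i : i \in labels mu -> i != l ->
  dcriterion k (dpath s (f i)) = dcriterion k (dpath mu i) /\
  dcriterion k (dpath t (f i)) = dcriterion k (dpath mu' i).
Proof.
move=> im il; rewrite (dpath_comp_l mm nm sh) // (dpath_comp_l mm' nm' sh') //.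
exact: mem_mu'.
Qed.

Let path_r i : i \in labels nu ->
  dpath s (g i) = dpath mu l ++ dpath nu i /\
  dpath t (g i) = dpath mu' l ++ dpath nu' i.
Proof.
move=> im; rewrite (dpath_comp_r mm nm sh) // (dpath_comp_r mm' nm' sh') //.
exact: mem_nu'.
Qed.

Section Level.
Variable k : nat.
Hypothesis lt_k : k < 5.
Hypothesis low_mu : forall k' i, k' < k -> i \in labels mu -> eq_mu k' i.
Hypothesis low_nu : forall k' i, k' < k -> i \in labels nu -> eq_nu k' i.

Let step_mu p i : (forall i, i \in labels mu -> f i < p -> eq_mu k i) ->
  i \in labels mu -> f i <= p ->
  (dcriterion k (dpath mu i) <= dcriterion k (dpath mu' i))%O.
Proof.
move=> agree im le_p; apply: le_mu => //; rewrite -?monomial_mem //.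
  by move=> k' j lt_k' j_in; apply: low_mu; rewrite ?monomial_mem.
move=> j j_in; have jm : j \in labels mu.
  by move: im j_in; rewrite !monomial_mem //; lia.
apply: agree => //; apply: leq_trans le_p.
by rewrite (shuffle_homol mm nm sh) //; lia.
Qed.

Let step_nu p i : (forall i, i \in labels nu -> g i < p -> eq_nu k i) ->
  i \in labels nu -> g i <= p ->
  (dcriterion k (dpath nu i) <= dcriterion k (dpath nu' i))%O.
Proof.
move=> agree im le_p; apply: le_nu => //; rewrite -?monomial_mem //.
  by move=> k' j lt_k' j_in; apply: low_nu; rewrite ?monomial_mem.
move=> j j_in; have jm : j \in labels nu.
  by move: im j_in; rewrite !monomial_mem //; lia.
apply: agree => //; apply: leq_trans le_p.
by rewrite (shuffle_homor mm nm sh) //; lia.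
Qed.

(** Since [l] takes the place of the least label of [nu], the comparison of [mu] with [mu'] at [l]
    is already available when any label coming from [nu] is reached. *)
Let leaf_le j : j \in labels nu -> f l <= g j.
Proof.
move=> jn; rewrite (shuffle_leafE sh).
have one : 1 \in labels nu by rewrite monomial_mem // arity_gt0.
rewrite leqNgt (shuffle_homor mm nm sh) //.
by move: jn; rewrite monomial_mem //; lia.
Qed.

(** Induction on [p]. At a label of [nu] the path is that to [l] followed by one in [nu], so
    [dcriterion_cat] splits agreement of the composites into agreement at [l] and in [nu]. The leaf
    [l] itself is met at the label [g 1 = f l]. *)
Let level_agree p : (forall q, q < p -> q \in labels s -> eq_at k q) ->
  (forall i, i \in labels mu -> f i < p -> eq_mu k i) /\
  (forall j, j \in labels nu -> g j < p -> eq_nu k j).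
Proof.
elim: p => [|p IH] agree; first by split.
have [|am an] := IH; first by move=> q /ltnW; apply: agree.
have at_g j : j \in labels nu -> g j = p -> eq_mu k l /\ eq_nu k j.
  move=> jn eq_p; have := agree p (ltnSn p).
  rewrite -eq_p (mem_labels_comp_r mm sh) // => /(_ isT).
  rewrite /eq_at; have [-> ->] := path_r jn.
  have [||||] // := @dcriterion_cat k (dpath mu l) (dpath mu' l)
                   (dpath nu j) (dpath nu' j) lt_k.
  - by move=> k' lt_k'; apply: low_mu.
  - by move=> k' lt_k'; apply: low_nu.
  - by apply: (step_mu am) => //; rewrite -eq_p leaf_le.
  - by apply: (step_nu an) => //; rewrite eq_p.
split=> i im; rewrite ltnS leq_eqVlt => /orP[/eqP eq_p|]; try by [apply: am|apply: an].
  have [eq_il|il] := eqVneq i l; last first.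
    have := agree p (ltnSn p); rewrite -eq_p (mem_labels_comp_l mm sh) //.
    by move=> /(_ isT); rewrite /eq_at; have [-> ->] := crit_l k im il.
  have one : 1 \in labels nu by rewrite monomial_mem // arity_gt0.
  have eq1 : g 1 = p by rewrite -(shuffle_leafE sh) -eq_il.
  by rewrite eq_il; have [] := at_g 1 one eq1.
by have [] := at_g i im eq_p.
Qed.

Lemma level_eq : (forall q, q \in labels s -> eq_at k q) ->
  (forall i, i \in labels mu -> eq_mu k i) /\
  (forall j, j \in labels nu -> eq_nu k j).
Proof.
move=> agree; split=> i im.
  by have [h _] := @level_agree (f i).+1 (fun q _ => agree q); apply: h.
by have [_ h] := @level_agree (g i).+1 (fun q _ => agree q); apply: h.
Qed.

Lemma level_le p : p \in labels s ->
  (forall q, q < p -> q \in labels s -> eq_at k q) ->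
  (dcriterion k (dpath s p) <= dcriterion k (dpath t p))%O.
Proof.
move=> ps /level_agree[am an].
case: (comp_labelP mm sh ps) => [i im il|j jn] eq_p.
  rewrite eq_p; have [-> ->] := crit_l k im il.
  by apply: (step_mu am) => //; rewrite eq_p.
rewrite eq_p; have [-> ->] := path_r jn.
apply: proj1 (dcriterion_cat lt_k _ _ _ _).
- by move=> k' lt_k'; apply: low_mu.
- by move=> k' lt_k'; apply: low_nu.
- by apply: (step_mu am) => //; rewrite eq_p leaf_le.
- by apply: (step_nu an) => //; rewrite eq_p.
Qed.

End Level.

Lemma comp_dvector_le : dvector_le s t.
Proof.
have ms p : (p \in labels s) = (1 <= p <= arity s).
  rewrite (perm_mem (perm_labels_comp_iota mm nm sh)) mem_iota /s.
  by rewrite (arity_comp mm nm sh); lia.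
move=> k lt_k agree.
(* Agreement descends to the factors one criterion at a time, because splitting a path at criterion
   [k'] presupposes ties below [k']. *)
have low : forall k', k' <= k ->
   (forall k'' i, k'' < k' -> i \in labels mu -> eq_mu k'' i) /\
   (forall k'' i, k'' < k' -> i \in labels nu -> eq_nu k'' i).
  elim=> [|k' IH] le_k'; first by split.
  have [lm ln] := IH (ltnW le_k').
  have lt_k' : k' < 5 by lia.
  have [|em en] := level_eq lt_k' lm ln.
    by move=> q qs; apply: agree; rewrite -?ms.
  by split=> k'' i; rewrite ltnS leq_eqVlt => /orP[/eqP ->|?]; auto.
have [lm ln] := low k (leqnn k).
move=> i i_in agree_i; apply: level_le => //; first by rewrite ms.
by move=> q lt_q; rewrite ms => q_in; apply: agree_i; lia.
Qed.

End CompositionMonotone.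

Lemma monomial_le_admissible : admissible monomial_le.
Proof.
split=> [s t _ _ lt_st|]; first by rewrite /monomial_le lt_st.
move=> mu mu' nu nu' l f g mm mm' nm nm' ar_mu ar_nu _ _ sh.
have sh' : shuffle (arity mu') (arity nu') l f g by rewrite -ar_mu -ar_nu.
have ar_comp : arity (comp_tree l f g mu nu) = arity (comp_tree l f g mu' nu').
  by rewrite (arity_comp _ _ sh) ?(arity_comp _ _ sh') ?ar_mu ?ar_nu.
rewrite !monomial_leE //.
case/andP=> /dvector_leP => /(_ ar_mu) le_mu _.
case/andP=> /dvector_leP => /(_ ar_nu) le_nu tie_nu.
apply/andP; split.
  apply/dvector_leP => //.
  exact: comp_dvector_le.
(* A composite has nonzero [root_leaf] only if both factors are single leaves, and then the
   tie-break between [nu] and [nu'] applies. *)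
apply/implyP => _.
have leaf_of (t : tree gen) : arity t = 1 -> exists c i, t = Leaf c i.
  case: t => [c i _|x a b]; first by exists c, i.
  by rewrite arity_node; have := arity_gt0 a; have := arity_gt0 b; lia.
have root_ge0 t : (0 <= root_leaf t)%R by case: t => [[]|].
case: mu mm ar_mu {le_mu ar_comp} sh => [c i|x a b] mm ar_mu sh; last exact: root_ge0.
have [c' [i' eq_mu']] := leaf_of mu' (esym ar_mu).
rewrite /comp_tree eq_mu' /=.
have -> : i = l by apply/eqP; have := shuffle_leaf mm sh; rewrite inE eq_sym.
have -> : i' = l.
  by apply/eqP; have := shuffle_leaf mm' sh'; rewrite eq_mu' inE eq_sym.
rewrite eqxx.
have root_relabel t : root_leaf (relabel g t) = root_leaf t by case: t => [[]|].
rewrite !root_relabel.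
case: nu nm ar_nu sh tie_nu {sh' le_nu} => [cn j|x a b] nm ar_nu sh tie_nu;
  last exact: root_ge0.
have [cn' [j' eq_nu']] := leaf_of nu' (esym ar_nu).
by move/implyP: tie_nu; rewrite eq_nu'; apply; rewrite /dvector /arity /=.
Qed.

Lemma exists_qm_ordering : exists le : rel (tree gen), qm_ordering le.
Proof.
exists monomial_le; split.
- exact: monomial_le_total.
- exact: monomial_le_admissible.
move=> s t sm tm; rewrite /qm_lt => /orP[lt_ar|/andP[/eqP eq_ar lt_v]].
  by rewrite /monomial_le lt_ar; apply: contraTneq lt_ar => ->; rewrite ltnn.
(* [qm_vector] is an initial segment of [dvector], so a strict inequality there decides the
   comparison. *)
have vecE u : exists v, dvector u = qm_vector u ++ v.
  exists [seq dcriterion 4 (dpath u i) | i <- iota 1 (arity u)].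
  rewrite /qm_vector /path_words /dvector /= !cats0 -!catA -!map_comp.
  by congr (_ ++ (_ ++ (_ ++ (_ ++ _)))); apply: eq_map => i;
     rewrite /dcriterion /= path_word_dpath.
have sz : size (qm_vector s) = size (qm_vector t).
  by rewrite /qm_vector /path_words eq_ar /= !cats0 !size_cat !size_map !size_iota.
rewrite monomial_leE //; have [vs ->] := vecE s; have [vt ->] := vecE t.
rewrite lex_le_cat // lt_v (eqseq_cat _ _ sz).
move: lt_v; rewrite lex_lt_le => /andP[_ ne_v].
by rewrite (negPf ne_v) /=; apply: contraNneq ne_v => ->.
Qed.

End Ordering.

(** * A DerCom algebra *)

Local Open Scope ring_scope.

Section LinearExtension.
Variables (F : fieldType) (K : choiceType) (V : lmodType F).

Definition lin (h : K -> V) (u : {malg F[K]}) : V :=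
  \sum_(k <- msupp u) u@_k *: h k.

Lemma linEw h (D : {fset K}) (u : {malg F[K]}) :
  fsubset (msupp u) D -> lin h u = \sum_(k <- D) u@_k *: h k.
Proof.
move=> sub; rewrite /lin (big_fset_incl _ sub) // => k kD.
by move/mcoeff_outdom => ->; rewrite scale0r.
Qed.

Lemma lin_is_linear h : linear (lin h).
Proof.
move=> a u v; pose D := fsetU (msupp u) (msupp v).
have sub : fsubset (msupp (a *: u + v)) D.
  apply: (fsubset_trans (msuppD_le _ _)); apply: fsetSU; exact: msuppZ_le.
rewrite (linEw _ sub) (linEw h (fsubsetUl _ (msupp v) : fsubset _ D)).
rewrite (linEw h (fsubsetUr (msupp u) _ : fsubset _ D)).
rewrite scaler_sumr -big_split; apply: eq_bigr => k _.
by rewrite mcoeffD mcoeffZ scalerDl scalerA.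
Qed.

HB.instance Definition _ h :=
  GRing.isLinear.Build F {malg F[K]} V *:%R (lin h) (lin_is_linear h).

Lemma linU h c k : lin h << c *g k >> = c *: h k.
Proof.
rewrite (linEw _ msuppU_le) big_seq_fset1 mcoeffU eqxx mulr1n //.
Qed.

Lemma linU1 h k : lin h << k >> = h k.
Proof. by rewrite linU scale1r. Qed.

Lemma lin_malg (h : {linear {malg F[K]} -> V}) u :
  h u = lin (fun k => h << k >>) u.
Proof.
rewrite {1}(monalgE u) linear_sum; apply: eq_bigr => k _.
rewrite -linearZ; congr (h _); apply/malgP => j.
by rewrite mcoeffZ !mcoeffU mulrnAr mulr1.
Qed.

End LinearExtension.

Section Bilinear.
Variables (F : fieldType) (K : choiceType).
Local Notation A := {malg F[K]}.

Definition bil (h : K -> K -> A) (u v : A) : A := lin (fun k => lin (h k) v) u.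

Lemma bilPl h a u v w : bil h (a *: u + v) w = a *: bil h u w + bil h v w.
Proof. exact: lin_is_linear. Qed.

Lemma bilPr h a u v w : bil h w (a *: u + v) = a *: bil h w u + bil h w v.
Proof.
rewrite /bil /lin scaler_sumr -big_split; apply: eq_bigr => k _ /=.
by rewrite [X in _ *: X = _]lin_is_linear scalerDr !scalerA mulrC.
Qed.

Lemma bilUU h j k : bil h << j >> << k >> = h j k.
Proof. by rewrite /bil !linU1. Qed.

Lemma bilUl h j v : bil h << j >> v = lin (h j) v.
Proof. by rewrite /bil linU1. Qed.

Lemma bilUl0 h j v : (forall k, h j k = 0) -> bil h << j >> v = 0.
Proof. by move=> h0; rewrite bilUl /lin big1 // => k _; rewrite h0 scaler0. Qed.

(** Kept unbundled so that linearity of an expression nested in [bil] is found syntactically;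
    [linear1_ext] then reduces multilinear identities to basis elements. *)
Definition linear1 (h : A -> A) := forall a u v, h (a *: u + v) = a *: h u + h v.

Lemma linear1_ext h : linear1 h -> (forall k, h << k >> = 0) -> forall u, h u = 0.
Proof.
move=> lh h0 u; pose hl := GRing.isLinear.Build F A A *:%R h lh.
pose H : {linear A -> A} := HB.pack h hl.
rewrite -[h u]/(H u) lin_malg /lin big1 // => k _.
by rewrite [H _]h0 scaler0.
Qed.

Lemma linear1_id : linear1 id. Proof. by []. Qed.

Lemma linear1_bill h g w : linear1 g -> linear1 (fun x => bil h (g x) w).
Proof. by move=> lg a u v; rewrite lg bilPl. Qed.

Lemma linear1_bilr h g w : linear1 g -> linear1 (fun x => bil h w (g x)).
Proof. by move=> lg a u v; rewrite lg bilPr. Qed.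

Lemma linear1D g g' : linear1 g -> linear1 g' -> linear1 (fun x => g x + g' x).
Proof. by move=> lg lg' a u v; rewrite lg lg' scalerDr addrACA. Qed.

Lemma linear1N g : linear1 g -> linear1 (fun x => - g x).
Proof. by move=> lg a u v; rewrite lg opprD scalerN. Qed.

Lemma bil0l h v : bil h 0 v = 0.
Proof. exact: linear0. Qed.

Lemma bil0r h v : bil h v 0 = 0.
Proof. by rewrite /bil {1}/lin big1 // => k _; rewrite linear0 scaler0. Qed.

Lemma bilDl h u v w : bil h (u + v) w = bil h u w + bil h v w.
Proof. by have := bilPl h 1 u v w; rewrite !scale1r. Qed.

Lemma bilDr h u v w : bil h w (u + v) = bil h w u + bil h w v.
Proof. by have := bilPr h 1 u v w; rewrite !scale1r. Qed.

Lemma bilZl h a u w : bil h (a *: u) w = a *: bil h u w.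
Proof. by have := bilPl h a u 0 w; rewrite bil0l !addr0. Qed.

Lemma bilZr h a u w : bil h w (a *: u) = a *: bil h w u.
Proof. by have := bilPr h a u 0 w; rewrite bil0r !addr0. Qed.

Lemma bilNl h u w : bil h (- u) w = - bil h u w.
Proof. by rewrite -scaleN1r bilZl scaleN1r. Qed.

Lemma bilNr h u w : bil h w (- u) = - bil h w u.
Proof. by rewrite -scaleN1r bilZr scaleN1r. Qed.

Lemma bil_suml h (I : Type) (r : seq I) (G : I -> A) w :
  bil h (\sum_(i <- r) G i) w = \sum_(i <- r) bil h (G i) w.
Proof.
elim: r => [|i r IH]; first by rewrite !big_nil bil0l.
by rewrite !big_cons bilDl IH.
Qed.

Lemma bil_sumr h (I : Type) (r : seq I) (G : I -> A) w :
  bil h w (\sum_(i <- r) G i) = \sum_(i <- r) bil h w (G i).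
Proof.
elim: r => [|i r IH]; first by rewrite !big_nil bil0r.
by rewrite !big_cons bilDr IH.
Qed.

End Bilinear.

(* A letter ((a, c), x) carries the label a and the weight c by which words are
   compared; x is either a generator of colour L or the code of a product
   m(s, w) of a monomial s of colour S and a word w. *)
Definition letter : Type := (nat * nat * (nat + nat))%type.
HB.instance Definition _ := Countable.on letter.
Notation word := (seq letter).
(* The piece (i, w) stands for the generator i of colour S acted upon by w. *)
Definition piece : Type := (nat * word)%type.
HB.instance Definition _ := Countable.on piece.
Notation smon := (seq piece).
Variant basis : Type := SMon of smon | LWord of word.
Definition sum_of_basis (b : basis) : smon + word :=
  match b with SMon s => inl s | LWord w => inr w end.
Definition basis_of_sum (b : smon + word) : basis :=
  match b with inl s => SMon s | inr w => LWord w end.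
Lemma sum_of_basisK : cancel sum_of_basis basis_of_sum. Proof. by case. Qed.
HB.instance Definition _ := Countable.copy basis (can_type sum_of_basisK).

(** * The operations of the model and the relations of DerCom in it *)

Section Model.
Variables (F : fieldType) (N : nat).

Local Notation A := {malg F[basis]}.

(** Monomials are multisets of pieces. An arbitrary total order, here that of the codes, selects a
    sorted representative. *)
Definition piece_le (p q : piece) : bool := (choice.pickle p <= choice.pickle q)%N.
Definition snorm (s : smon) : smon := sort piece_le s.

Lemma snorm_perm s t : perm_eq s t -> snorm s = snorm t.
Proof.
move/perm_sortP; apply; first by move=> p q; apply: leq_total.
  by move=> q p r; apply: leq_trans.
move=> p q; rewrite /piece_le -eqn_leq => /eqP.
exact: (pcan_inj choice.pickleK).
Qed.

Lemma perm_snorm s : perm_eq (snorm s) s.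
Proof. by rewrite perm_sort. Qed.

Lemma snorm_eq_perm s t : snorm s = snorm t -> perm_eq s t.
Proof. by move=> eq_st; rewrite -(permPl (perm_snorm s)) eq_st perm_snorm. Qed.

Definition lab (x : letter) : nat := x.1.1.
Definition weight (x : letter) : nat := x.1.2.

(** The labels are the digits of a numeral in base [N]: for words of equal length with labels below
    [N], comparing values is comparing label sequences lexicographically. *)
Fixpoint word_value (w : word) : nat :=
  if w is x :: w' then (lab x * N ^ size w' + word_value w')%N else 0%N.
Definition word_weight (w : word) : nat := sumn (map weight w).
Definition word_lab (w : word) : nat := foldr minn N (map lab w).

Definition smon_weight (s : smon) : nat :=
  sumn [seq (word_value p.2 + word_weight p.2)%N | p <- s].
Definition piece_lab (p : piece) : nat := minn p.1 (word_lab p.2).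
Definition smon_lab (s : smon) : nat := foldr minn N (map piece_lab s).

(** The weight stores the values and weights of both arguments, so that a change inside an argument
    stays visible when the letter is used in longer words. *)
Definition mletter (s : smon) (w : word) : letter :=
  ((minn (smon_lab s) (word_lab w),
    (smon_weight s + (word_value w + word_weight w))%N), inr (choice.pickle (s, w))).

(** Builds in m(s, m(s', w)) = m(s s', w): a one-letter word that codes an earlier product is
    unpacked and the two monomials are merged. *)
Definition mword (s : smon) (w : word) : letter :=
  if w is [:: (_, inr k)] then
    if choice.unpickle k is Some (s', w') then mletter (snorm (s ++ s')) w'
    else mletter s w
  else mletter s w.

Definition act (w : word) (p : piece) : piece := (p.1, w ++ p.2).

Definition alpha_b (b c : basis) : A :=
  if (b, c) is (SMon s, SMon t) then << SMon (snorm (s ++ t)) >> else 0.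
Definition beta_b (b c : basis) : A :=
  if (b, c) is (LWord u, LWord v)
  then << LWord (u ++ v) >> - << LWord (v ++ u) >> else 0.
Definition der (w : word) (s : smon) : A :=
  \sum_(p <- s) << SMon (snorm (act w p :: rem p s)) >>.
Definition d_b (b c : basis) : A :=
  if (b, c) is (SMon s, LWord w) then der w s else 0.
Definition m_b (b c : basis) : A :=
  if (b, c) is (SMon s, LWord w) then << LWord [:: mword s w] >> else 0.

Definition alphaA := bil alpha_b.
Definition betaA := bil beta_b.
Definition dA := bil d_b.
Definition mA := bil m_b.

Lemma alphaSS s t :
  alphaA << SMon s >> << SMon t >> = << SMon (snorm (s ++ t)) >>.
Proof. exact: bilUU. Qed.
Lemma alphaSL s w : alphaA << SMon s >> << LWord w >> = 0.
Proof. exact: bilUU. Qed.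
Lemma alphaL w x : alphaA << LWord w >> x = 0. Proof. exact: bilUl0. Qed.
Lemma alpha0l x : alphaA 0 x = 0. Proof. exact: bil0l. Qed.
Lemma alpha0r x : alphaA x 0 = 0. Proof. exact: bil0r. Qed.

Lemma betaLL u v : betaA << LWord u >> << LWord v >> =
  << LWord (u ++ v) >> - << LWord (v ++ u) >>.
Proof. exact: bilUU. Qed.
Lemma betaLS s w : betaA << LWord w >> << SMon s >> = 0.
Proof. exact: bilUU. Qed.
Lemma betaS s x : betaA << SMon s >> x = 0. Proof. exact: bilUl0. Qed.
Lemma beta0l x : betaA 0 x = 0. Proof. exact: bil0l. Qed.
Lemma beta0r x : betaA x 0 = 0. Proof. exact: bil0r. Qed.

Lemma dSL s w : dA << SMon s >> << LWord w >> = der w s.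
Proof. exact: bilUU. Qed.
Lemma dSS s t : dA << SMon s >> << SMon t >> = 0. Proof. exact: bilUU. Qed.
Lemma dL w x : dA << LWord w >> x = 0. Proof. exact: bilUl0. Qed.
Lemma d0l x : dA 0 x = 0. Proof. exact: bil0l. Qed.
Lemma d0r x : dA x 0 = 0. Proof. exact: bil0r. Qed.

Lemma mSL s w : mA << SMon s >> << LWord w >> = << LWord [:: mword s w] >>.
Proof. exact: bilUU. Qed.
Lemma mSS s t : mA << SMon s >> << SMon t >> = 0. Proof. exact: bilUU. Qed.
Lemma mL w x : mA << LWord w >> x = 0. Proof. exact: bilUl0. Qed.
Lemma m0l x : mA 0 x = 0. Proof. exact: bil0l. Qed.
Lemma m0r x : mA x 0 = 0. Proof. exact: bil0r. Qed.

Lemma der_suml w (I : Type) (r : seq I) (G : I -> smon) :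
  dA (\sum_(i <- r) << SMon (G i) >>) << LWord w >> = \sum_(i <- r) der w (G i).
Proof. by rewrite /dA bil_suml; apply: eq_bigr => i _; rewrite bilUU. Qed.

Lemma der_L w s b : dA (der w s) << SMon b >> = 0.
Proof. by rewrite /dA bil_suml big1 // => p _; rewrite bilUU. Qed.

Lemma der_alphal w s t : alphaA (der w s) << SMon t >> =
  \sum_(p <- s) << SMon (snorm (act w p :: rem p s ++ t)) >>.
Proof.
rewrite /alphaA bil_suml; apply: eq_bigr => p _; rewrite bilUU.
congr << SMon _ >>; apply: snorm_perm.
by rewrite -cat_cons perm_cat2r perm_snorm.
Qed.

Lemma der_alphar w s t : alphaA << SMon s >> (der w t) =
  \sum_(p <- t) << SMon (snorm (s ++ act w p :: rem p t)) >>.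
Proof.
rewrite /alphaA bil_sumr; apply: eq_bigr => p _; rewrite bilUU.
by congr << SMon _ >>; apply: snorm_perm; rewrite perm_cat2l perm_snorm.
Qed.

Lemma der_alphaLl w s b : alphaA (der w s) << LWord b >> = 0.
Proof. by rewrite /alphaA bil_suml big1 // => p _; rewrite bilUU. Qed.

Lemma der_alphaLr w s b : alphaA << LWord b >> (der w s) = 0.
Proof. by rewrite /alphaA bil_sumr big1 // => p _; rewrite bilUU. Qed.

Let zeroE := (alpha0l, alpha0r, beta0l, beta0r, d0l, d0r, m0l, m0r,
  alphaSL, alphaL, betaLS, betaS, dSS, dL, mSS, mL, der_L, der_alphaLl,
  der_alphaLr, oppr0, addr0, add0r).

Ltac linear1_tac := repeat
  first [exact: linear1_id | apply: linear1D | apply: linear1N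
        | apply: linear1_bill | apply: linear1_bilr].

Lemma alphaA_comm u v : alphaA u v = alphaA v u.
Proof.
apply/eqP; rewrite -subr_eq0; apply/eqP.
apply: (linear1_ext (h := fun u => alphaA u v - alphaA v u)) => [|b].
  by linear1_tac.
apply: (linear1_ext (h := fun v => alphaA _ v - alphaA v _)) => [|c].
  by linear1_tac.
case: b c => [s|s] [t|t]; rewrite ?zeroE //.
by rewrite !alphaSS (snorm_perm (t := t ++ s)) ?subrr // perm_catC.
Qed.

Lemma betaA_anti u v : betaA u v = - betaA v u.
Proof.
apply/eqP; rewrite -addr_eq0; apply/eqP.
apply: (linear1_ext (h := fun u => betaA u v + betaA v u)) => [|b].
  by linear1_tac.
apply: (linear1_ext (h := fun v => betaA _ v + betaA v _)) => [|c].
  by linear1_tac.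
case: b c => [s|s] [t|t]; rewrite ?zeroE //.
by rewrite !betaLL addrC subrKA subrr.
Qed.

Lemma alphaA_assoc x y z :
  alphaA (alphaA x y) z - alphaA x (alphaA y z) = 0.
Proof.
apply: (linear1_ext (h := fun x => alphaA (alphaA x y) z - alphaA x (alphaA y z)))
  => [|b]; first by linear1_tac.
apply: (linear1_ext (h := fun y => alphaA (alphaA _ y) z - alphaA _ (alphaA y z)))
  => [|c]; first by linear1_tac.
apply: (linear1_ext (h := fun z => alphaA (alphaA _ _) z - alphaA _ (alphaA _ z)))
  => [|e]; first by linear1_tac.
case: b c e => [s|s] [t|t] [u|u]; rewrite ?zeroE // !alphaSS ?zeroE //.
rewrite (snorm_perm (t := s ++ snorm (t ++ u))) ?subrr //.
rewrite (perm_trans (perm_cat (perm_snorm _) (perm_refl u))) // -catA.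
by rewrite perm_cat2l perm_sym perm_snorm.
Qed.

Lemma betaA_jacobi x y z :
  betaA (betaA x y) z - betaA (betaA x z) y - betaA x (betaA y z) = 0.
Proof.
apply: (linear1_ext (h := fun x =>
    betaA (betaA x y) z - betaA (betaA x z) y - betaA x (betaA y z)))
  => [|b]; first by linear1_tac.
apply: (linear1_ext (h := fun y =>
    betaA (betaA _ y) z - betaA (betaA _ z) y - betaA _ (betaA y z)))
  => [|c]; first by linear1_tac.
apply: (linear1_ext (h := fun z =>
    betaA (betaA _ _) z - betaA (betaA _ z) _ - betaA _ (betaA _ z)))
  => [|e]; first by linear1_tac.
case: b c e => [s|u] [t|v] [r|w]; rewrite ?zeroE // !betaLL;
  rewrite /betaA ?(bilDl, bilNl, bilDr, bilNr) -?/betaA ?zeroE //.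
rewrite !betaLL -!catA; apply/malgP => k.
rewrite !(mcoeffD, mcoeffN, mcoeff0); ring.
Qed.

Lemma perm_rem (T : eqType) (x : T) s t :
  perm_eq s t -> perm_eq (rem x s) (rem x t).
Proof. by move/permP => st; apply/allP => y _ /=; rewrite !count_mem_rem st. Qed.

Lemma der_perm w s t : perm_eq s t -> der w s = der w t.
Proof.
move=> st; rewrite /der (perm_big _ st); apply: eq_bigr => p _.
by rewrite (snorm_perm (t := act w p :: rem p t)) // perm_cons perm_rem.
Qed.

Lemma perm_rem_cat (T : eqType) (p : T) s t : p \in s ->
  perm_eq (rem p (s ++ t)) (rem p s ++ t).
Proof.
move=> ps; rewrite -(perm_cons p) -(permPl (perm_to_rem _)) ?mem_cat ?ps //.
by rewrite -cat_cons perm_cat2r perm_to_rem.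
Qed.

Lemma derM w s t : der w (s ++ t) =
  \sum_(p <- s) << SMon (snorm (act w p :: rem p s ++ t)) >> +
  \sum_(p <- t) << SMon (snorm (s ++ act w p :: rem p t)) >>.
Proof.
rewrite /der big_cat; congr (_ + _); apply: eq_big_seq => p pin;
  congr << SMon _ >>; apply: snorm_perm.
  by rewrite perm_cons perm_rem_cat.
rewrite perm_sym perm_catC cat_cons perm_cons perm_sym.
rewrite (perm_trans (perm_rem p (_ : perm_eq _ (t ++ s)))) ?perm_rem_cat //.
by rewrite perm_catC.
Qed.

Lemma dA_derivation x y z :
  dA (alphaA x y) z - alphaA x (dA y z) - alphaA (dA x z) y = 0.
Proof.
apply: (linear1_ext (h := fun x =>
    dA (alphaA x y) z - alphaA x (dA y z) - alphaA (dA x z) y))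
  => [|b]; first by linear1_tac.
apply: (linear1_ext (h := fun y =>
    dA (alphaA _ y) z - alphaA _ (dA y z) - alphaA (dA _ z) y))
  => [|c]; first by linear1_tac.
apply: (linear1_ext (h := fun z =>
    dA (alphaA _ _) z - alphaA _ (dA _ z) - alphaA (dA _ z) _))
  => [|e]; first by linear1_tac.
case: b c e => [s|u] [t|v] [r|w]; rewrite ?zeroE // ?alphaSS ?dSL ?zeroE //.
rewrite (der_perm w (perm_snorm _)) derM der_alphal der_alphar.
by rewrite addrK subrr.
Qed.

Lemma act_cat v w p : act v (act w p) = act (v ++ w) p.
Proof. by rewrite /act catA. Qed.

Lemma rem_rem_perm (T : eqType) (p q : T) s :
  perm_eq (rem p (rem q s)) (rem q (rem p s)).
Proof.
by apply/allP => x _ /=; rewrite !count_mem_rem subnAC.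
Qed.

(** Pairs of distinct occurrences are all pairs minus the diagonal, and both of these are
    symmetric. *)
Lemma sum_rem_swap (T : eqType) (s : seq T) (h : T -> T -> A) :
  \sum_(p <- s) \sum_(q <- rem p s) h p q = \sum_(p <- s) \sum_(q <- rem p s) h q p.
Proof.
have remE (g : T -> T -> A) : \sum_(p <- s) \sum_(q <- rem p s) g p q =
    \sum_(p <- s) \sum_(q <- s) g p q - \sum_(p <- s) g p p.
  rewrite -sumrB; apply: eq_big_seq => p ps.
  by rewrite [X in X - _](perm_big _ (perm_to_rem ps)) big_cons addrAC subrr add0r.
by rewrite !remE exchange_big.
Qed.

(** The part of a twofold derivation in which the two words act on different pieces. *)
Definition cross (v w : word) (s : smon) : A :=
  \sum_(p <- s) \sum_(q <- rem p s)
    << SMon (snorm (act v q :: act w p :: rem q (rem p s))) >>.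

Lemma cross_sym v w s : cross v w s = cross w v s.
Proof.
rewrite /cross sum_rem_swap; apply: eq_bigr => p _; apply: eq_bigr => q _.
congr << SMon _ >>; apply: snorm_perm.
rewrite -[X in perm_eq X _]/([:: act v p] ++ [:: act w q] ++ _) perm_catCA /=.
by rewrite !perm_cons rem_rem_perm.
Qed.

(** The second word acts either on the piece already acted upon, which concatenates the words, or on
    another piece. The latter part is symmetric in the words, so the commutator of two derivations
    is the derivation by the commutator: this is [dA_action]. *)
Lemma der_der v w s : dA (der w s) << LWord v >> =
  der (v ++ w) s + cross v w s.
Proof.
rewrite der_suml [in RHS]/der /cross -big_split; apply: eq_bigr => p _ /=.
rewrite (der_perm v (perm_snorm _)) /der big_cons /=.
rewrite eqxx act_cat; congr (_ + _); apply: eq_big_seq => q qin.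
congr << SMon _ >>; apply: snorm_perm; rewrite perm_cons.
by case: eqP => [->|_]; rewrite ?perm_refl // perm_to_rem.
Qed.

Lemma dA_action x y z :
  dA x (betaA y z) - dA (dA x z) y + dA (dA x y) z = 0.
Proof.
apply: (linear1_ext (h := fun x => dA x (betaA y z) - dA (dA x z) y + dA (dA x y) z))
  => [|b]; first by linear1_tac.
apply: (linear1_ext (h := fun y => dA _ (betaA y z) - dA (dA _ z) y + dA (dA _ y) z))
  => [|c]; first by linear1_tac.
apply: (linear1_ext (h := fun z => dA _ (betaA _ z) - dA (dA _ z) _ + dA (dA _ _) z))
  => [|e]; first by linear1_tac.
case: b c e => [s|u] [t|v] [r|w]; rewrite ?zeroE // ?betaLL ?dSL ?zeroE //.
rewrite !der_der /dA bilDr bilNr -/dA !dSL (cross_sym w v).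
by apply/malgP => k; rewrite !(mcoeffD, mcoeffN, mcoeff0); ring.
Qed.

Lemma mA_action x y z : mA (alphaA x y) z - mA x (mA y z) = 0.
Proof.
apply: (linear1_ext (h := fun x => mA (alphaA x y) z - mA x (mA y z)))
  => [|b]; first by linear1_tac.
apply: (linear1_ext (h := fun y => mA (alphaA _ y) z - mA _ (mA y z)))
  => [|c]; first by linear1_tac.
apply: (linear1_ext (h := fun z => mA (alphaA _ _) z - mA _ (mA _ z)))
  => [|e]; first by linear1_tac.
case: b c e => [s|u] [t|v] [r|w]; rewrite ?zeroE // ?alphaSS ?mSL ?zeroE //.
suff -> : mword (snorm (s ++ t)) w = mword s [:: mword t w] by rewrite subrr.
have mE (s1 s2 : smon) u : mword s1 [:: mletter s2 u] = mletter (snorm (s1 ++ s2)) u.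
  by rewrite /mword /mletter choice.pickleK.
have generic : mletter (snorm (s ++ t)) w = mword s [:: mletter t w] by rewrite mE.
(* If [w] is the letter of a product, both sides unpack it and merge the same three monomials; in
   all other cases [generic] applies. *)
rewrite {1 3}/mword; case: w generic => [|[ac [i|k]] [|a w]] //.
case: (choice.unpickle k) => [[s' w'] _|//]; rewrite mE; congr mletter.
apply: snorm_perm; rewrite (perm_trans (perm_cat (perm_snorm _) (perm_refl s'))) // -catA.
by rewrite perm_cat2l perm_sym perm_snorm.
Qed.

End Model.

Section LinearMaps.
Variables (F : fieldType) (K : choiceType).

Lemma linear1_0 (h : {malg F[K]} -> {malg F[K]}) : linear1 h -> h 0 = 0.
Proof.
by move=> lh; have := lh (-1) 0 0; rewrite scaleN1r oppr0 add0r scaleN1r addNr.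
Qed.

Lemma linear1_sum (h : {malg F[K]} -> {malg F[K]}) (I : Type) (r : seq I)
    (a : I -> F) (x : I -> {malg F[K]}) : linear1 h ->
  h (\sum_(i <- r) a i *: x i) = \sum_(i <- r) a i *: h (x i).
Proof.
move=> lh; elim: r => [|i r IH]; last by rewrite !big_cons lh IH.
by rewrite !big_nil linear1_0.
Qed.

Lemma msupp_sum (I : eqType) (r : seq I) (G : I -> {malg F[K]}) k :
  k \in msupp (\sum_(i <- r) G i) -> exists2 i, i \in r & k \in msupp (G i).
Proof.
elim: r => [|i r IH]; first by rewrite big_nil msupp0 inE.
rewrite big_cons => /(fsubsetP (msuppD_le _ _)); rewrite inE => /orP[ki|/IH[j jr kj]].
  by exists i => //; apply: mem_head.
by exists j => //; rewrite inE jr orbT.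
Qed.

End LinearMaps.

(** * Evaluation of trees in the model and its kernel *)

Section Evaluation.
Variables (F : fieldType) (N : nat).
Local Notation A := {malg F[basis]}.
Local Notation assignment := (Defs.col -> nat -> A).
Implicit Types (rho : assignment).

Definition op_sym (x : symgen) : A -> A -> A :=
  match x with
  | symAlpha => @alphaA F | symBeta => @betaA F | symD => @dA F | symM => mA N
  end.

Definition op_gen (x : gen) (u v : A) : A :=
  match x with
  | opAlpha => alphaA u v | opBeta => betaA u v
  | opD => dA u v | opE => dA v u | opM => mA N u v | opN => mA N v u
  end.

Lemma op_shuffle x u v : op_gen (shuffle_gen x) u v = op_sym x u v.
Proof. by case: x. Qed.

Lemma op_opposite x u v :
  op_gen (opposite_gen x) v u = (-1) ^+ opposite_sign x *: op_sym x u v.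
Proof.
case: x => /=; rewrite ?expr0 ?scale1r //; first exact: alphaA_comm.
by rewrite expr1 scaleN1r betaA_anti.
Qed.

Lemma linear1_opl x g w : linear1 g -> linear1 (fun u => op_gen x (g u) w).
Proof. by case: x => lg /=; (apply: linear1_bill || apply: linear1_bilr). Qed.

Lemma linear1_opr x g w : linear1 g -> linear1 (fun u => op_gen x w (g u)).
Proof. by case: x => lg /=; (apply: linear1_bill || apply: linear1_bilr). Qed.

Fixpoint ev rho (t : tree gen) : A :=
  match t with
  | Leaf c i => rho c i
  | Node x a b => op_gen x (ev rho a) (ev rho b)
  end.

Definition evl rho : {malg F[tree gen]} -> A := lin (ev rho).

Lemma eq_ev rho rho' t :
  (forall c i, i \in labels t -> rho c i = rho' c i) -> ev rho t = ev rho' t.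
Proof.
elim: t => /= [c i h|x a IHa b IHb h]; first by apply: h; rewrite inE.
rewrite IHa ?IHb // => c i ii; apply: h; rewrite labels_node mem_cat ii ?orbT //.
Qed.

Lemma ev_relabel rho f t : ev rho (relabel f t) = ev (fun c i => rho c (f i)) t.
Proof. by elim: t => //= x a -> b ->. Qed.

Lemma ev_graft rho l f s t : ev rho (graft l f s t) =
  ev (fun c i => if i == l then ev rho s else rho c (f i)) t.
Proof. by elim: t => [c i|x a IHa b IHb] /=; rewrite ?IHa ?IHb //; case: ifP. Qed.

(** With distinct labels, only one of the two subtrees at a vertex contains [l], so each operation
    is used in one argument only. *)
Lemma ev_linear_leaf rho l t : uniq (labels t) -> l \in labels t ->
  linear1 (fun x => ev (fun c i => if i == l then x else rho c i) t).
Proof.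
elim: t => [c i|y a IHa b IHb].
  by move=> _; rewrite inE => /eqP -> /=; rewrite eqxx => u v w.
rewrite labels_node cat_uniq mem_cat => /and3P[ua /hasPn dis ub].
have const s : l \notin labels s -> forall x,
    ev (fun c i => if i == l then x else rho c i) s = ev rho s.
  by move=> ls x; apply: eq_ev => c i ii; case: eqP => // il; rewrite il (negPf ls) in ii.
case/boolP: (l \in labels a) => [la _|la lb].
  have lb : l \notin labels b by apply: contraL la => /dis.
  move=> u v w /=; rewrite !(const _ lb).
  exact: (linear1_opl _ _ (IHa ua la)).
move=> u v w /=; rewrite !(const _ la).
exact: (linear1_opr _ _ (IHb ub lb)).
Qed.

Lemma evl_comp rho l f g u v : evl rho (comp_element l f g u v) =
  \sum_(s <- msupp u) \sum_(t <- msupp v) (u@_s * v@_t) *: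
    ev (fun c i => if i == l then ev (fun c j => rho c (g j)) t else rho c (f i)) s.
Proof.
rewrite /evl /comp_element linear_sum; apply: eq_bigr => s _.
rewrite linear_sum; apply: eq_bigr => t _ /=.
by rewrite linU /comp_tree ev_graft ev_relabel.
Qed.

(** All assignments are quantified over because grafting turns an assignment into another one. They
    may ignore colours: the operations vanish on basis elements of the wrong colour, and the
    identities hold on the whole model. *)
Definition ev_kernel : component_family F := fun chi c u =>
  in_component chi c u /\ forall rho, evl rho u = 0.

Lemma in_component_comp chi c chi' l f g (u v : {malg F[tree gen]}) :
  in_component chi c u -> in_component chi' (nth colS chi l.-1) v ->
  shuffle (size chi) (size chi') l f g ->
  in_component (comp_incols f g chi chi') c (comp_element l f g u v).
Proof.
move=> uc vc sh w /msupp_sum[s su] /msupp_sum[t tv].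
rewrite msuppU; case: ifP => // _; rewrite inE => /eqP ->.
exact: component_comp (uc s su) (vc t tv) sh.
Qed.

Lemma ev_kernel_ideal : operadic_ideal ev_kernel.
Proof.
split.
- by move=> chi c u [].
- by move=> chi c; split=> [t|rho]; rewrite ?msupp0 ?inE // /evl linear0.
- move=> chi c a u v [uc u0] [vc v0]; split=> [t|rho]; last first.
    by rewrite [LHS]lin_is_linear -!/(evl _ _) u0 v0 scaler0 addr0.
  move/(fsubsetP (msuppD_le _ _)); rewrite inE => /orP[|/vc //].
  by move/(fsubsetP (msuppZ_le _ _))/uc.
- move=> chi c chi' l f g u v [uc u0] vc sh; split=> [|rho].
    exact: in_component_comp sh.
  rewrite evl_comp exchange_big big1 // => t _ /=.
  under eq_bigr => s _ do rewrite mulrC -scalerA.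
  (* For fixed [t] the inserted value only changes the assignment, and [u] vanishes at every
     assignment. *)
  rewrite -scaler_sumr; pose rho' c i :=
    if i == l then ev (fun c j => rho c (g j)) t else rho c (f i).
  by rewrite -[X in _ *: X]/(evl rho' u) u0 scaler0.
move=> chi c chi' l f g u v uc [vc v0] sh; split=> [|rho].
  exact: in_component_comp sh.
rewrite evl_comp big1_seq // => s /andP[_ su].
under eq_bigr => t _ do rewrite -scalerA.
rewrite -scaler_sumr; apply/eqP; rewrite scaler_eq0; apply/orP; right; apply/eqP.
have /and3P[sm /eqP s_chi _] := uc s su.
have ar_s : arity s = size chi by rewrite -s_chi size_map size_iota.
have ls : l \in labels s by rewrite monomial_mem // ar_s; case: sh.
(* For fixed [s] the evaluation is linear in the leaf [l], into which the vanishing value of [v] is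
   inserted. *)
have lin_s := ev_linear_leaf (fun c i => rho c (f i)) (monomial_uniq sm) ls.
rewrite -(linear1_sum _ _ (fun t => ev (fun c j => rho c (g j)) t) lin_s).
rewrite (_ : \sum_(t <- msupp v) v@_t *: ev (fun c j => rho c (g j)) t = 0);
  last exact: v0.
exact: linear1_0 lin_s.
Qed.

Fixpoint ev_sym rho (t : tree symgen) : A :=
  match t with
  | Leaf c i => rho c i
  | Node x a b => op_sym x (ev_sym rho a) (ev_sym rho b)
  end.

(** The signs in [shuffle_form] come from reversed brackets and match those of [op_opposite]. A
    shuffle relation therefore evaluates like the symmetric relation at permuted arguments, without
    cases on the permutation. *)
Lemma ev_shuffle_form rho t :
  ev rho (shuffle_form t).2 = (-1) ^+ (shuffle_form t).1 *: ev_sym rho t.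
Proof.
elim: t => [c i|x a] /=; first by rewrite scale1r.
case: (shuffle_form a) => sa a' /= IHa b; case: (shuffle_form b) => sb b' /= IHb.
have opZ : op_sym x (ev rho a') (ev rho b') =
    (-1) ^+ (sa (+) sb) *: op_sym x (ev_sym rho a) (ev_sym rho b).
  rewrite IHa IHb; case: x => /=;
    rewrite /alphaA /betaA /dA /mA bilZl bilZr scalerA signr_addb //.
case: ifP => _ /=; first by rewrite op_shuffle opZ.
by rewrite op_opposite opZ scalerA -signr_addb addbC.
Qed.

Lemma evl_shuffle_element rho r sigma : evl rho (shuffle_element F r sigma) =
  \sum_(p <- r) p.1%:~R *: ev_sym rho (relabel sigma p.2).
Proof.
rewrite /evl /shuffle_element linear_sum; apply: eq_bigr => p _ /=.
have := ev_shuffle_form rho (relabel sigma p.2).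
case: (shuffle_form _) => b t /= ev_t; rewrite linU ev_t scalerA mulrAC.
by rewrite -expr2 sqrr_sign mul1r.
Qed.

Lemma sum_pair (V : nmodType) (I : Type) (p q : I) (h : I -> V) :
  \sum_(i <- [:: p; q]) h i = h p + h q.
Proof. by rewrite !big_cons big_nil addr0. Qed.

Lemma sum_triple (V : nmodType) (I : Type) (p q r : I) (h : I -> V) :
  \sum_(i <- [:: p; q; r]) h i = h p + h q + h r.
Proof. by rewrite !big_cons big_nil addr0 addrA. Qed.

Lemma evl_relation rho u : dercom_shuffle_relation u -> evl rho u = 0.
Proof.
case=> sigma [i [lt_i _ ->]]; rewrite evl_shuffle_element.
have e1 (v : A) : 1%:~R *: v = v by rewrite scale1r.
have eN (v : A) : (-1)%:~R *: v = - v by rewrite mulrN1z scaleN1r.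
case: i lt_i => [_|[_|[_|[_|[_|i lt_i]]]]]; last by rewrite /= ltnNge in lt_i.
all: cbn [nth dercom_relations]; rewrite ?sum_pair ?sum_triple.
all: cbn [fst snd relabel ev_sym op_sym]; rewrite ?eN ?e1.
- exact: alphaA_assoc.
- exact: betaA_jacobi.
- exact: dA_derivation.
- exact: dA_action.
exact: mA_action.
Qed.

Lemma relation_kernel chi c u :
  generated_ideal (@dercom_shuffle_relation F) chi c u -> ev_kernel chi c u.
Proof.
apply; first exact: ev_kernel_ideal.
by move=> chi' c' v vG vc; split=> // rho; apply: evl_relation.
Qed.

End Evaluation.

(** * Normal trees and their leads *)

Section NormalTrees.
Implicit Types t a b : tree gen.

Definition is_beta (x : gen) := if x is opBeta then true else false.
Definition is_mn (x : gen) := is_mnb x && ~~ is_beta x.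
Definition rooted (P : pred gen) t := if t is Node x _ _ then P x else false.

(** The root patterns that lead some relation. In a normal tree, products are left combs whose
    arguments have increasing least labels; in beta(beta(a1, a2), b) the least label of b is below
    that of a2, as for Lyndon brackets; d and e have no product as S-argument and no bracket as
    L-argument; the L-argument of m or n is not rooted at m or n. *)
Definition redex_at (x : gen) a b : bool :=
  match x with
  | opAlpha => rooted is_alpha b ||
      (if a is Node opAlpha _ a2 then (minlabel b < minlabel a2)%N else false)
  | opBeta => if a is Node opBeta _ a2 then (minlabel a2 < minlabel b)%N else false
  | opD => rooted is_alpha a || rooted is_beta b
  | opE => rooted is_alpha b || rooted is_beta a
  | opM => rooted is_mn b
  | opN => rooted is_mn a
  end.

Fixpoint normal t : bool :=
  if t is Node x a b then [&& ~~ redex_at x a b, normal a & normal b] else true.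

(** Labels are distinct and below [N] but need not be an initial segment, so that the notion passes
    to subtrees. *)
Definition good (N : nat) t : bool :=
  [&& well_coloured t, shuffle_tree t, uniq (labels t),
      all (ltn^~ N) (labels t) & normal t].

Lemma good_node N x a b : good N (Node x a b) ->
  [/\ good N a, good N b, outcol a = incol1 x, outcol b = incol2 x &
      (minlabel a < minlabel b)%N /\ ~~ redex_at x a b].
Proof.
rewrite /good labels_node cat_uniq all_cat /=.
case/and5P=> /and4P[/eqP oa /eqP ob wa wb] /and3P[lt_ab sa sb].
case/and3P=> ua _ ub /andP[la lb] /and3P[red na nb].
by rewrite wa wb sa sb ua ub la lb na nb.
Qed.

Lemma good_uniq N t : good N t -> uniq (labels t).
Proof. by case/and5P. Qed.

Lemma good_min_lt N t : good N t -> (minlabel t < N)%N.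
Proof. by case/and5P=> _ _ _ /allP lt_N _; apply/lt_N/minlabel_in. Qed.

End NormalTrees.

Section WordValues.
Variable N : nat.
Implicit Types (u v w : word) (s : smon).

Lemma word_value_cat u v :
  word_value N (u ++ v) = (word_value N u * N ^ size v + word_value N v)%N.
Proof. by elim: u => //= x u ->; rewrite size_cat expnD; lia. Qed.

Lemma word_weight_cat u v : word_weight (u ++ v) = (word_weight u + word_weight v)%N.
Proof. by rewrite /word_weight map_cat sumn_cat. Qed.

Lemma foldr_minn_cat (r r' : seq nat) :
  foldr minn N (r ++ r') = minn (foldr minn N r) (foldr minn N r').
Proof.
elim: r => /= [|i r ->]; last by rewrite minnA.
by apply/esym/minn_idPr; elim: r' => //= i r'; rewrite geq_min orbC => ->.
Qed.

Lemma foldr_minn_le (r : seq nat) i : i \in r -> (foldr minn N r <= i)%N.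
Proof.
elim: r => //= j r IH; rewrite inE geq_min => /orP[/eqP ->|/IH ->].
  by rewrite leqnn.
by rewrite orbT.
Qed.

Lemma word_lab_cat u v : word_lab N (u ++ v) = minn (word_lab N u) (word_lab N v).
Proof. by rewrite /word_lab map_cat foldr_minn_cat. Qed.

Lemma word_lab_le w x : x \in w -> (word_lab N w <= lab x)%N.
Proof. by move=> xw; apply/foldr_minn_le/map_f. Qed.

Lemma smon_lab_cat s t : smon_lab N (s ++ t) = minn (smon_lab N s) (smon_lab N t).
Proof. by rewrite /smon_lab map_cat foldr_minn_cat. Qed.

Lemma smon_lab_perm s t : perm_eq s t -> smon_lab N s = smon_lab N t.
Proof.
have le r r' : perm_eq r r' -> (smon_lab N r <= smon_lab N r')%N.
  rewrite /smon_lab => /(perm_map (piece_lab N)) /perm_mem.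
  elim: (map _ r') => /= [_|i q IH sub].
    by elim: (map _ r) => //= j q; rewrite geq_min orbC => ->.
  rewrite leq_min (foldr_minn_le (i := i)) ?sub ?mem_head //=.
  have {IH} : {subset q <= map (piece_lab N) r}.
    by move=> j jq; rewrite sub inE jq orbT.
  elim: q {sub} => /= [_|j q IH sub].
    by elim: (map _ r) => //= j q; rewrite geq_min orbC => ->.
  rewrite leq_min foldr_minn_le ?IH // => [k kq|]; apply: sub; rewrite inE ?eqxx //.
  by rewrite kq orbT.
by move=> st; apply/eqP; rewrite eqn_leq !le // perm_sym.
Qed.

Lemma smon_weight_cat s t :
  smon_weight N (s ++ t) = (smon_weight N s + smon_weight N t)%N.
Proof. by rewrite /smon_weight map_cat sumn_cat. Qed.

Lemma smon_weight_perm s t : perm_eq s t -> smon_weight N s = smon_weight N t.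
Proof.
by move=> st; rewrite /smon_weight !sumnE !big_map (perm_big _ st).
Qed.

Lemma word_value_lt w : (forall x, x \in w -> (lab x < N)%N) ->
  (word_value N w < N ^ size w)%N.
Proof.
elim: w => //= x w IH lt_N; have := lt_N x (mem_head _ _).
have := IH (fun y yw => lt_N y (mem_behead (s := x :: w) yw)); rewrite expnS; nia.
Qed.

Lemma snormK s : snorm (snorm s) = snorm s.
Proof. exact/snorm_perm/perm_snorm. Qed.

Lemma mletter_inj s w s' w' :
  mletter N s w = mletter N s' w' -> s = s' /\ w = w'.
Proof. by case=> _ _ /(pcan_inj choice.pickleK) []. Qed.

End WordValues.

Section BilinearCoefficients.
Variables (F : fieldType) (K : choiceType).
Local Notation A := {malg F[K]}.

Lemma mcoeff_sum (I : Type) (r : seq I) (G : I -> A) k :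
  (\sum_(i <- r) G i)@_k = \sum_(i <- r) (G i)@_k.
Proof. exact: raddf_sum. Qed.

Lemma msupp_bil (h : K -> K -> A) u v d : d \in msupp (bil h u v) ->
  exists j k, [/\ j \in msupp u, k \in msupp v & d \in msupp (h j k)].
Proof.
move/msupp_sum=> [j ju] /(fsubsetP (msuppZ_le _ _)) /msupp_sum[k kv].
by move/(fsubsetP (msuppZ_le _ _)) => dk; exists j, k.
Qed.

Lemma sum_fset_delta (V : nmodType) (D : {fset K}) (b : K) (x : V) :
  (b \notin D -> x = 0) -> \sum_(j <- D) (if j == b then x else 0) = x.
Proof.
have [bD _|bD ->//] := boolP (b \in D); last first.
  by rewrite big1 // => j _; case: ifP.
rewrite (bigD1_seq b bD (fset_uniq D)) /= eqxx big1 ?addr0 // => j jb.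
by rewrite (negPf jb).
Qed.

(** How a leading coefficient propagates: the lead of the result comes from the leads of the
    arguments alone, with coefficient 1. *)
Lemma mcoeff_bil (h : K -> K -> A) u v d b c :
  {in msupp u & msupp v, forall j k, (h j k)@_d = ((j == b) && (k == c))%:R} ->
  (bil h u v)@_d = u@_b * v@_c.
Proof.
move=> hd; rewrite mcoeff_sum.
have inner j : j \in msupp u -> (lin (h j) v)@_d = (j == b)%:R * v@_c.
  move=> ju; rewrite mcoeff_sum.
  have step k : k \in msupp v ->
      (v@_k *: h j k)@_d = if k == c then (j == b)%:R * v@_c else 0.
    move=> kv; rewrite mcoeffZ hd //; case: (k =P c) => [->|_].
      by rewrite andbT mulrC.
    by rewrite andbF mulr0.
  rewrite (eq_big_seq _ step) sum_fset_delta // => cv.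
  by rewrite (mcoeff_outdom cv) mulr0.
have step j : j \in msupp u ->
    (u@_j *: lin (h j) v)@_d = if j == b then u@_b * v@_c else 0.
  move=> ju; rewrite mcoeffZ inner //; case: (j =P b) => [->|_].
    by rewrite mul1r.
  by rewrite mul0r mulr0.
rewrite (eq_big_seq _ step) sum_fset_delta // => bu.
by rewrite (mcoeff_outdom bu) mul0r.
Qed.

End BilinearCoefficients.

(** * Every normal tree has a lead *)

Section Leads.
Variables (F : fieldType) (N : nat).

Definition smon_of (b : basis) : smon := if b is SMon s then s else [::].
Definition word_of (b : basis) : word := if b is LWord w then w else [::].
Definition letter0 : letter := ((0, 0), inl 0)%N.

Fixpoint lead (t : tree gen) : basis :=
  match t with
  | Leaf colS i => SMon [:: (i, [::])]
  | Leaf colL i => LWord [:: ((i, 0), inl i)%N]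
  | Node x a b =>
    match x with
    | opAlpha => SMon (snorm (smon_of (lead a) ++ smon_of (lead b)))
    | opBeta => LWord (word_of (lead a) ++ word_of (lead b))
    | opD => SMon (map (act (word_of (lead b))) (smon_of (lead a)))
    | opE => SMon (map (act (word_of (lead a))) (smon_of (lead b)))
    | opM => LWord [:: mletter N (smon_of (lead a)) (word_of (lead b))]
    | opN => LWord [:: mletter N (smon_of (lead b)) (word_of (lead a))]
    end
  end.

Definition generic_leaf (c : Defs.col) (i : nat) : {malg F[basis]} :=
  << lead (Leaf c i) >>.
Local Notation ev0 := (ev N generic_leaf).

(** Equal lengths matter: the word of a further derivation is prepended, and its value is multiplied
    by the same power of [N] in the lead and in the term. *)
Definition piece_above (s0 s : smon) : Prop := exists i u0 u,
  [/\ s0 = [:: (i, u0)], s = [:: (i, u)], size u = size u0,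
      (word_value N u0 <= word_value N u)%N &
      (word_weight u0 <= word_weight u)%N].

(** [isol] is set for trees not rooted at [opAlpha]. Their terms have one piece, so a derivation of
    such a term is a single monomial. *)
Record smon_above (isol : bool) (m : nat) (s0 s : smon) : Prop := SMonAbove {
  sab_lab : smon_lab N s = m;
  sab_weight : (smon_weight N s0 <= smon_weight N s)%N;
  sab_eq : smon_weight N s = smon_weight N s0 -> s = s0;
  sab_piece : isol -> piece_above s0 s }.

(** Value and weight are bounded separately, since concatenation multiplies the value of the left
    word by a power of [N] but merely adds weights. [nomn] is set for trees not rooted at [opM] or
    [opN], where [mword] has nothing to unpack. *)
Record word_above (nomn : bool) (m : nat) (w0 w : word) : Prop := WordAbove {
  wab_size : size w = size w0;
  wab_lab : word_lab N w = m;
  wab_lt : forall x, x \in w -> (lab x < N)%N;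
  wab_value : (word_value N w0 <= word_value N w)%N;
  wab_weight : (word_weight w0 <= word_weight w)%N;
  wab_eq : word_value N w = word_value N w0 -> word_weight w = word_weight w0 ->
    w = w0;
  wab_mword : nomn -> forall s, mword N s w = mletter N s w }.

Record smon_lead (u : {malg F[basis]}) (isol : bool) (m : nat) (s0 : smon) :
    Prop := SMonLead {
  sl_coef : u@_(SMon s0) = 1;
  sl_norm : snorm s0 = s0;
  sl_supp : forall b, b \in msupp u ->
    exists2 s, b = SMon s & smon_above isol m s0 s }.

Record word_lead (u : {malg F[basis]}) (nobeta nomn : bool) (m : nat) (w0 : word) :
    Prop := WordLead {
  wl_coef : u@_(LWord w0) = 1;
  wl_size : if nobeta then size w0 = 1%N else (1 < size w0)%N;
  wl_head : lab (head letter0 w0) = m;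
  wl_supp : forall b, b \in msupp u ->
    exists2 w, b = LWord w & word_above nomn m w0 w }.

Lemma coef1_supp (K : choiceType) (u : {malg F[K]}) b : u@_b = 1 -> b \in msupp u.
Proof. by move=> ub; rewrite -mcoeff_neq0 ub oner_neq0. Qed.

Lemma sl_self u p m s0 : smon_lead u p m s0 -> smon_above p m s0 s0.
Proof. by case=> c _ h; have [s [->]] := h _ (coef1_supp c). Qed.

Lemma wl_self u p q m w0 : word_lead u p q m w0 -> word_above q m w0 w0.
Proof. by case=> c _ _ h; have [s [->]] := h _ (coef1_supp c). Qed.

Lemma wl_gt0 u p q m w0 : word_lead u p q m w0 -> (0 < size w0)%N.
Proof. by case=> _; case: p => [->|/ltnW]. Qed.

Lemma mcoeffU1_lead (K : choiceType) (b : K) :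
  (<< b >> : {malg F[K]})@_b = 1.
Proof. by rewrite mcoeffU eqxx. Qed.

Lemma in_msuppU1 (K : choiceType) (b c : K) :
  c \in msupp (<< b >> : {malg F[K]}) -> c = b.
Proof. by rewrite msuppU oner_eq0 inE => /eqP. Qed.

(** Weights add and neither factor is below its lead, so equal totals force equality in both
    factors. *)
Lemma alpha_lead u v p q m m' s0 t0 :
  smon_lead u p m s0 -> smon_lead v q m' t0 ->
  smon_lead (alphaA u v) false (minn m m') (snorm (s0 ++ t0)).
Proof.
move=> Lu Lv; split; first 2 last.
- move=> b /msupp_bil[j [k [/(sl_supp Lu)[s -> As] /(sl_supp Lv)[t -> At]]]].
  move/in_msuppU1 => ->; exists (snorm (s ++ t)) => //; split=> //.
  + rewrite (smon_lab_perm _ (perm_snorm _)) smon_lab_cat.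
    by rewrite (sab_lab As) (sab_lab At).
  + rewrite !(smon_weight_perm _ (perm_snorm _)) !smon_weight_cat.
    by rewrite leq_add // ?(sab_weight As) ?(sab_weight At).
  rewrite !(smon_weight_perm _ (perm_snorm _)) !smon_weight_cat => eq_w.
  have := sab_weight As; have := sab_weight At => wt ws.
  have [eq_s eq_t] : smon_weight N s = smon_weight N s0 /\
    smon_weight N t = smon_weight N t0 by split; clear -ws wt eq_w; lia.
  by rewrite (sab_eq As eq_s) (sab_eq At eq_t).
- rewrite /alphaA (mcoeff_bil (b := SMon s0) (c := SMon t0)).
    by rewrite (sl_coef Lu) (sl_coef Lv) mulr1.
  move=> j k /(sl_supp Lu)[s -> As] /(sl_supp Lv)[t -> At].
  rewrite mcoeffU; congr (_ *+ nat_of_bool _); apply/eqP/andP; last first.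
    by case=> /eqP[->] /eqP[->].
  case=> eq_st.
  have := smon_weight_perm N (snorm_eq_perm eq_st); rewrite !smon_weight_cat => eq_w.
  have := sab_weight As; have := sab_weight At => wt ws.
  by rewrite (sab_eq As) 1?(sab_eq At) //; lia.
by rewrite snormK.
Qed.

(** The term [z ++ w] of the commutator starts with a label at least [m'], whereas [w0 ++ z0] starts
    with [m < m']; the first digit decides, so only [w ++ z] can compete ([swap]). *)
Lemma beta_lead u v p q p' q' m m' w0 z0 :
  word_lead u p q m w0 -> word_lead v p' q' m' z0 -> (m < m')%N ->
  word_lead (betaA u v) false true (minn m m') (w0 ++ z0).
Proof.
move=> Lu Lv lt_m.
have [w0_gt0 z0_gt0] := (wl_gt0 Lu, wl_gt0 Lv).
have [Sw Sz] := (wl_self Lu, wl_self Lv).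
have mword_long s w : (1 < size w)%N -> mword N s w = mletter N s w.
  by case: w => [|[ac [i|k]] [|y w]].
have Nw0 : (0 < N)%N.
  have := wab_lt Sw; case: (w0) w0_gt0 => // x w _ /(_ x (mem_head _ _)); lia.
have swap w z : word_above q m w0 w -> word_above q' m' z0 z ->
    (word_value N (w0 ++ z0) < word_value N (z ++ w))%N.
  move=> Aw Az.
  (* All that follows the head of [w0 ++ z0] is worth less than one unit of its first digit. *)
  have : (word_value N (behead w0 ++ z0) < N ^ size (behead w0 ++ z0))%N.
    apply: word_value_lt => x; rewrite mem_cat => /orP[/mem_behead xw|xz];
      [exact: wab_lt Sw _ xw|exact: wab_lt Sz _ xz].
  have : (m' <= lab (head letter0 z))%N.
    rewrite -(wab_lab Az); apply: word_lab_le.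
    by case: (z) (wab_size Az) z0_gt0 => [<-//|x ? _ _]; apply: mem_head.
  have := wl_head Lu; have := wab_size Aw; have := wab_size Az.
  case: (w0) w0_gt0 => // x w1 _; case: (z0) z0_gt0 => // y z1 _.
  case: z {Az} => //= y' z' [sz_z] sz_w lab_x le_m' lt_v.
  rewrite !size_cat /= sz_z sz_w -lab_x in le_m' lt_v lt_m *.
  rewrite (_ : size z1 + (size w1).+1 = size w1 + (size z1).+1)%N; last by lia.
  by move: (N ^ _)%N lt_v => B lt_v; nia.
split.
- rewrite /betaA (mcoeff_bil (b := LWord w0) (c := LWord z0)).
    by rewrite (wl_coef Lu) (wl_coef Lv) mulr1.
  move=> j k /(wl_supp Lu)[w -> Aw] /(wl_supp Lv)[z -> Az].
  rewrite mcoeffB !mcoeffU.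
  have -> : (LWord (z ++ w) == LWord (w0 ++ z0)) = false.
    apply/eqP => -[eq_zw]; have := swap _ _ Aw Az.
    by rewrite eq_zw ltnn.
  rewrite subr0; congr (_ *+ nat_of_bool _); apply/eqP/andP; last first.
    by case=> /eqP[->] /eqP[->].
  case=> /eqP; rewrite eqseq_cat ?(wab_size Aw) // => /andP[/eqP -> /eqP ->].
  by rewrite !eqxx.
- by rewrite size_cat; lia.
- rewrite (minn_idPl (ltnW lt_m)) -(wl_head Lu).
  by case: (w0) w0_gt0.
move=> b /msupp_bil[j [k [/(wl_supp Lu)[w -> Aw] /(wl_supp Lv)[z -> Az]]]].
have sz : size (w ++ z) = size (w0 ++ z0).
  by rewrite !size_cat (wab_size Aw) (wab_size Az).
have wt : (word_weight (w0 ++ z0) <= word_weight (w ++ z))%N.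
  by rewrite !word_weight_cat leq_add ?(wab_weight Aw) ?(wab_weight Az).
have lt_N x : x \in w ++ z -> (lab x < N)%N.
  by rewrite mem_cat => /orP[]; [exact: (wab_lt Aw) | exact: (wab_lt Az)].
have long : (1 < size (w ++ z))%N by rewrite sz size_cat; lia.
move/(fsubsetP (msuppB_le _ _)); rewrite inE => /orP[] /in_msuppU1 ->.
  exists (w ++ z) => //; split=> //.
  + by rewrite word_lab_cat (wab_lab Aw) (wab_lab Az).
  + by rewrite !word_value_cat (wab_size Az) leq_add ?leq_mul ?(wab_value Aw)
      ?(wab_value Az).
  + rewrite !word_value_cat (wab_size Az) !word_weight_cat => eq_v eq_wt.
    have B_gt0 : (0 < N ^ size z0)%N by rewrite expn_gt0 Nw0.
    have [v1 v2] := (wab_value Aw, wab_value Az).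
    have [t1 t2] := (wab_weight Aw, wab_weight Az).
    have eq_vz : word_value N z = word_value N z0 by move: (N ^ _)%N eq_v B_gt0 => B; nia.
    have eq_vw : word_value N w = word_value N w0 by move: (N ^ _)%N eq_v B_gt0 => B; nia.
    have [eq_tw eq_tz] : word_weight w = word_weight w0 /\ word_weight z = word_weight z0.
      by split; clear -t1 t2 eq_wt; lia.
    by rewrite (wab_eq Aw eq_vw eq_tw) (wab_eq Az eq_vz eq_tz).
  by move=> _ s; apply: mword_long.
have perm_zw : perm_eq (z ++ w) (w ++ z) by rewrite perm_catC.
have wt_zw : word_weight (z ++ w) = word_weight (w ++ z).
  by rewrite !word_weight_cat addnC.
exists (z ++ w) => //; split.
- by rewrite -sz (perm_size perm_zw).
- by rewrite word_lab_cat (wab_lab Aw) (wab_lab Az) minnC.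
- by move=> x; rewrite (perm_mem perm_zw); apply: lt_N.
- exact: ltnW (swap _ _ Aw Az).
- by rewrite wt_zw.
- by move=> eq_v; have := swap _ _ Aw Az; rewrite eq_v ltnn.
by move=> _ s; apply: mword_long; rewrite (perm_size perm_zw).
Qed.

(** On a single piece the sum in [der] has one term, so the word is simply prepended. *)
Lemma d_lead u v q q' m m' s0 w0 :
  smon_lead u true m s0 -> word_lead v q q' m' w0 ->
  smon_lead (dA u v) true (minn m m') (map (act w0) s0).
Proof.
move=> Lu Lv.
have [i [u0 [_ [s0E _ _ _ _]]]] := sab_piece (sl_self Lu) isT.
have der1 i' (w z : word) : der F w [:: (i', z)] = << SMon [:: (i', w ++ z)] >>.
  by rewrite /der big_seq1 /= eqxx.
have step s w : smon_above true m s0 s -> word_above q' m' w0 w ->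
    der F w s = << SMon (map (act w) s) >>.
  by case/sab_piece/(_ isT) => [? [? [z [_ -> _ _ _]]]] _; rewrite der1.
split.
- rewrite /dA (mcoeff_bil (b := SMon s0) (c := LWord w0)).
    by rewrite (sl_coef Lu) (wl_coef Lv) mulr1.
  move=> j k /(sl_supp Lu)[s -> As] /(wl_supp Lv)[w -> Aw].
  rewrite /d_b (step _ _ As Aw) mcoeffU; congr (_ *+ nat_of_bool _).
  apply/eqP/andP; last first.
    by case=> /eqP[->] /eqP[->].
  have [i' [u' [z [s0E' -> _ _ _]]]] := sab_piece As isT.
  rewrite s0E' => -[/eqP]; rewrite eqseq_cat ?(wab_size Aw) // => /andP[/eqP -> /eqP ->].
  by rewrite !eqxx.
- by rewrite s0E.
move=> b /msupp_bil[j [k [/(sl_supp Lu)[s -> As] /(wl_supp Lv)[w -> Aw]]]].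
rewrite /d_b (step _ _ As Aw) => /in_msuppU1 ->.
exists (map (act w) s) => //.
have [i' [u' [z [s0E' sE sz vz wz]]]] := sab_piece As isT.
have above : piece_above (map (act w0) s0) (map (act w) s).
  exists i', (w0 ++ u'), (w ++ z); rewrite s0E' sE; split=> //.
  + by rewrite !size_cat sz (wab_size Aw).
  + by rewrite !word_value_cat sz leq_add ?leq_mul ?(wab_value Aw).
  + by rewrite !word_weight_cat leq_add ?(wab_weight Aw).
split=> //.
- rewrite -(sab_lab As) -(wab_lab Aw) sE /smon_lab /= /piece_lab /= word_lab_cat.
  by lia.
- case: above => [? [? [? [-> -> _ ? ?]]]].
  by rewrite /smon_weight /= !addn0 leq_add.
rewrite s0E' sE /smon_weight /= !addn0 !word_value_cat !word_weight_cat sz => eq_w.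
have Az := sab_eq As; rewrite s0E' sE /smon_weight /= !addn0 in Az.
have [v1 t1] := (wab_value Aw, wab_weight Aw).
have le1 : (word_value N w0 * N ^ size u' <= word_value N w * N ^ size u')%N.
  by rewrite leq_mul.
have [->] : [:: (i', z)] = [:: (i', u')] by apply: Az; lia.
(* The power could vanish only for [N = 0], but the nonempty [w0] has labels below [N]. *)
have [B0|B_gt0] := posnP (N ^ size u')%N.
  have N0 : N = 0%N by move/eqP: B0; rewrite expn_eq0 => /andP[/eqP].
  have := wl_gt0 Lv; have := wab_lt (wl_self Lv).
  by case: (w0) => // x ? /(_ x (mem_head _ _)); rewrite N0.
have eq_v : word_value N w = word_value N w0.
  by move: (N ^ _)%N B_gt0 le1 eq_w => B; nia.
by rewrite (wab_eq Aw eq_v) //; move: eq_w; rewrite eq_v; lia.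
Qed.

(** All the new letters carry the same label, so the value is constant and the whole excess of the
    arguments passes into the weight. *)
Lemma m_lead u v p q m m' s0 w0 :
  smon_lead u p m s0 -> word_lead v q true m' w0 -> (m < N)%N ->
  word_lead (mA N u v) true false (minn m m') [:: mletter N s0 w0].
Proof.
move=> Lu Lv lt_m; have [Ss Sw] := (sl_self Lu, wl_self Lv).
split=> //.
- rewrite /mA (mcoeff_bil (b := SMon s0) (c := LWord w0)).
    by rewrite (sl_coef Lu) (wl_coef Lv) mulr1.
  move=> j k /(sl_supp Lu)[s -> As] /(wl_supp Lv)[w -> Aw].
  rewrite /m_b (wab_mword Aw) // mcoeffU; congr (_ *+ nat_of_bool _).
  apply/eqP/andP; last first.
    by case=> /eqP[->] /eqP[->].
  move/(congr1 (fun b => head letter0 (word_of b))) => /= eq_l.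
  by have [-> ->] := mletter_inj eq_l; rewrite !eqxx.
- by rewrite /= /lab /= (sab_lab Ss) (wab_lab Sw).
move=> b /msupp_bil[j [k [/(sl_supp Lu)[s -> As] /(wl_supp Lv)[w -> Aw]]]].
rewrite /m_b (wab_mword Aw) // => /in_msuppU1 ->.
exists [:: mletter N s w] => //.
have labE s' w' : smon_above p m s0 s' -> word_above true m' w0 w' ->
    lab (mletter N s' w') = minn m m'.
  by move=> As' Aw'; rewrite /lab /= (sab_lab As') (wab_lab Aw').
have le_w := (sab_weight As, wab_value Aw, wab_weight Aw).
split=> //.
- rewrite /word_lab /= labE //; apply/minn_idPl.
  by rewrite geq_min (ltnW lt_m).
- by move=> x; rewrite inE => /eqP ->; rewrite labE // gtn_min lt_m.
- by rewrite /= !labE.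
- by rewrite /word_weight /= /weight /= !addn0; move: le_w => [[]]; lia.
rewrite /word_weight /= /weight /= !addn0 => _ eq_w.
move: le_w => [[l1 l2] l3].
by rewrite (sab_eq As) 1?(wab_eq Aw) //; lia.
Qed.

(** The flags translate the absence of redexes into what [d_lead] and [m_lead] require, while
    [nobeta] serves to read a tree off its lead. *)
Lemma leadP t : good N t ->
  if outcol t is colS
  then exists2 s, lead t = SMon s &
         smon_lead (ev0 t) (~~ rooted is_alpha t) (minlabel t) s
  else exists2 w, lead t = LWord w &
         word_lead (ev0 t) (~~ rooted is_beta t) (~~ rooted is_mn t) (minlabel t) w.
Proof.
elim: t => [c i gt|x a IHa b IHb /good_node[ga gb oa ob [lt_ab red]]].
  have lt_i : (i < N)%N by exact: good_min_lt gt.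
  have le_i := ltnW lt_i.
  case: c {gt} => /=;
    [exists [:: (i, [::])] => // | exists [:: ((i, 0), inl i)%N] => //]; split=> //.
  - exact: mcoeffU1_lead.
  - move=> c /in_msuppU1 ->; exists [:: (i, [::])] => //; split=> //.
      by rewrite /smon_lab /= /piece_lab /= (minn_idPl le_i) (minn_idPl le_i).
    by move=> _; exists i, [::], [::].
  - exact: mcoeffU1_lead.
  move=> c /in_msuppU1 ->; exists [:: ((i, 0), inl i)%N] => //; split=> //.
    by rewrite /word_lab /= (minn_idPl le_i).
  by move=> y; rewrite inE => /eqP ->.
have {}IHa := IHa ga; have {}IHb := IHb gb.
rewrite oa in IHa; rewrite ob in IHb.
case: x oa ob red IHa IHb => /= oa ob red [wa La Ia] [wb Lb Ib];
  rewrite La Lb /=; eexists=> //.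
- exact: alpha_lead Ia Ib.
- exact: beta_lead Ia Ib lt_ab.
- by case/norP: red => ra rb; apply: d_lead Ib; rewrite ra in Ia.
- by case/norP: red => ra rb; rewrite minnC; apply: d_lead Ia; rewrite ra in Ib.
- by rewrite red in Ib; apply: m_lead Ia Ib _; apply: good_min_lt ga.
by rewrite red in Ia; rewrite minnC; apply: m_lead Ib Ia _; apply: good_min_lt gb.
Qed.

End Leads.

(** * Recovering a normal tree from its lead, and independence *)

Section LeadInjective.
Variables (F : fieldType) (N : nat).

Lemma lead_S (t : tree gen) : good N t -> outcol t = colS -> exists s,
  [/\ lead N t = SMon s, snorm s = s, smon_lab N s = minlabel t,
      (0 < size s)%N & ~~ rooted is_alpha t -> exists i u, s = [:: (i, u)]].
Proof.
move=> gt ot; have := leadP F gt; rewrite ot => -[s Ls Is].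
exists s; split=> //; first exact: sl_norm Is.
  exact: sab_lab (sl_self Is).
  case: s {Ls} Is => // Is; have := sab_lab (sl_self Is).
  by rewrite /smon_lab /= => eqN; have := good_min_lt gt; rewrite -eqN ltnn.
by move=> ra; have [i [u [_ [? _ _ _ _]]]] := sab_piece (sl_self Is) ra; exists i, u.
Qed.

Lemma lead_L (t : tree gen) : good N t -> outcol t = colL -> exists w,
  [/\ lead N t = LWord w,
      if ~~ rooted is_beta t then size w = 1%N else (1 < size w)%N,
      lab (head letter0 w) = minlabel t & word_lab N w = minlabel t].
Proof.
move=> gt ot; have := leadP F gt; rewrite ot => -[w Lw Iw].
exists w; split=> //; [exact: wl_size Iw|exact: wl_head Iw|].
exact: wab_lab (wl_self Iw).
Qed.

(** In a normal product this is the largest of the least labels of the factors, which singles out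
    the factor to be split off. *)
Definition last_lab (t : tree gen) : nat :=
  if t is Node opAlpha _ b then minlabel b else minlabel t.

Lemma minlabel_neq x (a b c : tree gen) :
  uniq (labels (Node x a b)) -> {subset labels c <= labels a} ->
  minlabel c != minlabel b.
Proof.
rewrite labels_node cat_uniq => /and3P[_ /hasPn dis _] sub.
apply: contraTneq (minlabel_in c) => ->.
by apply: contra (dis _ (minlabel_in b)); apply: sub.
Qed.

Lemma last_lab_lt (a b : tree gen) : good N (Node opAlpha a b) ->
  (last_lab a < minlabel b)%N.
Proof.
move=> g; have [_ _ _ _ [lt_ab /norP[_ red]]] := good_node g.
have uq := good_uniq g.
case: a lt_ab red uq {g} => [//|x a1 a2] lt_ab red uq.
case: x lt_ab red uq => //= _ red uq; rewrite ltnNge leq_eqVlt negb_or red andbT.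
rewrite eq_sym; apply: minlabel_neq uq _ => i.
by rewrite labels_node mem_cat orbC => ->.
Qed.

(** With [last_lab_lt], this makes the piece of b the strict maximum in the lead of alpha(a, b). *)
Lemma piece_lab_le (t : tree gen) s : good N t -> lead N t = SMon s ->
  forall p, p \in s -> (piece_lab N p <= last_lab t)%N.
Proof.
have single t' s' p : good N t' -> outcol t' = colS -> lead N t' = SMon s' ->
    ~~ rooted is_alpha t' -> p \in s' -> (piece_lab N p <= minlabel t')%N.
  move=> g o; have [s'' [-> _ l _ r]] := lead_S g o; case=> <- /r[i [u eq_s]].
  rewrite eq_s inE => /eqP ->; move: l; rewrite eq_s /smon_lab /=.
  by have := good_min_lt g; lia.
elim: t s => [c i|x a IHa b _] s g ls p ps.
  by apply: (single _ _ _ g _ ls _ ps) => //; case: c ls {g}.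
have [ga gb oa ob [lt_ab red]] := good_node g.
have [rx|nx] := boolP (is_alpha x); last first.
  have -> : last_lab (Node x a b) = minlabel (Node x a b) by case: (x) nx.
  apply: (single _ _ _ g _ ls _ ps); last by case: (x) nx.
  by case: (x) nx ls => //= _; case.
case: x rx g ls oa ob red => //= _ g ls oa ob red.
have [sa [La na _ _ _]] := lead_S ga oa; have [sb [Lb _ _ _ _]] := lead_S gb ob.
move: ls; rewrite La Lb /= => -[eq_s]; move: ps.
rewrite -eq_s (perm_mem (perm_snorm _)) mem_cat => /orP[pa|pb].
  exact: leq_trans (IHa _ ga La p pa) (ltnW (last_lab_lt g)).
by apply: single Lb _ pb => //; case/norP: red.
Qed.

(** In nested brackets, the block of an outer right argument has least label at most that of the
    inner one, since the opposite order is a redex. *)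
Lemma head_tail_lab (t : tree gen) w : good N t -> outcol t = colL ->
  lead N t = LWord w -> forall x, x \in behead w ->
  exists a b, t = Node opBeta a b /\ (minlabel b <= lab x)%N.
Proof.
elim: t w => [c i|y a IHa b _] w g o.
  by case: c o {g} => //= _ [<-].
have [ga gb oa ob [lt_ab red]] := good_node g.
have [wt [Lt sz _ _]] := lead_L g o; rewrite Lt => -[<-] x xw.
have [ry|ny] := boolP (is_beta y); last first.
  move: sz xw; rewrite /= ny; by case: wt {Lt} => [|? []].
case: y ry g o Lt red oa ob sz => //= _ g _ Lt red oa ob _.
exists a, b; split=> //.
have [wa [La sza ha _]] := lead_L ga oa; have [wb [Lb szb hb lb]] := lead_L gb ob.
move: Lt; rewrite La Lb /= => -[eq_w].
have : x \in behead wa \/ x \in wb.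
  move: xw; rewrite -eq_w; case: (wa) sza => [|z wa'] _ /=.
    by move/mem_behead; right.
  by rewrite mem_cat => /orP[]; [left|right].
case=> [xa|xb]; last by rewrite -lb word_lab_le.
have [a1 [a2 [eq_a le_x]]] := IHa _ ga oa La x xa.
rewrite (leq_trans _ le_x) // leqNgt.
by move: red; rewrite eq_a.
Qed.

(* In the lead of beta(a, b) the block of b starts where the label of a letter
   other than the first one is least. *)
Lemma beta_tail_lab (a b : tree gen) w : good N (Node opBeta a b) ->
  lead N a = LWord w -> forall x, x \in behead w -> (minlabel b < lab x)%N.
Proof.
move=> g La x xw; have [ga _ oa _ [_ red]] := good_node g.
have [a1 [a2 [eq_a le_x]]] := head_tail_lab ga oa La xw.
apply: leq_trans le_x; rewrite ltn_neqAle leqNgt.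
move: red; rewrite eq_a /= => -> ; rewrite andbT eq_sym.
have := good_uniq g; rewrite eq_a; move=> uq; apply: minlabel_neq uq _ => i.
by rewrite labels_node mem_cat orbC => ->.
Qed.

Lemma perm_rcons_max (s s' : seq piece) p p' :
  (forall q, q \in s -> (piece_lab N q < piece_lab N p)%N) ->
  (forall q, q \in s' -> (piece_lab N q < piece_lab N p')%N) ->
  perm_eq (s ++ [:: p]) (s' ++ [:: p']) -> p = p' /\ perm_eq s s'.
Proof.
move=> lt lt' eq_s; suff eq_p : p = p'.
  by split=> //; rewrite -(perm_cat2r [:: p]) {2}eq_p.
have : p \in s' ++ [:: p'] by rewrite -(perm_mem eq_s) mem_cat inE eqxx orbT.
have : p' \in s ++ [:: p] by rewrite (perm_mem eq_s) mem_cat inE eqxx orbT.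
rewrite !mem_cat !inE => /orP[/lt lt1|/eqP -> //] /orP[/lt' lt2|/eqP //].
by move: (ltn_trans lt1 lt2); rewrite ltnn.
Qed.

(** If [u'] were longer than [u], the head of [v] would lie in the tail of [u'], giving [m' < m],
    while the head of [v'] would lie in [v], giving [m <= m']. *)
Lemma cat_min_inj (u v u' v' : word) m m' :
  (forall x, x \in behead u -> (m < lab x)%N) ->
  (forall x, x \in behead u' -> (m' < lab x)%N) ->
  (0 < size u)%N -> (0 < size u')%N -> (0 < size v)%N -> (0 < size v')%N ->
  lab (head letter0 v) = m -> lab (head letter0 v') = m' ->
  (forall x, x \in v -> (m <= lab x)%N) ->
  (forall x, x \in v' -> (m' <= lab x)%N) ->
  u ++ v = u' ++ v' -> u = u' /\ v = v'.
Proof.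
suff wlog_le (a b a' b' : word) n n' :
    (forall x, x \in behead a' -> (n' < lab x)%N) ->
    (0 < size a)%N -> (0 < size b)%N -> (0 < size b')%N ->
    lab (head letter0 b) = n -> lab (head letter0 b') = n' ->
    (forall x, x \in b -> (n <= lab x)%N) ->
    a ++ b = a' ++ b' -> (size a' <= size a)%N.
  move=> tu tu' u0 u'0 v0 v'0 hv hv' mv mv' eq_w.
  have sz : size u = size u'.
    apply/eqP; rewrite eqn_leq.
    by rewrite (wlog_le _ _ _ _ _ _ tu u'0 v'0 v0 hv' hv mv' (esym eq_w))
               (wlog_le _ _ _ _ _ _ tu' u0 v0 v'0 hv hv' mv eq_w).
  by move/eqP: eq_w; rewrite eqseq_cat // => /andP[/eqP -> /eqP ->].
move=> ta' a0 b0 b'0 hb hb' mb eq_w; rewrite leqNgt; apply/negP => lt_sz.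
have split_a' : a' = a ++ take (size a' - size a) b.
  have := congr1 (take (size a')) eq_w.
  rewrite (take_size_cat _ (erefl (size a'))) take_cat.
  by rewrite ltnNge (ltnW lt_sz) /= => ->.
have in_a' : head letter0 b \in behead a'.
  have : (0 < size a' - size a)%N by rewrite subn_gt0.
  move: split_a'; move: (size a' - size a)%N => k -> k0.
  case: (a) a0 => // y a1 _ /=; rewrite mem_cat.
  by case: (b) b0 => // z b1 _; case: k k0 => // k _; rewrite /= mem_head orbT.
have in_b : head letter0 b' \in b.
  have := congr1 (drop (size a')) eq_w.
  rewrite (drop_size_cat _ (erefl (size a'))) drop_cat.
  rewrite ltnNge (ltnW lt_sz) /= => eq_b'.
  apply: (@mem_drop (size a' - size a)%N); rewrite eq_b'.
  by case: (b') b'0 => // z b1 _; apply: mem_head.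
have := ta' _ in_a'; rewrite hb => lt1; have := mb _ in_b; rewrite hb' => le2.
by move: (leq_trans lt1 le2); rewrite ltnn.
Qed.

(* The subtrees of a node labelled d or e, or m or n, with the argument of
   colour S first. *)
Definition mixed_args (x : gen) (a b : tree gen) : tree gen * tree gen :=
  match x with opD | opM => (a, b) | _ => (b, a) end.

(** A lead does not tell d from e, nor m from n; the order of least labels in a shuffle tree
    does. *)
Lemma mixed_args_inj x x' a b a' b' :
  is_de x && is_de x' || is_mn x && is_mn x' ->
  (minlabel a < minlabel b)%N -> (minlabel a' < minlabel b')%N ->
  mixed_args x a b = mixed_args x' a' b' -> Node x a b = Node x' a' b'.
Proof.
move=> xx' lt lt'; case: x x' xx' => -[] //= _ [e1 e2];
  by [rewrite e1 e2 | move: lt lt'; rewrite e1 e2; lia].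
Qed.

Lemma mixed_args_good x a b : good N (Node x a b) -> is_de x || is_mn x ->
  let: (s, l) := mixed_args x a b in
  [/\ good N s, good N l, outcol s = colS & outcol l = colL].
Proof. by case/good_node; case: x. Qed.

Lemma lead_d x a b : good N (Node x a b) -> is_de x ->
  let: (s, l) := mixed_args x a b in exists i u y,
  [/\ lead N s = SMon [:: (i, u)], lead N l = LWord [:: y] &
      lead N (Node x a b) = SMon [:: (i, y :: u)]].
Proof.
move=> g dx; have := mixed_args_good g; rewrite dx => /(_ isT).
have [_ _ _ _ [_ red]] := good_node g.
case: x dx g red => //= _ g red [gs gl os ol]; case/norP: red => rs rl.
  have [s [-> _ _ _ /(_ rs)[i [u ->]]]] := lead_S gs os.
  have [w [-> sz _ _]] := lead_L gl ol.
  by move: sz; rewrite rl; case: w => [|y []] //= _; exists i, u, y.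
have [s [-> _ _ _ /(_ rs)[i [u ->]]]] := lead_S gs os.
have [w [-> sz _ _]] := lead_L gl ol.
by move: sz; rewrite rl; case: w => [|y []] //= _; exists i, u, y.
Qed.

Lemma lead_m x a b : good N (Node x a b) -> is_mn x ->
  let: (s, l) := mixed_args x a b in exists s0 w0,
  [/\ lead N s = SMon s0, lead N l = LWord w0 &
      lead N (Node x a b) = LWord [:: mletter N s0 w0]].
Proof.
move=> g mx; have := mixed_args_good g; rewrite mx orbT => /(_ isT).
case: x mx g => //= _ g [gs gl os ol].
  have [s [-> _ _ _ _]] := lead_S gs os; have [w [-> _ _ _]] := lead_L gl ol.
  by exists s, w.
have [s [-> _ _ _ _]] := lead_S gs os; have [w [-> _ _ _]] := lead_L gl ol.
by exists s, w.
Qed.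

Lemma lead_alpha a b : good N (Node opAlpha a b) -> exists s p,
  [/\ lead N a = SMon s, lead N b = SMon [:: p], snorm s = s /\ (0 < size s)%N,
      forall q, q \in s -> (piece_lab N q < piece_lab N p)%N &
      lead N (Node opAlpha a b) = SMon (snorm (s ++ [:: p]))].
Proof.
move=> g; have [ga gb oa ob [_ /norP[rb _]]] := good_node g.
have [s [La ns _ s0 _]] := lead_S ga oa.
have [t [Lb _ lb _ /(_ rb)[i [u eq_t]]]] := lead_S gb ob.
rewrite eq_t in Lb lb; exists s, (i, u); split=> //; last by rewrite /= La Lb.
move=> q qs; apply: leq_ltn_trans (piece_lab_le ga La qs) _.
apply: leq_trans (last_lab_lt g) _; rewrite -lb /smon_lab /=.
exact: geq_minl.
Qed.

Lemma lead_beta a b : good N (Node opBeta a b) -> exists u v,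
  [/\ lead N a = LWord u, lead N b = LWord v, (0 < size u)%N /\ (0 < size v)%N,
      forall x, x \in behead u -> (minlabel b < lab x)%N &
      lab (head letter0 v) = minlabel b /\
      forall x, x \in v -> (minlabel b <= lab x)%N].
Proof.
move=> g; have [ga gb oa ob _] := good_node g.
have [u [Lu su _ _]] := lead_L ga oa; have [v [Lv sv hv lv]] := lead_L gb ob.
exists u, v; split=> //.
- by split; [move: su | move: sv]; case: ifP => _; lia.
- exact: beta_tail_lab g Lu.
by split=> // x xv; rewrite -lv word_lab_le.
Qed.

(** One shape for each kind of root in [tree_shape]. The order of the clauses matters, as the lead
    of a leaf is also a single piece or a single letter. *)
Definition lead_shape (b : basis) : nat :=
  match b with
  | SMon [:: (_, [::])] => 0
  | LWord [:: (_, inl _)] => 1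
  | SMon [:: _] => 2
  | LWord [:: _] => 3
  | SMon _ => 4
  | LWord _ => 5
  end%N.

Definition tree_shape (t : tree gen) : nat :=
  match t with
  | Leaf colS _ => 0
  | Leaf colL _ => 1
  | Node x _ _ =>
      if is_de x then 2 else if is_mn x then 3 else if is_alpha x then 4 else 5
  end%N.

Lemma lead_shapeE (t : tree gen) : good N t -> lead_shape (lead N t) = tree_shape t.
Proof.
case: t => [[] i //|x a b] g.
have [dx|nd] := boolP (is_de x).
  have := lead_d g dx; case: mixed_args => s l [i [u [y [_ _ ->]]]].
  by rewrite /= dx.
have [mx|nm] := boolP (is_mn x).
  have := lead_m g mx; case: mixed_args => s l [s0 [w0 [_ _ ->]]].
  by rewrite /= mx (negPf nd).
case: x g nd nm => // g _ _.
  have [s [p [_ _ [_ s0] _ ->]]] := lead_alpha g.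
  have := perm_size (perm_snorm (s ++ [:: p])); rewrite size_cat addn1 /=.
  by case: (s) s0 => // q s1 _; case: (snorm _) => [|r [|r' s2]] //=; case: r => ? [].
have [u [v [La Lb [u0 v0] _ _]]] := lead_beta g.
rewrite /= La Lb /=; case: u u0 {La} => // x u _; case: v v0 {Lb} => // y v _.
by case: x => ? [] ?; case: u.
Qed.

(** The shape gives the kind of root. The leads of the arguments are then read off: from the first
    acting letter for d and e, from the code of the letter for m and n, from the piece of largest
    label for a product, from the unique cut for a bracket. *)
Lemma lead_inj (t t' : tree gen) :
  good N t -> good N t' -> lead N t = lead N t' -> t = t'.
Proof.
have [n] := ubnP (vertices t); elim: n t t' => // n IH t t' lt_n g g' eq_l.
have := congr1 lead_shape eq_l; rewrite !lead_shapeE //.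
case: t lt_n g eq_l => [c i|x a b] lt_n g eq_l.
  case: t' g' eq_l => [c' i'|x' a' b'] g'; last first.
    by case: c {g lt_n} => _ /=; do 3?case: ifP.
  by case: c g {lt_n}; case: c' g' => // _ _ [->].
case: t' g' eq_l => [c' i'|x' a' b'] g' eq_l.
  by case: c' {g' eq_l} => /=; do 3?case: ifP.
have [ga gb _ _ [lt_ab _]] := good_node g.
have [ga' gb' _ _ [lt_ab' _]] := good_node g'.
have IHa t : lead N a = lead N t -> good N t -> a = t.
  by move=> eq_a gt; apply: IH => //; move: lt_n => /=; lia.
have IHb t : lead N b = lead N t -> good N t -> b = t.
  by move=> eq_b gt; apply: IH => //; move: lt_n => /=; lia.
have mixed s l s' l' : mixed_args x a b = (s, l) -> mixed_args x' a' b' = (s', l') ->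
    lead N s = lead N s' -> lead N l = lead N l' -> (s, l) = (s', l').
  move=> eq_ab eq_ab' eq_s eq_l0.
  have good_args : good N s' /\ good N l' by case: x' eq_ab' {g' eq_l} => -[<- <-].
  case: good_args => gs gl; case: x eq_ab {g eq_l lt_n} => -[e1 e2];
  by move: eq_s eq_l0; rewrite -e1 -e2 => es el; congr pair;
  (apply: IHa || apply: IHb).
rewrite /=; have [dx|nd] := boolP (is_de x).
  have [dx' _|nd'] := boolP (is_de x'); last by do 2?case: ifP.
  apply: mixed_args_inj => //; first by rewrite dx dx'.
  have := lead_d g dx; have := lead_d g' dx'; rewrite eq_l.
  case E' : (mixed_args x' a' b') => [s' l']; case E : (mixed_args x a b) => [s l].
  move=> [i' [u' [y' [Ls' Ll' ->]]]] [i [u [y [Ls Ll [ei ey eu]]]]].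
  by apply: (mixed _ _ _ _ E E'); rewrite ?Ls ?Ls' ?Ll ?Ll' ?ei ?eu ?ey.
have [mx|nm] := boolP (is_mn x).
  have [dx'|nd'] := boolP (is_de x'); first by [].
  have [mx' _|nm'] := boolP (is_mn x'); last by case: ifP.
  apply: mixed_args_inj => //; first by rewrite mx mx' orbT.
  have := lead_m g mx; have := lead_m g' mx'; rewrite eq_l.
  case E' : (mixed_args x' a' b') => [s' l']; case E : (mixed_args x a b) => [s l].
  move=> [s0' [w0' [Ls' Ll' ->]]] [s0 [w0 [Ls Ll eq_w]]].
  have /mletter_inj[es ew] := congr1 (fun b => head letter0 (word_of b)) eq_w.
  by apply: (mixed _ _ _ _ E E'); rewrite ?Ls ?Ls' ?Ll ?Ll' ?es ?ew.
have [dx'|nd'] := boolP (is_de x'); first by case: ifP.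
have [mx'|nm'] := boolP (is_mn x'); first by case: ifP.
case: x g eq_l nd nm {mixed lt_n} => // g eq_l _ _;
  case: x' g' eq_l nd' nm' => // g' eq_l _ _ _.
  have [s [p [La Lb [ns _] lt_p Lab]]] := lead_alpha g.
  have [s' [p' [La' Lb' [ns' _] lt_p' Lab']]] := lead_alpha g'.
  move: eq_l; rewrite Lab Lab' => -[/snorm_eq_perm eq_s].
  have [eq_p /snorm_perm] := perm_rcons_max lt_p lt_p' eq_s.
  rewrite ns ns' => {}eq_s; congr Node.
    by apply: IHa => //; rewrite La La' eq_s.
  by apply: IHb => //; rewrite Lb Lb' eq_p.
have [u [v [La Lb [u0 v0] tu [hv mv]]]] := lead_beta g.
have [u' [v' [La' Lb' [u0' v0'] tu' [hv' mv']]]] := lead_beta g'.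
move: eq_l; rewrite /= La Lb La' Lb' /= => -[eq_w].
have [eq_u eq_v] := cat_min_inj tu tu' u0 u0' v0 v0' hv hv' mv mv' eq_w.
congr Node; first by apply: IHa => //; rewrite La La' eq_u.
by apply: IHb => //; rewrite Lb Lb' eq_v.
Qed.

Definition basis_weight (b : basis) : nat :=
  match b with
  | SMon s => smon_weight N s
  | LWord w => (word_value N w + word_weight w)%N
  end.

Lemma lead_coef (t : tree gen) : good N t ->
  (ev N (@generic_leaf F N) t)@_(lead N t) = 1.
Proof.
by move=> g; have := leadP F g; case: (outcol t) => -[s -> Is];
  [exact: sl_coef Is | exact: wl_coef Is].
Qed.

Lemma lead_min (t : tree gen) b : good N t ->
  b \in msupp (ev N (@generic_leaf F N) t) ->
  (basis_weight (lead N t) <= basis_weight b)%N /\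
  (basis_weight b = basis_weight (lead N t) -> b = lead N t).
Proof.
move=> g; have := leadP F g; case: (outcol t) => -[s -> Is].
  move=> /(sl_supp Is)[s' -> As] /=; split; first exact: sab_weight As.
  by move=> eq_w; rewrite (sab_eq As eq_w).
move=> /(wl_supp Is)[s' -> As] /=.
have [le_v le_w] := (wab_value As, wab_weight As); split; first by rewrite leq_add.
move=> eq_w; have [eq_v eq_wt] : word_value N s' = word_value N s /\
    word_weight s' = word_weight s by split; lia.
by rewrite (wab_eq As eq_v eq_wt).
Qed.

(** Take a tree of the support whose lead has least weight. Another tree with this lead among its
    terms has a lead of no greater weight, so of equal weight, so the same lead, and is the same
    tree. Nothing cancels the coefficient. *)
Lemma normal_independent (u : {malg F[tree gen]}) :
  (forall t, t \in msupp u -> good N t) ->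
  evl N (@generic_leaf F N) u = 0 -> u = 0.
Proof.
move=> gu ev_u; apply/malgP => t0; rewrite mcoeff0; apply/eqP.
rewrite mcoeff_eq0; apply/negP => t0u.
pose w t := basis_weight (lead N t).
have [t tu min_t] : exists2 t, t \in msupp u &
    forall s, s \in msupp u -> (w t <= w s)%N.
  have [n] := ubnP (w t0); elim: n t0 t0u => // n IH t0 t0u lt_n.
  case: (boolP (all (fun s => w t0 <= w s)%N (msupp u))) => [/allP min0|].
    by exists t0.
  by case/allPn => s su; rewrite -ltnNge => lt_s; apply: (IH s su); lia.
have := congr1 (mcoeff (lead N t)) ev_u; rewrite mcoeff0 /evl /lin mcoeff_sum.
have step s : s \in msupp u ->
    (u@_s *: ev N (@generic_leaf F N) s)@_(lead N t) = if s == t then u@_t else 0.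
  move=> su; rewrite mcoeffZ; case: eqP => [->|ne].
    by rewrite lead_coef ?mulr1 //; apply: gu.
  rewrite [X in _ * X]mcoeff_outdom ?mulr0 //; apply/negP => lt_s.
  have [le_w eq_w] := lead_min (gu s su) lt_s.
  apply: ne; apply: lead_inj; rewrite ?gu //; apply/esym/eq_w/eqP.
  by rewrite eqn_leq le_w [X in X && _]min_t.
rewrite (eq_big_seq _ step) sum_fset_delta => [/eqP|]; last first.
  by move/mcoeff_outdom.
by rewrite mcoeff_eq0 tu.
Qed.

End LeadInjective.

(** * Rewriting *)

Section SmartNodes.
Implicit Types (x : symgen) (a b t : tree gen).

(** The shuffle tree of a symmetric operation at [a] and [b], up to the sign of a reversed bracket.
    With it each rule is stated once for all numberings of the leaves. *)
Definition mk x a b : tree gen :=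
  if (minlabel a < minlabel b)%N then Node (shuffle_gen x) a b
  else Node (opposite_gen x) b a.

Definition sym_incol1 x : Defs.col := incol1 (shuffle_gen x).
Definition sym_incol2 x : Defs.col := incol2 (shuffle_gen x).

Definition ok t : bool := [&& well_coloured t, shuffle_tree t & uniq (labels t)].

Definition disj a b : bool := ~~ has (in_mem^~ (mem (labels a))) (labels b).

Lemma disjP a b :
  reflect (forall i, i \in labels a -> i \in labels b -> False) (disj a b).
Proof.
apply: (iffP hasPn) => [h i ia /h|h i ib]; first by rewrite ia.
by apply/negP => /h; apply.
Qed.

Lemma disjC a b : disj a b = disj b a.
Proof. by apply/disjP/disjP => h i ia ib; apply: (h i). Qed.

Lemma mkE x a b : disj a b ->
  (minlabel a < minlabel b)%N /\ mk x a b = Node (shuffle_gen x) a b \/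
  (minlabel b < minlabel a)%N /\ mk x a b = Node (opposite_gen x) b a.
Proof.
move=> /disjP dis; rewrite /mk; case: ltngtP => [||eq_m]; [by left|by right|].
by case: (dis (minlabel a)); rewrite ?minlabel_in // eq_m minlabel_in.
Qed.

Lemma leaves_mk x a b : perm_eq (leaves (mk x a b)) (leaves a ++ leaves b).
Proof. by rewrite /mk; case: ifP => _ //=; rewrite perm_catC. Qed.

Lemma labels_mk x a b : perm_eq (labels (mk x a b)) (labels a ++ labels b).
Proof. by rewrite /labels -map_cat perm_map ?leaves_mk. Qed.

Lemma mem_mk x a b i : (i \in labels (mk x a b)) = (i \in labels a) || (i \in labels b).
Proof. by rewrite (perm_mem (labels_mk x a b)) mem_cat. Qed.

Lemma outcol_mk x a b : outcol (mk x a b) = gen_outcol (shuffle_gen x).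
Proof. by rewrite /mk; case: ifP => //; case: x. Qed.

Lemma ok_mk x a b : ok a -> ok b -> disj a b ->
  outcol a = sym_incol1 x -> outcol b = sym_incol2 x -> ok (mk x a b).
Proof.
move=> /and3P[wa sa ua] /and3P[wb sb ub] dis oa ob.
rewrite /ok (perm_uniq (labels_mk x a b)) cat_uniq ua ub.
rewrite [~~ _]dis andbT; case: (mkE x dis) => -[lt_ab ->] /=;
  by rewrite oa ob wa wb sa sb lt_ab /sym_incol1 /sym_incol2; case: (x).
Qed.

Lemma ev_mk (F : fieldType) N (rho : Defs.col -> nat -> {malg F[basis]}) x a b :
  ~~ opposite_sign x || (minlabel a < minlabel b)%N ->
  ev N rho (mk x a b) = op_sym N x (ev N rho a) (ev N rho b).
Proof.
rewrite /mk; case: ifP => _ /=; first by rewrite op_shuffle.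
by rewrite orbF op_opposite => /negPf ->; rewrite scale1r.
Qed.

Lemma minlabel_mk x a b : minlabel (mk x a b) = minn (minlabel a) (minlabel b).
Proof. by rewrite /mk; case: ifP => _ //=; rewrite minnC. Qed.

Definition crit (i : nat) t (j : nat) : int := qcriterion i (path_word t j).

Lemma qcriterion_cons i y w : (i < 3)%N ->
  qcriterion i (y :: w) = qcriterion i [:: y] + qcriterion i w.
Proof.
case: i => [|[|[|//]]] _; rewrite ?qcriterion0 ?qcriterion1 ?qcriterion2 /=;
  by rewrite addn0 PoszD ?opprD.
Qed.

Lemma crit_node i y a b j : (i < 3)%N -> crit i (Node y a b) j =
  qcriterion i [:: y] + (if j \in labels a then crit i a j else crit i b j).
Proof.
by move=> lt_i; rewrite /crit /= qcriterion_cons //; case: (j \in labels a).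
Qed.

(** A generator and its opposite are on the same level, so the orientation chosen by [mk] does not
    affect these criteria. *)
Lemma crit_mk i x a b j : (i < 3)%N -> (j \in labels a) (+) (j \in labels b) ->
  crit i (mk x a b) j = qcriterion i [:: shuffle_gen x] +
    (if j \in labels a then crit i a j else crit i b j).
Proof.
move=> lt_i; rewrite /mk; case: ifP => _; rewrite crit_node //.
case: (j \in labels a); case: (j \in labels b) => // _; congr (_ + _);
  by case: i lt_i => [|[|[|//]]] _; case: x.
Qed.

(** A strict decrease within the first three criteria, which, unlike the exponent of [q], are
    additive along paths; hence the stability under contexts in [step_node]. *)
Definition below (t' t : tree gen) : Prop := exists i, exists j,
  [/\ (i < 3)%N,
      forall i' k, (i' < i)%N -> k \in labels t -> crit i' t' k = crit i' t k,
      j \in labels t, crit i t' j < crit i t j &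
      forall k, k \in labels t -> (k < j)%N -> crit i t' k = crit i t k].

(** A weak decrease at the smaller leaves is enough, since the least leaf with a strict decrease can
    be taken as witness. *)
Lemma below_intro i j t' t : (i < 3)%N ->
  (forall i' k, (i' < i)%N -> k \in labels t -> crit i' t' k = crit i' t k) ->
  j \in labels t -> crit i t' j < crit i t j ->
  (forall k, k \in labels t -> (k < j)%N -> crit i t' k <= crit i t k) ->
  below t' t.
Proof.
move=> lt_i eq_low jt lt_j le_k.
pose P k := (k \in labels t) && (crit i t' k < crit i t k).
have exP : exists k, P k by exists j; rewrite /P jt.
case: (ex_minnP exP) => m /andP[mt lt_m] min_m; exists i, m; split=> // k kt lt_k.
apply/eqP; rewrite eq_le le_k //=; last first.
  by apply: leq_trans lt_k _; apply: min_m; rewrite /P jt.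
rewrite leNgt; apply/negP => lt_crit.
by have := min_m k; rewrite /P kt lt_crit leqNgt lt_k => /(_ isT).
Qed.

Definition step (t' t : tree gen) : Prop :=
  [/\ perm_eq (leaves t') (leaves t), outcol t' = outcol t,
      well_coloured t', shuffle_tree t' & below t' t].

(** The new root adds the same constant on both sides at every leaf, and least labels and output
    colours are unchanged. *)
Lemma step_node y a b a' b' : ok (Node y a b) ->
  (step a' a /\ b' = b) \/ (a' = a /\ step b' b) ->
  step (Node y a' b') (Node y a b).
Proof.
rewrite /ok labels_node cat_uniq /= => /and3P[/and4P[/eqP oa /eqP ob wa wb]].
move=> /and3P[lt_ab sa sb] /and3P[_ /disjP dis _].
have mem_step c' c : step c' c -> labels c' =i labels c.
  by case=> p _ _ _ _; apply: perm_mem; apply: perm_map.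
have min_step c' c : step c' c -> minlabel c' = minlabel c.
  by case=> p _ _ _ _; apply: minlabel_perm; apply: perm_map.
case=> -[]; last first.
  move=> -> st; have [p o w s [i [j [lt_i low jb lt_j agree]]]] := st.
  have in_b k : k \in labels b -> (k \in labels a) = false.
    by move=> kb; apply/negP => ka; apply: (dis k).
  split=> /=; first by rewrite perm_cat2l.
  - by [].
  - by rewrite oa o ob wa w !eqxx.
  - by rewrite (min_step _ _ st) lt_ab sa s.
  exists i, j; split=> //.
  + move=> i' k lt_i' kt; rewrite !crit_node ?(ltn_trans lt_i') //.
    move: kt; rewrite labels_node mem_cat; case: (k \in labels a) => //= kb.
    by rewrite (low i') .
  + by rewrite labels_node mem_cat jb orbT.
  + by rewrite !crit_node // (in_b j jb) ltrD2l.
  move=> k kt lt_k; rewrite !crit_node //.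
  move: kt; rewrite labels_node mem_cat; case: (k \in labels a) => //= kb.
  by rewrite agree.
move=> st ->; have [p o w s [i [j [lt_i low ja lt_j agree]]]] := st.
split=> /=; first by rewrite perm_cat2r.
- by [].
- by rewrite o oa ob wb w !eqxx.
- by rewrite (min_step _ _ st) lt_ab sb s.
exists i, j; split=> //.
- move=> i' k lt_i' kt; rewrite !crit_node ?(ltn_trans lt_i') //.
  rewrite (mem_step _ _ st); case: ifP => // ka.
  by rewrite (low i').
- by rewrite labels_node mem_cat ja.
- by rewrite !crit_node // (mem_step _ _ st) ja ltrD2l.
move=> k kt lt_k; rewrite !crit_node // (mem_step _ _ st).
by case: ifP => // ka; rewrite agree.
Qed.

End SmartNodes.

Section Reductions.
Variables (F : fieldType) (N : nat).
Local Notation rho_type := (Defs.col -> nat -> {malg F[basis]}).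
Implicit Types (t a b x y z : tree gen).

(** Equality is asked after evaluation rather than modulo the ideal; independence of normal trees is
    also proved after evaluation, so the two fit together. *)
Definition reduces t (r : seq (F * tree gen)) : Prop :=
  (forall p, p \in r -> step p.2 t) /\
  forall rho : rho_type, ev N rho t = \sum_(p <- r) p.1 *: ev N rho p.2.

Lemma reduces_nodel (g : gen) a b r : ok (Node g a b) -> reduces a r ->
  reduces (Node g a b) [seq (p.1, Node g p.2 b) | p <- r].
Proof.
move=> okt [st eq_ev]; split=> [_ /mapP[p pr ->]|rho] /=.
  by apply: step_node => //; left; split=> //; apply: st.
rewrite big_map /= eq_ev; have := linear1_opl N g (ev N rho b) (@linear1_id F _).
by move=> lin_g; rewrite (linear1_sum _ _ _ lin_g).
Qed.

Lemma reduces_noder (g : gen) a b r : ok (Node g a b) -> reduces b r ->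
  reduces (Node g a b) [seq (p.1, Node g a p.2) | p <- r].
Proof.
move=> okt [st eq_ev]; split=> [_ /mapP[p pr ->]|rho] /=.
  by apply: step_node => //; right; split=> //; apply: st.
rewrite big_map /= eq_ev; have := linear1_opr N g (ev N rho a) (@linear1_id F _).
by move=> lin_g; rewrite (linear1_sum _ _ _ lin_g).
Qed.

Definition disj3 x y z := [&& disj x y, disj x z & disj y z].

Lemma disj_mk_l (g : symgen) a b c : disj (mk g a b) c = disj a c && disj b c.
Proof.
apply/disjP/andP => [h|[/disjP ha /disjP hb] i].
  by split; apply/disjP => i ia ic; apply: (h i); rewrite ?mem_mk ?ia ?orbT.
by rewrite mem_mk => /orP[/ha|/hb]; apply.
Qed.

Lemma disj_mk_r (g : symgen) a b c : disj c (mk g a b) = disj c a && disj c b.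
Proof. by rewrite disjC disj_mk_l !(disjC c). Qed.

Lemma disj3_mem x y z i : disj3 x y z ->
  [\/ i \notin labels x /\ i \notin labels y /\ i \notin labels z,
      [/\ i \in labels x, (i \in labels y) = false & (i \in labels z) = false],
      [/\ (i \in labels x) = false, i \in labels y & (i \in labels z) = false] |
      [/\ (i \in labels x) = false, (i \in labels y) = false & i \in labels z]].
Proof.
case/and3P=> /disjP xy /disjP xz /disjP yz.
have no (b : bool) : (b -> False) -> b = false by case: b => // h; case: h.
have [ix|ix] := boolP (i \in labels x).
  by constructor 2; split=> //; apply: no; [apply: xy ix|apply: xz ix].
have [iy|iy] := boolP (i \in labels y).
  by constructor 3; split; [exact: negbTE| by []|apply: no; apply: yz iy].
have [iz|iz] := boolP (i \in labels z).
  by constructor 4; split; [exact: negbTE|exact: negbTE|by []].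
by constructor 1.
Qed.

End Reductions.

(** * The rewriting rules at the root *)

Section RootReductions.
Variables (F : fieldType) (N : nat).

Lemma ok_node (g : gen) (a b : tree gen) : ok (Node g a b) ->
  [/\ ok a, ok b, outcol a = incol1 g, outcol b = incol2 g &
      (minlabel a < minlabel b)%N /\ disj a b].
Proof.
rewrite /ok labels_node cat_uniq /=.
case/and3P=> /and4P[/eqP oa /eqP ob wa wb] /and3P[lt_ab sa sb] /and3P[ua dis ub].
by rewrite wa wb sa sb ua ub.
Qed.

Lemma count_leaves_mk P (g : symgen) a b :
  count P (leaves (mk g a b)) = (count P (leaves a) + count P (leaves b))%N.
Proof. by rewrite (permP (leaves_mk g a b)) count_cat. Qed.

Lemma weightE :
  (((qcriterion 0 [:: opAlpha] = -1) * (qcriterion 0 [:: opBeta] = 0) *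
    (qcriterion 0 [:: opD] = 0) * (qcriterion 0 [:: opM] = 0)) *
   ((qcriterion 1 [:: opAlpha] = 0) * (qcriterion 1 [:: opBeta] = 0) *
    (qcriterion 1 [:: opD] = -1) * (qcriterion 1 [:: opM] = 0)) *
   (qcriterion 2 [:: opBeta] = 1))%type.
Proof. by []. Qed.

Section ThreeArguments.
Variables x y z : tree gen.
Hypotheses (okx : ok x) (oky : ok y) (okz : ok z) (dis : disj3 x y z).

Let dxy : disj x y. Proof. by case/and3P: dis. Qed.
Let dxz : disj x z. Proof. by case/and3P: dis. Qed.
Let dyz : disj y z. Proof. by case/and3P: dis. Qed.
Let dyx : disj y x. Proof. by rewrite disjC. Qed.
Let dzx : disj z x. Proof. by rewrite disjC. Qed.
Let dzy : disj z y. Proof. by rewrite disjC. Qed.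

Let step_intro (t' t : tree gen) :
  (forall P, count P (leaves t') = count P (leaves t)) ->
  outcol t' = outcol t -> ok t' -> below t' t -> step t' t.
Proof. by move=> /permP p o /and3P[w s _] bel; split. Qed.

Let miny k : k \in labels y -> (minlabel y <= k)%N. Proof. exact: minlabel_le. Qed.
Let minz k : k \in labels z -> (minlabel z <= k)%N. Proof. exact: minlabel_le. Qed.

Ltac mono_tac c1 c2 c3 := apply: step_intro;
  [ let P := fresh "P" in let a := fresh "a" in let b := fresh "b" in
    let c := fresh "c" in
    move=> P; rewrite !count_leaves_mk;
    move: (count P (leaves x)) (count P (leaves y)) (count P (leaves z)) => a b c;
    clear; lia
  | by rewrite !outcol_mk
  | repeat apply: ok_mk; try assumption;
    rewrite ?outcol_mk ?disj_mk_l ?disj_mk_r ?dxy ?dxz ?dyz ?dyx ?dzx ?dzy;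
    first [reflexivity | assumption]
  | ].

Ltac crit_tac k kt hx hy hz :=
  case: (disj3_mem k dis) => [[hx [hy hz]]|[hx hy hz]|[hx hy hz]|[hx hy hz]];
  [by move: kt; rewrite !mem_mk (negPf hx) (negPf hy) (negPf hz)| | |];
  repeat (rewrite crit_mk;
    [rewrite ?mem_mk ?hx ?hy ?hz; cbn [orb]|done|by rewrite ?mem_mk ?hx ?hy ?hz]);
  cbn [shuffle_gen].

Ltac compare_tac := rewrite ?(weightE, add0r);
  repeat match goal with |- context [crit ?i ?t ?k] =>
    let c := fresh "c" in move: (crit i t k) => c end;
  clear; first [reflexivity | lia].

Ltac ev_tac := repeat (rewrite ev_mk;
  last by rewrite ?minlabel_mk ?gtn_min ?leq_min; repeat match goal with
    | h : is_true (leq _ _) |- _ => rewrite ?h; clear h end; rewrite ?orbT);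
  cbn [op_sym].

(** The leaves of [x] get a second product on their paths, which lowers criterion 0. It rises only
    at [z], whose labels exceed the least one of [x]. *)
Lemma reduces_alpha_r : outcol x = colS -> outcol y = colS -> outcol z = colS ->
  (minlabel x < minlabel y)%N -> (minlabel x < minlabel z)%N ->
  reduces N (mk symAlpha x (mk symAlpha y z))
    [:: (1 : F, mk symAlpha (mk symAlpha x y) z)].
Proof.
move=> cx cy cz lt_xy lt_xz; split=> [p|rho]; last first.
  rewrite big_seq1 scale1r; ev_tac; apply/esym/eqP.
  by rewrite -subr_eq0 alphaA_assoc.
rewrite inE => /eqP ->; cbn [snd]; mono_tac cx cy cz.
have kt : minlabel x \in labels (mk symAlpha x (mk symAlpha y z)).
  by rewrite !mem_mk minlabel_in.
apply: (@below_intro 0 (minlabel x) _ _ isT) => [i' k| | |k {}kt lt_k].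
- by rewrite ltn0.
- exact: kt.
- crit_tac (minlabel x) kt hx hy hz; try (rewrite minlabel_in in hx; discriminate hx).
  compare_tac.
crit_tac k kt hx hy hz; try compare_tac.
by have := minz hz; rewrite leqNgt (ltn_trans lt_k lt_xz).
Qed.

(** Criterion 0 falls at [z] and rises at [y], whose labels come after the least one of [z]. *)
Lemma reduces_alpha_l : outcol x = colS -> outcol y = colS -> outcol z = colS ->
  (minlabel z < minlabel y)%N ->
  reduces N (mk symAlpha (mk symAlpha x y) z)
    [:: (1 : F, mk symAlpha (mk symAlpha x z) y)].
Proof.
move=> cx cy cz lt_zy; split=> [p|rho]; last first.
  rewrite big_seq1 scale1r; ev_tac.
  have asc u v w : alphaA (alphaA u v) w = alphaA u (alphaA v w) :> {malg F[basis]}.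
    by apply/eqP; rewrite -subr_eq0 alphaA_assoc.
  by rewrite 2!asc (alphaA_comm (ev N rho y)).
rewrite inE => /eqP ->; cbn [snd]; mono_tac cx cy cz.
have kt : minlabel z \in labels (mk symAlpha (mk symAlpha x y) z).
  by rewrite !mem_mk minlabel_in orbT.
apply: (@below_intro 0 (minlabel z) _ _ isT) => [i' k| | |k {}kt lt_k].
- by rewrite ltn0.
- exact: kt.
- crit_tac (minlabel z) kt hx hy hz; try (rewrite minlabel_in in hz; discriminate hz).
  compare_tac.
crit_tac k kt hx hy hz; try compare_tac.
by have := miny hy; rewrite leqNgt (ltn_trans lt_k lt_zy).
Qed.

(** Brackets do not count for criteria 0 and 1. Criterion 2 falls at [y] in the first term and at
    [x] in the second, and rises only at [z], whose labels come later. *)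
Lemma reduces_beta : outcol x = colL -> outcol y = colL -> outcol z = colL ->
  (minlabel x < minlabel y)%N -> (minlabel y < minlabel z)%N ->
  reduces N (mk symBeta (mk symBeta x y) z)
    [:: (1 : F, mk symBeta (mk symBeta x z) y); (1, mk symBeta x (mk symBeta y z))].
Proof.
move=> cx cy cz lt_xy lt_yz; have lt_xz := ltn_trans lt_xy lt_yz.
split=> [p|rho]; last first.
  rewrite sum_pair !scale1r; ev_tac.
  by apply/eqP; rewrite -subr_eq0 opprD addrA betaA_jacobi.
have kt j : j \in labels y \/ j \in labels x ->
    j \in labels (mk symBeta (mk symBeta x y) z).
  by rewrite !mem_mk => -[] ->; rewrite ?orbT.
rewrite !inE => /orP[] /eqP ->; cbn [snd]; mono_tac cx cy cz.
  apply: (@below_intro 2 (minlabel y) _ _ isT) => [|||k {}kt lt_k].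
  - case=> [k _ kt'|[k _ kt'|i' k]]; last by rewrite 2!ltnS ltn0.
      by crit_tac k kt' hx hy hz; compare_tac.
    by crit_tac k kt' hx hy hz; compare_tac.
  - by apply: kt; left; apply: minlabel_in.
  - crit_tac (minlabel y) (kt _ (or_introl (minlabel_in y))) hx hy hz;
      try (rewrite minlabel_in in hy; discriminate hy).
    compare_tac.
  crit_tac k kt hx hy hz; try compare_tac.
  by have := minz hz; rewrite leqNgt (ltn_trans lt_k lt_yz).
apply: (@below_intro 2 (minlabel x) _ _ isT) => [|||k {}kt lt_k].
- case=> [k _ kt'|[k _ kt'|i' k]]; last by rewrite 2!ltnS ltn0.
    by crit_tac k kt' hx hy hz; compare_tac.
  by crit_tac k kt' hx hy hz; compare_tac.
- by apply: kt; right; apply: minlabel_in.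
- crit_tac (minlabel x) (kt _ (or_intror (minlabel_in x))) hx hy hz;
    try (rewrite minlabel_in in hx; discriminate hx).
  compare_tac.
crit_tac k kt hx hy hz; try compare_tac.
by have := minz hz; rewrite leqNgt (ltn_trans lt_k lt_xz).
Qed.

(** In both terms [z] gains a product on its paths, and criterion 0 is unchanged at [x] and [y]. One
    of these loses a d, which would raise criterion 1, but criterion 0 is compared first at all
    leaves. *)
Lemma reduces_d_alpha : outcol x = colS -> outcol y = colS -> outcol z = colL ->
  reduces N (mk symD (mk symAlpha x y) z)
    [:: (1 : F, mk symAlpha x (mk symD y z)); (1, mk symAlpha (mk symD x z) y)].
Proof.
move=> cx cy cz; split=> [p|rho]; last first.
  rewrite sum_pair !scale1r; ev_tac.
  by apply/eqP; rewrite -subr_eq0 opprD addrA dA_derivation.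
have kt : minlabel z \in labels (mk symD (mk symAlpha x y) z).
  by rewrite !mem_mk minlabel_in orbT.
rewrite !inE => /orP[] /eqP ->; cbn [snd]; mono_tac cx cy cz.
  apply: (@below_intro 0 (minlabel z) _ _ isT) => [i' k| | |k {}kt lt_k].
  - by rewrite ltn0.
  - exact: kt.
  - crit_tac (minlabel z) kt hx hy hz; try (rewrite minlabel_in in hz; discriminate hz).
    compare_tac.
  by crit_tac k kt hx hy hz; compare_tac.
apply: (@below_intro 0 (minlabel z) _ _ isT) => [i' k| | |k {}kt lt_k].
- by rewrite ltn0.
- exact: kt.
- crit_tac (minlabel z) kt hx hy hz; try (rewrite minlabel_in in hz; discriminate hz).
  compare_tac.
by crit_tac k kt hx hy hz; compare_tac.
Qed.

(** Criterion 0 ties. Both terms have two d instead of one on the paths to [x], and no path has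
    fewer than before. *)
Lemma reduces_d_beta : outcol x = colS -> outcol y = colL -> outcol z = colL ->
  (minlabel y < minlabel z)%N ->
  reduces N (mk symD x (mk symBeta y z))
    [:: (1 : F, mk symD (mk symD x z) y); (-1, mk symD (mk symD x y) z)].
Proof.
move=> cx cy cz lt_yz; split=> [p|rho]; last first.
  rewrite sum_pair scale1r scaleN1r; ev_tac.
  by apply/eqP; rewrite -subr_eq0 opprB addrA addrAC dA_action.
have kt : minlabel x \in labels (mk symD x (mk symBeta y z)).
  by rewrite !mem_mk minlabel_in.
rewrite !inE => /orP[] /eqP ->; cbn [snd]; mono_tac cx cy cz.
  apply: (@below_intro 1 (minlabel x) _ _ isT) => [|||k {}kt lt_k].
  - case=> [k _ kt'|i' k]; last by rewrite ltnS ltn0.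
    crit_tac k kt' hx hy hz; compare_tac.
  - exact: kt.
  - crit_tac (minlabel x) kt hx hy hz; try (rewrite minlabel_in in hx; discriminate hx).
    compare_tac.
  by crit_tac k kt hx hy hz; compare_tac.
apply: (@below_intro 1 (minlabel x) _ _ isT) => [|||k {}kt lt_k].
- case=> [k _ kt'|i' k]; last by rewrite ltnS ltn0.
  crit_tac k kt' hx hy hz; compare_tac.
- exact: kt.
- crit_tac (minlabel x) kt hx hy hz; try (rewrite minlabel_in in hx; discriminate hx).
  compare_tac.
by crit_tac k kt hx hy hz; compare_tac.
Qed.

(** A product appears on the paths to [x] and [y], and none disappears. *)
Lemma reduces_m_m : outcol x = colS -> outcol y = colS -> outcol z = colL ->
  reduces N (mk symM x (mk symM y z)) [:: (1 : F, mk symM (mk symAlpha x y) z)].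
Proof.
move=> cx cy cz; split=> [p|rho]; last first.
  rewrite big_seq1 scale1r; ev_tac; apply/esym/eqP.
  by rewrite -subr_eq0 mA_action.
have kt : minlabel x \in labels (mk symM x (mk symM y z)).
  by rewrite !mem_mk minlabel_in.
rewrite inE => /eqP ->; cbn [snd]; mono_tac cx cy cz.
apply: (@below_intro 0 (minlabel x) _ _ isT) => [i' k| | |k {}kt lt_k].
- by rewrite ltn0.
- exact: kt.
- crit_tac (minlabel x) kt hx hy hz; try (rewrite minlabel_in in hx; discriminate hx).
  compare_tac.
by crit_tac k kt hx hy hz; compare_tac.
Qed.

End ThreeArguments.
End RootReductions.

Section Rewriting.
Variables (F : fieldType) (N : nat).

Lemma mk_lt x a b : (minlabel a < minlabel b)%N ->
  Node (shuffle_gen x) a b = mk x a b.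
Proof. by rewrite /mk => ->. Qed.

Lemma mk_gt x a b : (minlabel a < minlabel b)%N ->
  Node (opposite_gen x) a b = mk x b a.
Proof. by move=> lt_ab; rewrite /mk ltnNge (ltnW lt_ab). Qed.

Lemma disj3_intro x y z : disj x y -> disj x z -> disj y z -> disj3 x y z.
Proof. by rewrite /disj3 => -> -> ->. Qed.

(** Writing both vertices with [mk] brings d and e, and m and n, under the same six rules. *)
Lemma reduces_redex g a b : ok (Node g a b) -> redex_at g a b ->
  exists r : seq (F * tree gen), reduces N (Node g a b) r.
Proof.
move=> okt; have [oka okb ca cb [lt_ab dis]] := ok_node okt.
case: g ca cb okt => /= ca cb _.
- case/orP.
    case: b okb cb lt_ab dis => // -[] // b1 b2 okb _ lt_ab dis _.
    have [ok1 ok2 c1 c2 [lt12 d12]] := ok_node okb.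
    move: dis lt_ab; rewrite (mk_lt symAlpha lt12) disj_mk_r => /andP[d1 d2] lt_ab.
    rewrite (mk_lt symAlpha lt_ab); move: lt_ab.
    rewrite minlabel_mk leq_min => /andP[lt1 lt2].
    by eexists; apply: reduces_alpha_r => //; apply: disj3_intro.
  case: a oka ca lt_ab dis => // -[] // a1 a2 oka _ lt_ab dis lt_b.
  have [ok1 ok2 c1 c2 [lt12 d12]] := ok_node oka.
  move: dis lt_ab; rewrite (mk_lt symAlpha lt12) disj_mk_l => /andP[d1 d2].
  move=> lt_ab; rewrite (mk_lt symAlpha lt_ab).
  by eexists; apply: reduces_alpha_l => //; apply: disj3_intro.
- case: a oka ca lt_ab dis => // -[] // a1 a2 oka _ lt_ab dis lt_b.
  have [ok1 ok2 c1 c2 [lt12 d12]] := ok_node oka.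
  move: dis lt_ab; rewrite (mk_lt symBeta lt12) disj_mk_l => /andP[d1 d2].
  move=> lt_ab; rewrite (mk_lt symBeta lt_ab).
  by eexists; apply: reduces_beta => //; apply: disj3_intro.
- rewrite (mk_lt symD lt_ab) => /orP[].
    case: a oka ca lt_ab dis => // -[] // a1 a2 oka _ lt_ab dis _.
    have [ok1 ok2 c1 c2 [lt12 d12]] := ok_node oka.
    move: dis; rewrite (mk_lt symAlpha lt12) disj_mk_l => /andP[d1 d2].
    by eexists; apply: reduces_d_alpha => //; apply: disj3_intro.
  case: b okb cb lt_ab dis => // -[] // b1 b2 okb _ lt_ab dis _.
  have [ok1 ok2 c1 c2 [lt12 d12]] := ok_node okb.
  move: dis; rewrite (mk_lt symBeta lt12) disj_mk_r => /andP[d1 d2].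
  by eexists; apply: reduces_d_beta => //; apply: disj3_intro.
- rewrite (mk_gt symD lt_ab) => /orP[].
    case: b okb cb lt_ab dis => // -[] // b1 b2 okb _ lt_ab dis _.
    have [ok1 ok2 c1 c2 [lt12 d12]] := ok_node okb.
    move: dis; rewrite disjC (mk_lt symAlpha lt12) disj_mk_l => /andP[d1 d2].
    by eexists; apply: reduces_d_alpha => //; apply: disj3_intro.
  case: a oka ca lt_ab dis => // -[] // a1 a2 oka _ lt_ab dis _.
  have [ok1 ok2 c1 c2 [lt12 d12]] := ok_node oka.
  move: dis; rewrite disjC (mk_lt symBeta lt12) disj_mk_r => /andP[d1 d2].
  by eexists; apply: reduces_d_beta => //; apply: disj3_intro.
- rewrite (mk_lt symM lt_ab).
  case: b okb cb lt_ab dis => // -[] // b1 b2 okb _ lt_ab dis _;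
    have [ok1 ok2 c1 c2 [lt12 d12]] := ok_node okb.
    move: dis; rewrite (mk_lt symM lt12) disj_mk_r => /andP[d1 d2].
    by eexists; apply: reduces_m_m => //; apply: disj3_intro.
  move: dis; rewrite (mk_gt symM lt12) disj_mk_r => /andP[d1 d2].
  by eexists; apply: reduces_m_m => //; apply: disj3_intro; rewrite // disjC.
rewrite (mk_gt symM lt_ab).
case: a oka ca lt_ab dis => // -[] // a1 a2 oka _ lt_ab dis _;
  have [ok1 ok2 c1 c2 [lt12 d12]] := ok_node oka.
  move: dis; rewrite disjC (mk_lt symM lt12) disj_mk_r => /andP[d1 d2].
  by eexists; apply: reduces_m_m => //; apply: disj3_intro.
move: dis; rewrite disjC (mk_gt symM lt12) disj_mk_r => /andP[d1 d2].
by eexists; apply: reduces_m_m => //; apply: disj3_intro; rewrite // disjC.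
Qed.

Lemma reduces_not_normal t : ok t -> ~~ normal t ->
  exists r : seq (F * tree gen), reduces N t r.
Proof.
elim: t => //= g a IHa b IHb okt; have [oka okb _ _ _] := ok_node okt.
rewrite -/(normal a) -/(normal b) !negb_and negbK => /or3P[red|na|nb].
- exact: reduces_redex.
- by have [r red] := IHa oka na; eexists; apply: reduces_nodel red.
by have [r red] := IHb okb nb; eexists; apply: reduces_noder red.
Qed.

Lemma step_component chi c t' t : component_basis chi c t -> step t' t ->
  component_basis chi c t'.
Proof.
case/and3P=> /and3P[w s p] /eqP <- /eqP <- [pl o w' s' _].
have plab : perm_eq (labels t') (labels t) by apply: perm_map.
have ar : arity t' = arity t by apply: perm_size pl.
have u : uniq (labels t') by rewrite (perm_uniq plab) (perm_uniq p) iota_uniq.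
apply/and3P; split; last by rewrite o.
  by apply/and3P; split=> //; rewrite (permPl plab) ar.
apply/eqP; rewrite /incols ar; apply/eq_in_map => i i_in.
have it : i \in labels t by rewrite (perm_mem p).
by apply: leafcolP => //; rewrite (perm_mem pl) mem_leafcol.
Qed.

Definition crit_vector (t : tree gen) : seq int :=
  flatten [seq [seq crit i t j | j <- iota 1 (arity t)] | i <- iota 0 3].

Lemma crit_vector_lt t' t : tree_monomial t -> step t' t ->
  lex_lt (crit_vector t') (crit_vector t).
Proof.
move=> tm [pl _ _ _ [i [j [lt_i low jt lt_j agree]]]].
have ar : arity t' = arity t by apply: perm_size pl.
have mt k : (k \in labels t) = (k \in iota 1 (arity t)).
  by rewrite monomial_mem // mem_iota; lia.
rewrite lex_lt_le; apply/andP; split.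
  rewrite /crit_vector ar lex_le_flatten; first last.
  - by move=> k; rewrite !size_map.
  - exact: iota_ltn_sorted.
  move=> k _ agree_k; rewrite lex_le_map; last exact: iota_ltn_sorted.
  move=> l; rewrite -mt => lt agree_l.
  have [lt_ki|lt_ik|eq_k] := ltngtP k i.
  - by rewrite low.
  - have i_in : i \in iota 0 3 by rewrite mem_iota.
    have /eq_in_map := agree_k i i_in lt_ik; move/(_ j); rewrite -mt jt => /(_ isT).
    by move: lt_j => /[swap] ->; rewrite ltxx.
  subst k; have [lt_lj|lt_jl|->] := ltngtP l j; [by rewrite agree| |exact: ltW].
  have j_in : j \in iota 1 (arity t) by rewrite -mt.
  by move: lt_j; rewrite (agree_l j j_in lt_jl) ltxx.
apply/eqP => eq_v; have : crit i t' j = crit i t j.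
  move: eq_v; rewrite /crit_vector ar.
  have : i \in iota 0 3 by rewrite mem_iota.
  elim: (iota 0 3) => //= k r IH; rewrite inE => i_in /eqP.
  rewrite eqseq_cat ?size_map // => /andP[/eqP eq_k /eqP eq_r].
  case/orP: i_in eq_k => [/eqP <- /eq_in_map|i_in _]; last exact: IH.
  by apply; rewrite -mt.
by move: lt_j => /[swap] ->; rewrite ltxx.
Qed.

(** [crit_vector] is an initial segment of [qm_vector]; steps therefore decrease in every total
    extension of the QM-ordering. *)
Lemma step_qm_lt t' t : tree_monomial t -> step t' t -> qm_lt t' t.
Proof.
move=> tm st; have lt_v := crit_vector_lt tm st; case: st => pl _ _ _ _.
have ar : arity t' = arity t by apply: perm_size pl.
rewrite /qm_lt ar eqxx ltnn /=.
have vecE u : qm_vector u = crit_vector u ++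
    [seq qcriterion 3 w | w <- path_words u].
  by rewrite /qm_vector /crit_vector /path_words /= !cats0 -!catA -!map_comp.
rewrite !vecE lex_lt_cat ?lt_v // /crit_vector ar /=.
by rewrite !size_cat !size_map.
Qed.

End Rewriting.

(** * Leading terms of the relations *)

Section LeadingTerms.
Variable F : fieldType.

(** Integer coefficients and lists instead of elements over [F], so that homogeneity and leading
    terms can be settled by computation over the six permutations. *)
Definition relation_terms (r : seq (int * tree symgen)) (sigma : nat -> nat) :
    seq (int * tree gen) :=
  [seq (let: (b, t) := shuffle_form (relabel sigma p.2) in ((-1) ^+ b * p.1, t))
  | p <- r].

Definition shuffle_relation (i : nat) (sigma : nat -> nat) : {malg F[tree gen]} :=
  shuffle_element F (nth [::] dercom_relations i) sigma.

Definition terms (i : nat) (sigma : nat -> nat) : seq (int * tree gen) :=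
  relation_terms (nth [::] dercom_relations i) sigma.

Lemma shuffle_relationE i sigma : shuffle_relation i sigma =
  \sum_(q <- terms i sigma) << q.1%:~R *g q.2 >>.
Proof.
rewrite /shuffle_relation /shuffle_element big_map; apply: eq_bigr => p _.
case: (shuffle_form _) => b t /=; congr << _ *g _ >>.
by rewrite intrM rmorph_sign.
Qed.

Definition sigma3 (a b c : nat) (j : nat) : nat := nth 0%N [:: 0; a; b; c]%N j.

Lemma terms_sigma3 i (sigma : nat -> nat) : (i < size dercom_relations)%N ->
  terms i sigma = terms i (sigma3 (sigma 1%N) (sigma 2%N) (sigma 3%N)).
Proof.
move=> lt_i; rewrite /terms.
have : all (fun q : int * tree symgen => all [pred j in [:: 1; 2; 3]%N] (labels q.2))
    (nth [::] dercom_relations i).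
  have : all (all (fun q : int * tree symgen =>
    all [pred j in [:: 1; 2; 3]%N] (labels q.2))) dercom_relations by [].
  by move/(all_nthP [::]) => /(_ i lt_i).
elim: (nth _ _ _) => //= p r IH /andP[lp /IH ->].
suff -> : relabel sigma p.2 =
  relabel (sigma3 (sigma 1%N) (sigma 2%N) (sigma 3%N)) p.2 by [].
elim: (p.2) lp => [c j|x a IHa b IHb] /=.
  by rewrite andbT !inE => /or3P[] /eqP ->.
by rewrite labels_node all_cat => /andP[/IHa -> /IHb ->].
Qed.

Definition sigmas : seq (nat * nat * nat) :=
  [:: (1, 2, 3); (1, 3, 2); (2, 1, 3); (2, 3, 1); (3, 1, 2); (3, 2, 1)]%N.

Lemma perm_sigmas a b c :
  perm_eq [:: a; b; c] [:: 1; 2; 3]%N -> (a, b, c) \in sigmas.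
Proof.
move=> p; have u : uniq [:: a; b; c] by rewrite (perm_uniq p).
have mem x : x \in [:: a; b; c] -> x \in [:: 1; 2; 3]%N by rewrite (perm_mem p).
have := mem a; have := mem b; have := mem c; move: u; rewrite !inE !eqxx ?orbT /=.
move=> u /(_ isT) /or3P hc /(_ isT) /or3P hb /(_ isT) /or3P ha.
by case: ha u => /eqP ->; case: hb => /eqP ->; case: hc => /eqP ->.
Qed.

Definition terms_ok (ts : seq (int * tree gen)) : bool :=
  all (fun q => (vertices q.2 == 2) &&
    component_basis (incols (head (Leaf colS 1) (unzip2 ts)))
                    (outcol (head (Leaf colS 1) (unzip2 ts))) q.2) ts.

Lemma terms_okP :
  all (fun i => all (fun s => terms_ok (terms i (sigma3 s.1.1 s.1.2 s.2))) sigmas)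
    (iota 0 5).
Proof. by vm_compute. Qed.

(** Distinct trees with coefficients 1 or -1 keep the candidate from cancelling over any field. *)
Definition lead_ok (ts : seq (int * tree gen)) (t' : tree gen) : bool :=
  [&& t' \in unzip2 ts, uniq (unzip2 ts),
      all (fun q => (q.1 == 1) || (q.1 == -1)) ts,
      all (fun q => (q.2 == t') || qm_lt q.2 t') ts &
      all (fun q => tree_monomial q.2) ts].

Lemma uniq_map_inj (T U : eqType) (h : T -> U) (r : seq T) :
  uniq (map h r) -> {in r &, injective h}.
Proof.
elim: r => //= x r IH /andP[hx ur] p q; rewrite !inE.
case/orP=> [/eqP ->|pr] /orP[/eqP ->|qr] // eq_h; last exact: IH.
  by case/negP: hx; rewrite eq_h map_f.
by case/negP: hx; rewrite -eq_h map_f.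
Qed.

Lemma lead_okP le i sigma t' : qm_ordering le -> lead_ok (terms i sigma) t' ->
  leading_term le (shuffle_relation i sigma) t'.
Proof.
move=> [[le_refl _ _ _] _ le_qm] /and5P[t'_in uts /allP unit_ts /allP lt_ts /allP mon].
have t'_mon : tree_monomial t' by case/mapP: t'_in => q /mon tq ->.
rewrite shuffle_relationE; split=> [|s /msupp_sum[q qts]].
  rewrite -mcoeff_neq0 mcoeff_sum; case/mapP: t'_in => q qts ->.
  rewrite (bigD1_seq q qts (map_uniq uts)) /= mcoeffU eqxx mulr1n.
  rewrite big1_seq ?addr0 => [|p /andP[ne_pq pts]].
    by case/orP: (unit_ts q qts) => /eqP ->; rewrite ?mulrN1z ?oppr_eq0 oner_neq0.
  rewrite mcoeffU; case: eqP => // eq_pq; case/eqP: ne_pq.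
  exact: uniq_map_inj uts _ _ pts qts eq_pq.
rewrite msuppU; case: ifP => // _; rewrite inE => /eqP ->.
case/orP: (lt_ts q qts) => [/eqP ->|lt_q]; first exact: le_refl.
by have /andP[] := le_qm _ _ (mon q qts) t'_mon lt_q.
Qed.

(* The three-leaf trees with a redex at the root, the leaves being numbered so
   as to make them shuffle trees. *)
Definition pattern_l (g h : gen) (p : bool) : tree gen :=
  Node g (Node h (Leaf (incol1 h) 1) (Leaf (incol2 h) (if p then 2 else 3)))
         (Leaf (incol2 g) (if p then 3 else 2)).
Definition pattern_r (g h : gen) : tree gen :=
  Node g (Leaf (incol1 g) 1) (Node h (Leaf (incol1 h) 2) (Leaf (incol2 h) 3)).

(** Each entry gives a relation, a permutation by its values at 1, 2, 3, and the leading term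
    obtained: two for associativity, one for the Jacobi identity, three for the derivation rule
    (alpha is symmetric), three for the action of brackets (beta is skew), six for m. *)
Definition lead_table : seq (nat * (nat * nat * nat) * tree gen) :=
  [:: (0, (1, 2, 3), pattern_r opAlpha opAlpha);
      (0, (2, 1, 3), pattern_l opAlpha opAlpha false);
      (1, (1, 2, 3), pattern_l opBeta opBeta true);
      (2, (1, 2, 3), pattern_l opD opAlpha true);
      (2, (1, 3, 2), pattern_l opD opAlpha false);
      (2, (2, 3, 1), pattern_r opE opAlpha);
      (3, (1, 2, 3), pattern_r opD opBeta);
      (3, (3, 1, 2), pattern_l opE opBeta true);
      (3, (2, 1, 3), pattern_l opE opBeta false);
      (4, (1, 2, 3), pattern_r opM opM);
      (4, (1, 3, 2), pattern_r opM opN);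
      (4, (3, 1, 2), pattern_l opN opM true);
      (4, (2, 1, 3), pattern_l opN opM false);
      (4, (3, 2, 1), pattern_l opN opN true);
      (4, (2, 3, 1), pattern_l opN opN false)]%N.

Lemma lead_table_ok : all (fun e =>
  lead_ok (terms e.1.1 (sigma3 e.1.2.1.1 e.1.2.1.2 e.1.2.2)) e.2) lead_table.
Proof. by vm_compute. Qed.

(** In a left nesting [x] has the least label, but [y] and [z] may come in either order, which the
    Boolean of [pattern_l] records. *)
Lemma pattern_l_divides g h x y z : ok (Node g (Node h x y) z) ->
  (exists2 s, truncation (Node g (Node h x y) z) s &
    pattern_l g h (minlabel y < minlabel z)%N = standardize s).
Proof.
move=> okt; have [okl _ _ cz [lt_lz dis]] := ok_node okt.
have [_ _ cx cy [lt_xy _]] := ok_node okl.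
exists (Node g (Node h (Leaf (outcol x) (minlabel x)) (Leaf (outcol y) (minlabel y)))
               (Leaf (outcol z) (minlabel z))).
  by do 2?constructor; constructor.
have lt_xz : (minlabel x < minlabel z)%N.
  by move: lt_lz; rewrite /= (minn_idPl (ltnW lt_xy)).
have ne_yz : minlabel y != minlabel z.
  apply: contraL dis => /eqP eq_m; apply/negP => /disjP/(_ (minlabel y)); apply.
    by rewrite labels_node mem_cat minlabel_in orbT.
  by rewrite eq_m minlabel_in.
rewrite cx cy cz /standardize /pattern_l /labels /= !leqnn.
move: ne_yz lt_xy lt_xz; move: (minlabel x) (minlabel y) (minlabel z) => i j k.
move=> ne ij ik; rewrite (leqNgt j i) (leqNgt k i) (ltnW ij) (ltnW ik) ij ik /=.
by rewrite (leqNgt k j); case: (ltngtP j k) ne => //= _ _; congr Node;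
  congr Node; congr Leaf.
Qed.

Lemma pattern_r_divides g h x y z : ok (Node g x (Node h y z)) ->
  (exists2 s, truncation (Node g x (Node h y z)) s & pattern_r g h = standardize s).
Proof.
move=> okt; have [_ okr cx _ [lt_xr dis]] := ok_node okt.
have [_ _ cy cz [lt_yz _]] := ok_node okr.
exists (Node g (Leaf (outcol x) (minlabel x))
  (Node h (Leaf (outcol y) (minlabel y)) (Leaf (outcol z) (minlabel z)))).
  by do 2?constructor; constructor.
have lt_xy : (minlabel x < minlabel y)%N.
  by move: lt_xr; rewrite /= (minn_idPl (ltnW lt_yz)).
rewrite cx cy cz /standardize /pattern_r /labels /= !leqnn.
move: lt_xy lt_yz; move: (minlabel x) (minlabel y) (minlabel z) => i j k ij jk.
have ik := ltn_trans ij jk.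
by rewrite (leqNgt j i) (leqNgt k i) (leqNgt k j) ij ik jk (ltnW ij) (ltnW ik) (ltnW jk).
Qed.

(** Links the combinatorial notion of redex to leading terms of actual relations. *)
Lemma redex_pattern g a b : ok (Node g a b) -> redex_at g a b ->
  exists2 e, e \in lead_table &
    exists2 s, truncation (Node g a b) s & e.2 = standardize s.
Proof.
have found t' t : t' \in unzip2 lead_table ->
    (exists2 s, truncation t s & t' = standardize s) ->
    exists2 e, e \in lead_table & exists2 s, truncation t s & e.2 = standardize s.
  by case/mapP=> e eT -> div; exists e.
have rootP (P : pred gen) t : rooted P t -> exists h x y, t = Node h x y /\ P h.
  by case: t => // h x y; exists h, x, y.
move=> okt red; have left_case h x y : a = Node h x y ->
    (pattern_l g h (minlabel y < minlabel b)%N \in unzip2 lead_table) ->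
    exists2 e, e \in lead_table &
      exists2 s, truncation (Node g a b) s & e.2 = standardize s.
  by move=> eq_a inT; rewrite eq_a in okt *; apply: found inT (pattern_l_divides okt).
have right_case h x y : b = Node h x y -> (pattern_r g h \in unzip2 lead_table) ->
    exists2 e, e \in lead_table &
      exists2 s, truncation (Node g a b) s & e.2 = standardize s.
  by move=> eq_b inT; rewrite eq_b in okt *; apply: found inT (pattern_r_divides okt).
case: g {found okt} red left_case right_case => /= red left_case right_case.
- case/orP: red => [/rootP[h [x [y [eq_b]]]]|].
    by case: h eq_b => // eq_b _; apply: right_case eq_b _.
  move=> lt_b; have [x [y [E {}lt_b]]] : exists x y, a = Node opAlpha x y /\
      (minlabel b < minlabel y)%N.
    by case: (a) lt_b => // -[] // x y lt_b; exists x, y.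
  by apply: left_case E _; rewrite ltnNge (ltnW lt_b).
- have [x [y [E lt_b]]] : exists x y, a = Node opBeta x y /\
      (minlabel y < minlabel b)%N.
    by case: (a) red => // -[] // x y lt_b; exists x, y.
  by apply: left_case E _; rewrite lt_b.
- case/orP: red => /rootP[h [x [y [E]]]]; case: h E => // E _.
    by apply: left_case E _; case: ltnP.
  by apply: right_case E _.
- case/orP: red => /rootP[h [x [y [E]]]]; case: h E => // E _.
    by apply: right_case E _.
  by apply: left_case E _; case: ltnP.
- by case/rootP: red => h [x [y [E]]]; case: h E => // E _; apply: right_case E _.
case/rootP: red => h [x [y [E]]].
by case: h E => // E _; apply: left_case E _; case: ltnP.
Qed.

Lemma not_normal_divisible t : ok t -> ~~ normal t ->
  exists2 e, e \in lead_table & divides e.2 t.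
Proof.
elim: t => //= g a IHa b IHb okt; have [oka okb _ _ _] := ok_node okt.
rewrite -/(normal a) -/(normal b) !negb_and negbK => /or3P[red|na|nb].
- have [e eT [s st eq_s]] := redex_pattern okt red.
  by exists e => //; exists s => //; apply: SubtreeRoot.
- have [e eT [s st eq_s]] := IHa oka na.
  by exists e => //; exists s => //; apply: SubtreeLeft.
have [e eT [s st eq_s]] := IHb okb nb.
by exists e => //; exists s => //; apply: SubtreeRight.
Qed.

Lemma relation_of_sigma3 a b c i : (i < 5)%N -> (a, b, c) \in sigmas ->
  dercom_shuffle_relation (shuffle_relation i (sigma3 a b c)).
Proof.
move=> lt_i s_in; exists (sigma3 a b c), i; split=> //.
have : all (fun s => perm_eq [:: s.1.1; s.1.2; s.2] [:: 1; 2; 3]%N) sigmas by [].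
by move/allP/(_ _ s_in).
Qed.

Lemma relation_leading le t : qm_ordering le -> ok t -> ~~ normal t ->
  exists v t', [/\ dercom_shuffle_relation v, @leading_term F le v t' & divides t' t].
Proof.
move=> le_qm okt nt; have [e eT div] := not_normal_divisible okt nt.
exists (shuffle_relation e.1.1 (sigma3 e.1.2.1.1 e.1.2.1.2 e.1.2.2)), e.2.
split=> //; last by apply: lead_okP => //; apply: (allP lead_table_ok).
have : all (fun e => (e.1.1 < 5)%N && (e.1.2 \in sigmas)) lead_table by [].
move/allP/(_ e eT) => /andP[lt5 s_in]; apply: relation_of_sigma3 => //.
Qed.

Lemma relation_terms_ok v : dercom_shuffle_relation v -> exists i sigma,
  v = shuffle_relation i sigma /\ terms_ok (terms i sigma).
Proof.
case=> sigma [i [lt_i perm_s ->]]; exists i, sigma; split=> //.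
rewrite terms_sigma3 //; have i_in : i \in iota 0 5 by rewrite mem_iota.
exact: (allP (allP terms_okP i i_in) _ (perm_sigmas perm_s)).
Qed.

Lemma relation_homogeneous v : dercom_shuffle_relation v ->
  exists chi c, @in_component F chi c v.
Proof.
case/relation_terms_ok=> i [sigma [-> /allP okv]].
eexists; eexists => t; rewrite shuffle_relationE => /msupp_sum[q qv].
rewrite msuppU; case: ifP => // _; rewrite inE => /eqP ->.
by have /andP[_] := okv q qv; apply.
Qed.

Lemma relation_quadratic : quadratic (@dercom_shuffle_relation F).
Proof.
move=> v t /relation_terms_ok[i [sigma [-> /allP okv]]].
rewrite shuffle_relationE => /msupp_sum[q qv].
rewrite msuppU; case: ifP => // _; rewrite inE => /eqP ->.
by have /andP[/eqP] := okv q qv.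
Qed.

End LeadingTerms.

(** * Termination, normal forms and the conclusion *)

Section Digits.
Variable B : nat.

(** Entries between [-B] and [B] are shifted to digits in base 2B + 1. For equal lengths this embeds
    the lexicographic order into the naturals and yields a termination measure. *)
Fixpoint digits (v : seq int) : nat :=
  if v is x :: v' then (absz (x + B%:Z)%R * B.*2.+1 ^ size v' + digits v')%N else 0%N.

Definition bounded (v : seq int) : bool := all (fun x => - B%:Z <= x <= B%:Z) v.

Lemma digits_lt v : bounded v -> (digits v < B.*2.+1 ^ size v)%N.
Proof.
elim: v => //= x v IH /andP[x_in /IH]; rewrite expnS.
have : (absz (x + B%:Z)%R <= B.*2)%N by lia.
by move: (absz _) (digits v) (_ ^ _)%N => a n m; nia.
Qed.

Lemma lex_lt_digits v w : size v = size w -> bounded v -> bounded w ->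
  lex_lt v w -> (digits v < digits w)%N.
Proof.
elim: v w => [|x v IH] [|y w] //= [eq_sz] /andP[x_in bv] /andP[y_in bw].
rewrite lex_lt_cons -eq_sz => /orP[lt_xy|/andP[/eqP -> lt_vw]]; last first.
  by rewrite ltn_add2l IH.
have := digits_lt bv.
have : (absz (x + B%:Z)%R < absz (y + B%:Z)%R)%N by lia.
by move: (absz _) (absz _) (digits v) (_ ^ _)%N => a b n m; nia.
Qed.

End Digits.

Section NormalForms.
Variables (F : fieldType) (le : rel (tree gen)).
Hypothesis le_qm : qm_ordering le.
Variables (chi : seq Defs.col) (c : Defs.col).
Local Notation comp := (component_basis chi c).
(** Labels run from 1 to [size chi], so they are digits in base [N]. *)
Let N := (size chi).+1.

Lemma component_arity t : comp t -> arity t = size chi.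
Proof. by case/and3P=> _ /eqP <- _; rewrite size_map size_iota. Qed.

Lemma component_ok t : comp t -> ok t.
Proof.
by case/and3P=> tm _ _; have /and3P[w s _] := tm; rewrite /ok w s monomial_uniq.
Qed.

Lemma component_good t : comp t -> normal t -> good N t.
Proof.
move=> ct nt; have /and3P[w s u] := component_ok ct.
rewrite /good w s u nt andbT; apply/allP => i.
case/and3P: (ct) => tm _ _; rewrite monomial_mem // component_arity //.
by case/andP.
Qed.

Lemma size_path_word (t : tree gen) j : (size (path_word t j) < arity t)%N.
Proof.
elim: t => //= x a IHa b IHb; rewrite arity_node.
by case: ifP => _ /=; [move: IHa (arity_gt0 b) | move: IHb (arity_gt0 a)]; lia.
Qed.

Lemma crit_vector_bounded t : comp t -> bounded N (crit_vector t).
Proof.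
move=> ct; apply/allP => x /flattenP[v /mapP[i i_in ->] /mapP[j _ ->]].
have := size_path_word t j; rewrite component_arity // /crit.
move: (path_word t j) => w.
have := (count_size is_alpha w, count_size is_de w, count_size is_mnb w).
move: i_in; rewrite !inE => i_in [[h1 h2] h3] h4.
by case/or3P: i_in => /eqP ->; rewrite ?qcriterion0 ?qcriterion1 ?qcriterion2; lia.
Qed.

Let measure t := digits N (crit_vector t).

Lemma step_measure t' t : comp t -> step t' t -> (measure t' < measure t)%N.
Proof.
move=> ct st; have ct' := step_component ct st.
apply: lex_lt_digits; try exact: crit_vector_bounded.
  by rewrite /crit_vector !component_arity //= !size_cat !size_map.
by apply: crit_vector_lt => //; case/and3P: ct.
Qed.

Lemma comp_monomial_basis t : comp t -> tree_monomial t.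
Proof. by case/and3P. Qed.

Lemma step_le t' t : comp t -> step t' t -> le t' t && (t' != t).
Proof.
move=> ct st; have [_ _ lt_le] := le_qm.
apply: lt_le; [exact: comp_monomial_basis (step_component ct st)| |].
  exact: comp_monomial_basis ct.
exact: step_qm_lt (comp_monomial_basis ct) st.
Qed.

Lemma le_lt_trans_monomial s t' t : comp s -> comp t' -> comp t ->
  le s t' -> le t' t && (t' != t) -> le s t && (s != t).
Proof.
have [[_ anti tr _] _ _] := le_qm.
move=> /comp_monomial_basis ms /comp_monomial_basis mt' /comp_monomial_basis mt.
move=> le1 /andP[le2 ne]; rewrite (tr t' s t) //.
by apply: contraNneq ne => eq_st; apply/eqP/anti; rewrite // le2 -eq_st le1.
Qed.

Definition normal_below (t : tree gen) (u : {malg F[tree gen]}) : Prop :=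
  forall s, s \in msupp u -> [/\ comp s, normal s & le s t && (s != t)].

Lemma normal_below_sum (t : tree gen) (r : seq (F * tree gen)) : comp t ->
  (forall p, p \in r -> [/\ comp p.2, le p.2 t && (p.2 != t) &
     normal p.2 \/ exists2 u, normal_below p.2 u &
       forall rho, evl N rho u = ev N rho p.2]) ->
  exists2 u, normal_below t u &
    forall rho, evl N rho u = \sum_(p <- r) p.1 *: ev N rho p.2.
Proof.
move=> ct; elim: r => [|p r IH] hr.
  exists 0 => [s|rho]; first by rewrite msupp0 inE.
  by rewrite big_nil /evl linear0.
have [w wt ev_w] := IH (fun q qr => hr q (mem_behead (s := p :: r) qr)).
have [cp lt_p hp] := hr p (mem_head _ _).
have [u ut ev_u] : exists2 u, normal_below t u &
    forall rho, evl N rho u = ev N rho p.2.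
  case: hp => [np|[u up ev_u]].
    exists << p.2 >> => [s|rho]; last by rewrite /evl linU1.
    by move/in_msuppU1 => ->.
  exists u => // s /up[cs ns /andP[le_s _]]; split=> //.
  exact: le_lt_trans_monomial lt_p.
exists (p.1 *: u + w) => [s|rho].
  move/(fsubsetP (msuppD_le _ _)); rewrite inE => /orP[|/wt //].
  by move/(fsubsetP (msuppZ_le _ _))/ut.
by rewrite [LHS]lin_is_linear -!/(evl _ _ _) ev_u ev_w big_cons.
Qed.

(** Induction on [measure]; as every step also decreases for [le], the result stays strictly below
    [t]. *)
Lemma normal_form t : comp t -> ~~ normal t ->
  exists2 u, normal_below t u & forall rho, evl N rho u = ev N rho t.
Proof.
have [n] := ubnP (measure t); elim: n t => // n IH t lt_n ct nt.
have [r [st ev_t]] := reduces_not_normal F N (component_ok ct) nt.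
have [|u ut ev_u] := @normal_below_sum t r ct; last first.
  by exists u => // rho; rewrite ev_u ev_t.
move=> p pr; have stp := st p pr; have cp := step_component ct stp.
split=> //; first exact: step_le.
have [np|np] := boolP (normal p.2); first by left.
by right; apply: IH => //; apply: leq_trans (step_measure ct stp) _; rewrite -ltnS.
Qed.

(** If [t] were normal, replacing the other terms by normal forms strictly below [t] would give a
    combination of normal trees in the kernel with the same nonzero coefficient at [t], against
    independence. *)
Lemma kernel_leading_not_normal (u : {malg F[tree gen]}) t :
  ev_kernel N chi c u -> leading_term le u t -> ~~ normal t.
Proof.
move=> [uc u0] [tu le_t]; apply/negP => nt; have ct := uc t tu.
pose r := [seq (u@_s, s) | s <- msupp u & s != t].
have [|w wt ev_w] := @normal_below_sum t r ct.
  move=> p /mapP[s]; rewrite mem_filter => /andP[ne_st su] -> /=.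
  split; [exact: uc | by rewrite le_t|].
  have [ns|ns] := boolP (normal s); first by left.
  by right; apply: normal_form => //; apply: uc.
have : u@_t *: << t >> + w = 0.
  apply: (@normal_independent F N) => [s|].
    move/(fsubsetP (msuppD_le _ _)); rewrite inE => /orP[|/wt[cs ns _]].
      by move/(fsubsetP (msuppZ_le _ _))/in_msuppU1 => ->; apply: component_good.
    exact: component_good.
  rewrite [LHS]lin_is_linear -!/(evl _ _ _) ev_w /r big_map big_filter /=.
  rewrite {1}/evl linU1 -[RHS](u0 (@generic_leaf F N)).
  by rewrite /evl /lin [RHS](bigD1_seq t tu (fset_uniq _)).
move/(congr1 (mcoeff t)); rewrite mcoeffD mcoeffZ mcoeffU1_lead mulr1 mcoeff0.
rewrite (mcoeff_outdom (g := w)) ?addr0 => [/eqP|].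
  by rewrite mcoeff_eq0 tu.
by apply/negP => /wt[_ _]; rewrite eqxx andbF.
Qed.

End NormalForms.

Theorem theorem4p14 (F : fieldType) (charF0 : [pchar F]%R =i pred0) :
  (exists le : rel (tree gen), qm_ordering le) /\
  (forall le : rel (tree gen), qm_ordering le ->
     exists G : {malg F[tree gen]} -> Prop,
       quadratic G /\
       groebner_basis le (generated_ideal (@dercom_shuffle_relation F)) G).
Proof.
split=> [|le le_qm]; first exact: exists_qm_ordering.
(* The defining relations are themselves the basis, so generation is immediate and only divisibility
   of leading terms is at stake. *)
exists (@dercom_shuffle_relation F); split; first exact: relation_quadratic.
split=> [v|//|chi c u t uM lead_t]; first exact: relation_homogeneous.
have ker := relation_kernel (size chi).+1 uM.
have nt := kernel_leading_not_normal le_qm ker lead_t.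
have [[uc _] [tu _]] := (ker, lead_t).
have [v [t' [Gv lead_v div]]] := relation_leading F le_qm (component_ok (uc t tu)) nt.
by exists v, t'.
Qed.
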